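(* Let $\Omega_0,T_0\geq 2$ and $\varepsilon_T,\varepsilon_\Omega>0$. Let $f\in L^2(\mathbb{R})$ and assume that $$\int_{|t|>T_0}|f(t)|^2\,\mathrm{d}t\leq \varepsilon_T^2\|f\|_{L^2(\mathbb{R})}^2\quad\text{and}\quad \int_{|\omega|>\Omega_0}|\widehat{f}(\omega)|^2\,\mathrm{d}\omega\leq \varepsilon_\Omega^2\|f\|_{L^2(\mathbb{R})}^2.$$ Let $T\geq T_0$ and let $n$ be an integer with $n\geq \max(2T^2,2\Omega_0^2)$. Then $$\|f-K_nf\|_{L^2([-T,T])}\leq\left(2\varepsilon_T+\varepsilon_\Omega+\frac{34T^3}{\sqrt{2n+1}}\right)\|f\|_{L^2(\mathbb{R})}.$$
   Context: The Fourier transform is normalized by $\widehat{f}(\omega)=\frac{1}{\sqrt{2\pi}}\int_{\mathbb{R}}f(t)e^{-it\omega}\,\mathrm{d}t$ for $f\in L^1(\mathbb{R})$ (extended to $L^2(\mathbb{R})$ as usual). $H_k(x)=e^{x^2}\frac{\mathrm{d}^k}{\mathrm{d}x^k}e^{-x^2}$ is the $k$-th Hermite polynomial and $h_k(x)=\frac{1}{\pi^{1/4}\sqrt{2^k k!}}H_k(x)e^{-x^2/2}$ the $k$-th Hermite function; $(h_k)_{k\ge0}$ is an orthonormal basis of $L^2(\mathbb{R})$. $K_nf=\sum_{k=0}^n\langle f,h_k\rangle h_k$ is the orthogonal projection of $f$ onto the span of $h_0,\ldots,h_n$. *)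

(* Defs.v *)
From HB Require Import structures.
From mathcomp Require Import all_boot all_order all_algebra.
From mathcomp Require Import all_classical all_reals all_analysis.
From mathcomp.real_closed Require Import complex.

Set Implicit Arguments.
Unset Strict Implicit.
Unset Printing Implicit Defensive.
Import Order.TTheory GRing.Theory Num.Theory numFieldNormedType.Exports.

Local Open Scope classical_set_scope.
Local Open Scope ring_scope.

Section ComplexFunctions.
Context {R : realType}.
Implicit Types (f g : R -> R[i]) (D : set R).

(* [Normc.normc] is the modulus as an element of R; the norm [`|z|]
   that R[i] carries as a numeric field takes its values in R[i]. *)
Definition cabs (z : R[i]) : R := Normc.normc z.

Definition cmeasurable f : Prop :=
  measurable_fun [set: R] (fun x => complex.Re (f x)) /\
  measurable_fun [set: R] (fun x => complex.Im (f x)).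

(* Meaningful when f is integrable on D, i.e., when both parts are. *)
Definition cintegral D f : R[i] :=
  Complex (\int[lebesgue_measure]_(x in D) complex.Re (f x))
          (\int[lebesgue_measure]_(x in D) complex.Im (f x)).

Definition L2norm D f : \bar R :=
  ((\int[lebesgue_measure]_(x in D) (cabs (f x) ^+ 2)%:E) `^ 2^-1)%E.

Definition isL1 f : Prop :=
  cmeasurable f /\
  (\int[lebesgue_measure]_(x in [set: R]) (cabs (f x))%:E < +oo)%E.

Definition isL2 f : Prop := cmeasurable f /\ (L2norm [set: R] f < +oo)%E.

Definition inner f g : R[i] :=
  cintegral [set: R] (fun x => f x * conjc (g x)).

(* exp(i x) *)
Definition expi (x : R) : R[i] := Complex (cos x) (sin x).

Definition fourier f (w : R) : R[i] :=
  (Num.sqrt (2 * pi))^-1%:C%C *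
  cintegral [set: R] (fun t => f t * expi (- (t * w))).

(* [g] is (a representative of) the Fourier transform of the L^2 function [f]:
   the graph of the transform on L^2 is the closure in L^2 x L^2 of the graph
   of the integral transform on the intersection of L^1 and L^2. *)
Definition is_fourierL2 f g : Prop :=
  [/\ isL2 f, isL2 g &
   exists u : nat -> R -> R[i],
     [/\ forall k, isL1 (u k) /\ isL2 (u k),
         L2norm [set: R] (fun x => u k x - f x) @[k --> \oo] --> 0%E &
         L2norm [set: R] (fun w => fourier (u k) w - g w) @[k --> \oo]
           --> 0%E]].

End ComplexFunctions.

Section Hermite.
Context {R : realType}.

(* No sign factor (-1)^k in this normalization. *)
Definition hermite (k : nat) (x : R) : R :=
  expR (x ^+ 2) * derive1n k (fun y : R => expR (- y ^+ 2)) x.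

Definition hermite_fun (k : nat) (x : R) : R :=
  (pi `^ (4^-1) * Num.sqrt (2 ^+ k * k`!%:R))^-1 *
  hermite k x * expR (- (x ^+ 2) / 2).

Definition chermite_fun (k : nat) (x : R) : R[i] := (hermite_fun k x)%:C%C.

Definition hermite_proj (n : nat) (f : R -> R[i]) (x : R) : R[i] :=
  \sum_(k < n.+1) inner f (chermite_fun k) * chermite_fun k x.

End Hermite.

(* Main.v *)
(* Since [f] is almost supported in [-T, T], it can be replaced by g = 1_[-T,T] f at
   the price of eps_T ||f||, both in f - K_n f (Bessel) and in the Fourier tail
   (Plancherel).  Put l = sqrt (2n + 1), which is at least Omega_0.  By
   Christoffel-Darboux, 2 (x - y) k_n(x, y) is the Wronskian form
   h_n(x) h_n'(y) - h_n'(x) h_n(y) plus the small term (x - y) h_n(x) h_n(y); as h_n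
   solves u'' = (x^2 - l^2) u, near the origin it rotates in phase space like a free
   oscillator of frequency l, with an energy at 0 given by Wallis' integrals.  Hence
   k_n is within 17 T^2 / l of the sinc kernel sin (l s) / (pi s) on [-T, T]^2, and
   Cauchy-Schwarz turns this into 34 T^3 / l in operator norm.  The sinc kernel is the
   Fourier projection on [-l, l], so what it misses of g is the part of the spectrum of
   g beyond l.  When l < 34 T^3 the bound is Bessel's inequality.

   Plancherel is proved with Poisson kernels: damping the frequency by exp (- e w) and
   exchanging integrals gives a Poisson average, and e tends to 0. *)
Require Import Defs.
From HB Require Import structures.
From mathcomp Require Import all_boot all_order all_algebra.
From mathcomp Require Import all_classical all_reals all_analysis.
From mathcomp.real_closed Require Import complex.
From mathcomp Require Import measurable_realfun lebesgue_Rintegral ring lra zify.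

Set Implicit Arguments.
Unset Strict Implicit.
Unset Printing Implicit Defensive.
Import Order.TTheory GRing.Theory Num.Theory numFieldNormedType.Exports.

Local Open Scope classical_set_scope.
Local Open Scope ring_scope.

(** * Square-integrable functions *)

Section RealIntegral.
Context d (T : measurableType d) (R : realType)
  (mu : {measure set T -> \bar R}).
Implicit Types (f g : T -> R) (c : R).

(** The analysis is carried out on real functions: cosine and sine transforms replace the complex
    transform, frequencies are restricted to a half-line, and real and imaginary parts are estimated
    separately. Adding the two estimates must not lose a constant, so bilinear bounds are kept in
    the form (t x^2 + y^2 / t) / 2 with a free weight t, chosen only once both parts have been
    summed. Plancherel is proved as an equality for functions carried by a segment, which is what g
    requires; on L^1 and L^2 together the inequality is enough to pass to the transform of an L^2
    limit. The difficulty of the kernel bound is near the diagonal: the Wronskian is divided by 2 (x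
    - y), so each of its errors has to contain a factor |x - y|, while the energy at the origin,
    itself of order l, has to be known up to 2 / l. The kernel error obtained is (6 T^2 + 1) / l,
    relaxed to 17 T^2 / l; the passage from 17 T^2 to 34 T^3 is the length 2 T of the segment. *)

Definition summable f := mu.-integrable [set: T] (EFin \o f).

Local Notation "'I' f" := (Rintegral mu [set: T] f) (at level 10, f at level 8).

Lemma summable_measurable f : summable f -> measurable_fun [set: T] f.
Proof. by move=> /integrableP[/measurable_EFinP]. Qed.

Lemma summable_le f g : measurable_fun [set: T] f -> summable g ->
  (forall x, `|f x| <= g x) -> summable f.
Proof.
move=> mf ig fg; apply: (le_integrable measurableT _ _ ig).
  exact/measurable_EFinP.
by move=> x _; rewrite /= lee_fin (le_trans (fg x))// ler_norm.
Qed.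

Lemma summable0 : summable (cst 0).
Proof. exact: integrable0. Qed.

Lemma summableD f g : summable f -> summable g ->
  summable (fun x => f x + g x).
Proof. by move=> hf hg; exact: (integrableD measurableT hf hg). Qed.

Lemma summableZ c f : summable f -> summable (fun x => c * f x).
Proof. by move=> h; exact: (integrableZl measurableT c h). Qed.

Lemma summableN f : summable f -> summable (fun x => - f x).
Proof. by move=> h; exact: (integrableN h). Qed.

Lemma summableB f g : summable f -> summable g ->
  summable (fun x => f x - g x).
Proof. by move=> ? ?; apply: summableD => //; exact: summableN. Qed.

Lemma summable_norm f : summable f -> summable (fun x => `|f x|).
Proof. exact: integrable_norm. Qed.

Lemma summableMb f g c : measurable_fun [set: T] g -> (forall x, `|g x| <= c) ->
  summable f -> summable (fun x => g x * f x).
Proof.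
move=> mg gc hf; apply: (@summable_le _ (fun x => c * `|f x|)).
- by apply: measurable_funM => //; exact: summable_measurable.
- exact/summableZ/summable_norm.
- by move=> x; rewrite normrM ler_wpM2r.
Qed.

Lemma summable_sum (s : seq nat) (F : nat -> T -> R) :
  (forall k, summable (F k)) -> summable (fun x => \sum_(k <- s) F k x).
Proof.
move=> h; elim: s => [|k s ih].
  by under eq_fun do rewrite big_nil; exact: summable0.
by under eq_fun do rewrite big_cons; exact: summableD.
Qed.

Lemma eq_RintegralT f g : f =1 g -> I f = I g.
Proof. by move=> fg; apply: eq_Rintegral => x _. Qed.

Lemma RintegralDT f g : summable f -> summable g ->
  I (fun x => f x + g x) = I f + I g.
Proof. exact: RintegralD. Qed.

Lemma RintegralBT f g : summable f -> summable g ->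
  I (fun x => f x - g x) = I f - I g.
Proof. exact: RintegralB. Qed.

Lemma RintegralZT c f : summable f -> I (fun x => c * f x) = c * I f.
Proof. exact: RintegralZl. Qed.

Lemma Rintegral0T : I (cst 0) = 0.
Proof. by rewrite /Rintegral integral0. Qed.

Lemma Rintegral_sumT (s : seq nat) (F : nat -> T -> R) :
  (forall k, summable (F k)) ->
  I (fun x => \sum_(k <- s) F k x) = \sum_(k <- s) I (F k).
Proof.
move=> h; elim: s => [|k s ih].
  by rewrite big_nil; under eq_RintegralT do rewrite big_nil; exact: Rintegral0T.
rewrite big_cons; under eq_RintegralT do rewrite big_cons.
by rewrite RintegralDT ?ih//; exact: summable_sum.
Qed.

Lemma le_RintegralT f g : summable f -> summable g -> (forall x, f x <= g x) ->
  I f <= I g.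
Proof. by move=> ? ? fg; apply: le_Rintegral. Qed.

Lemma Rintegral_ge0T f : (forall x, 0 <= f x) -> 0 <= I f.
Proof. by move=> f0; apply: Rintegral_ge0. Qed.

Lemma normr_le_RintegralT f : summable f -> `|I f| <= I (fun x => `|f x|).
Proof. exact: le_normr_Rintegral. Qed.

Lemma normr_Rintegral_le f g : measurable_fun [set: T] f -> summable g ->
  (forall x, `|f x| <= g x) -> `|I f| <= I g.
Proof.
move=> mf ig fg; have hf := summable_le mf ig fg.
by apply: (le_trans (normr_le_RintegralT hf)); apply: le_RintegralT => //;
  exact: summable_norm.
Qed.

Lemma Rintegral_EFin f : summable f ->
  (\int[mu]_x (f x)%:E)%E = (I f)%:E.
Proof. by move=> hf; rewrite /Rintegral fineK//; exact: integrable_fin_num. Qed.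

Lemma summableP f : measurable_fun [set: T] f ->
  (\int[mu]_x (`|f x|)%:E < +oo)%E -> summable f.
Proof. by move=> mf h; apply/integrableP; split => //; exact/measurable_EFinP. Qed.

Lemma Rintegral_dominated_cvg (f_ : nat -> T -> R) f g :
  (forall n, measurable_fun [set: T] (f_ n)) ->
  (forall x, f_ n x @[n --> \oo] --> f x) -> summable g ->
  (forall n x, `|f_ n x| <= g x) ->
  I (f_ n) @[n --> \oo] --> I f.
Proof.
move=> mf_ ff ig fg.
have mf : measurable_fun [set: T] f.
  apply: (@measurable_fun_cvg _ _ _ _ f_) => // x _; exact: ff.
have [iff _ h] : [/\ mu.-integrable setT (EFin \o f), 
  [sequence \int[mu]_x (`|(f_ n x)%:E - (f x)%:E|)]_n%E @ \oo --> 0%E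
  & [sequence \int[mu]_x (f_ n x)%:E]_n%E @ \oo --> (\int[mu]_x (f x)%:E)%E].
  apply: (@dominated_convergence _ _ _ mu setT measurableT
    (fun n => EFin \o f_ n) (EFin \o f) (EFin \o g)) => //.
  - by move=> n; exact/measurable_EFinP.
  - exact/measurable_EFinP.
  - apply: aeW => x _; apply: cvg_EFin; last exact: ff.
    by apply: nearW.
  - by apply: aeW => x n _; rewrite lee_fin.
rewrite Rintegral_EFin// in h.
exact: (fine_cvg h).
Qed.


(** Gives integrability of the limit along with its bound. The exponential weight, the Poisson
    kernel and the spectral energies are all shown integrable this way. *)
Lemma Rintegral_fatou (f_ : nat -> T -> R) f c :
  (forall n, summable (f_ n)) -> (forall n x, 0 <= f_ n x) ->
  (forall x, f_ n x @[n --> \oo] --> f x) ->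
  (forall n, I (f_ n) <= c) -> summable f /\ I f <= c.
Proof.
move=> sf f0 ff fc.
have mf_ n : measurable_fun setT (f_ n) by exact: summable_measurable.
have mf : measurable_fun [set: T] f.
  by apply: (@measurable_fun_cvg _ _ _ _ f_) => // x _; exact: ff.
have f_ge0 x : 0 <= f x.
  rewrite -(cvg_lim (@Rhausdorff R) (ff x)); apply: limr_ge.
    by apply/cvg_ex; exists (f x); exact: ff.
  exact: nearW.
have limE x : limn_einf (fun n => (f_ n x)%:E) = (f x)%:E.
  have h : (f_ n x)%:E @[n --> \oo] --> (f x)%:E.
    by apply: cvg_EFin; [exact: nearW|exact: ff].
  by rewrite (cvg_limn_einf_sup h).1.
have le : (\int[mu]_x (f x)%:E <= c%:E)%E.
  have := @fatou _ _ _ mu setT measurableT (fun n x => (f_ n x)%:E)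
     (fun n => (measurable_EFinP _ _).2 (mf_ n))
     (fun n x _ => f0 n x).
  under eq_integral do rewrite limE.
  move=> /le_trans; apply.
  rewrite limn_einf_lim; apply: lime_le; first exact: is_cvg_einfs.
  apply: nearW => n; apply: (@le_trans _ _ (\int[mu]_x (f_ n x)%:E)%E).
    by apply: ereal_inf_lbound; exists n => /=.
  by rewrite Rintegral_EFin// lee_fin.
have sumf : summable f.
  apply: summableP => //; under eq_integral do rewrite ger0_norm//.
  by rewrite (le_lt_trans le)// ltry.
by split => //; rewrite -lee_fin -Rintegral_EFin.
Qed.

Definition sqsummable f := measurable_fun [set: T] f /\ summable (fun x => f x ^+ 2).

Definition ip f g := I (fun x => f x * g x).

Lemma summable_mul f g : sqsummable f -> sqsummable g ->
  summable (fun x => f x * g x).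
Proof.
move=> [mf sf] [mg sg]; apply: (summable_le _ (summableD sf sg)).
  exact: measurable_funM.
move=> x; rewrite normrM -[f x ^+ 2]real_normK ?num_real//.
rewrite -[g x ^+ 2]real_normK ?num_real//.
have := sqr_ge0 (`|f x| - `|g x|); have := mulr_ge0 (normr_ge0 (f x)) (normr_ge0 (g x)).
by nra.
Qed.

Lemma sqsummableD f g : sqsummable f -> sqsummable g ->
  sqsummable (fun x => f x + g x).
Proof.
move=> hf hg; split; first by apply: measurable_funD; [case: hf|case: hg].
under eq_fun do rewrite sqrrD -mulr_natl.
apply: summableD; last by case: hg.
apply: summableD; first by case: hf.
exact/summableZ/summable_mul.
Qed.

Lemma sqsummableZ c f : sqsummable f -> sqsummable (fun x => c * f x).
Proof.
move=> [mf sf]; split; first exact: measurable_funM.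
by under eq_fun do rewrite exprMn; exact: summableZ.
Qed.

Lemma sqsummableB f g : sqsummable f -> sqsummable g ->
  sqsummable (fun x => f x - g x).
Proof.
move=> hf hg; have := sqsummableD hf (sqsummableZ (-1) hg).
by under eq_fun do rewrite mulN1r.
Qed.

Lemma sqsummableMb f g c : measurable_fun [set: T] g -> (forall x, `|g x| <= c) ->
  sqsummable f -> sqsummable (fun x => g x * f x).
Proof.
move=> mg gc [mf sf]; split; first exact: measurable_funM.
under eq_fun do rewrite exprMn; apply: (@summableMb _ _ (c ^+ 2)) => //.
  exact: measurable_funX.
by move=> x; rewrite normrX lerXn2r ?nnegrE// (le_trans _ (gc x)).
Qed.

Lemma sqsummable_sum (s : seq nat) (F : nat -> T -> R) :
  (forall k, sqsummable (F k)) -> sqsummable (fun x => \sum_(k <- s) F k x).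
Proof.
move=> h; elim: s => [|k s ih].
  under eq_fun do rewrite big_nil; split => //.
  by under eq_fun do rewrite expr0n; exact: summable0.
by under eq_fun do rewrite big_cons; exact: sqsummableD.
Qed.

Lemma ipC f g : ip f g = ip g f.
Proof. by apply: eq_RintegralT => x; rewrite mulrC. Qed.

Lemma ip_ge0 f : 0 <= ip f f.
Proof. by apply: Rintegral_ge0T => x; rewrite -expr2 sqr_ge0. Qed.

Lemma ipDl f g h : sqsummable f -> sqsummable g -> sqsummable h ->
  ip (fun x => f x + g x) h = ip f h + ip g h.
Proof.
move=> hf hg hh; rewrite /ip; under eq_RintegralT do rewrite mulrDl.
by rewrite RintegralDT//; exact: summable_mul.
Qed.

Lemma ipZl c f g : sqsummable f -> sqsummable g ->
  ip (fun x => c * f x) g = c * ip f g.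
Proof.
move=> hf hg; rewrite /ip; under eq_RintegralT do rewrite -mulrA.
by rewrite RintegralZT//; exact: summable_mul.
Qed.

Lemma ipBl f g h : sqsummable f -> sqsummable g -> sqsummable h ->
  ip (fun x => f x - g x) h = ip f h - ip g h.
Proof.
move=> hf hg hh; rewrite /ip; under eq_RintegralT do rewrite mulrBl.
by rewrite RintegralBT//; exact: summable_mul.
Qed.

Lemma ip_suml (s : seq nat) (F : nat -> T -> R) g : (forall k, sqsummable (F k)) ->
  sqsummable g -> ip (fun x => \sum_(k <- s) F k x) g = \sum_(k <- s) ip (F k) g.
Proof.
move=> hF hg; rewrite /ip -Rintegral_sumT; last by move=> k; exact: summable_mul.
by apply: eq_RintegralT => x; rewrite mulr_suml.
Qed.

End RealIntegral.

(** * Integral operators with a bounded kernel *)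

Section KernelFubini.
Context d1 d2 (T1 : measurableType d1) (T2 : measurableType d2) (R : realType)
  (m1 : {sigma_finite_measure set T1 -> \bar R})
  (m2 : {sigma_finite_measure set T2 -> \bar R}).
Variables (K : T1 * T2 -> R) (c : R).
Hypotheses (mK : measurable_fun [set: T1 * T2] K) (Kc : forall z, `|K z| <= c).

Lemma measurable_kernel_section1 x : measurable_fun [set: T2] (fun y => K (x, y)).
Proof. exact: measurableT_comp. Qed.

Lemma measurable_kernel_section2 y : measurable_fun [set: T1] (fun x => K (x, y)).
Proof. exact: measurableT_comp. Qed.

Lemma summable_kernel1 v x : summable m2 v -> summable m2 (fun y => K (x, y) * v y).
Proof.
by apply: summableMb (fun y => Kc (x, y)); exact: measurable_kernel_section1.
Qed.

Lemma summable_kernel2 u y : summable m1 u -> summable m1 (fun x => K (x, y) * u x).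
Proof.
by apply: summableMb (fun x => Kc (x, y)); exact: measurable_kernel_section2.
Qed.

(** Tonelli's measurability statement concerns nonnegative functions, hence the splitting into
    positive and negative parts. *)
Lemma measurable_kernel_integral v : summable m2 v ->
  measurable_fun [set: T1] (fun x => Rintegral m2 setT (fun y => K (x, y) * v y)).
Proof.
move=> sv; pose F (z : T1 * T2) := (K z * v z.2)%:E.
have mF : measurable_fun setT F.
  apply/measurable_EFinP; apply: measurable_funM => //.
  by apply: measurableT_comp => //; exact: summable_measurable sv.
apply: (measurableT_comp (fine_measurable measurableT)) => /=.
rewrite (_ : (fun x => _) =
  (fun x => fubini_F m2 F^\+%E x - fubini_F m2 F^\-%E x)%E); last first.
  apply/funext => x; rewrite -[X in integral m2 setT X]/(F \o pair x) integralE.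
  under eq_integral do rewrite funepos_comp/=.
  by under [X in (_ - X)%E = _]eq_integral do rewrite funeneg_comp/=.
apply: (@emeasurable_funB _ _ _ setT (fubini_F m2 F^\+%E) (fubini_F m2 F^\-%E)); apply: measurable_fun_fubini_tonelli_F => //.
  exact: measurable_funepos.
exact: measurable_funeneg.
Qed.

Lemma normr_kernel_integral v x : summable m2 v ->
  `|Rintegral m2 setT (fun y => K (x, y) * v y)| <=
    c * Rintegral m2 setT (fun y => `|v y|).
Proof.
move=> sv; rewrite -RintegralZT; last exact: summable_norm.
apply: normr_Rintegral_le.
- exact/summable_measurable/summable_kernel1.
- exact/summableZ/summable_norm.
- by move=> y; rewrite normrM ler_wpM2r.
Qed.

Lemma summable_kernel_integral u v : summable m1 u -> summable m2 v ->
  summable m1 (fun x => u x * Rintegral m2 setT (fun y => K (x, y) * v y)).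
Proof.
move=> su sv; under eq_fun do rewrite mulrC.
apply: (summableMb (c := c * Rintegral m2 setT (fun y => `|v y|))) => //.
  exact: measurable_kernel_integral.
by move=> x; exact: normr_kernel_integral.
Qed.

(** Since [K] is bounded by [c], the product u(x) K(x, y) v(y) is dominated by c |u(x)| |v(y)|,
    which is integrable on the product space. *)
Lemma kernel_fubini u v : summable m1 u -> summable m2 v ->
  Rintegral m1 setT (fun x => u x * Rintegral m2 setT (fun y => K (x, y) * v y)) =
  Rintegral m2 setT (fun y => v y * Rintegral m1 setT (fun x => K (x, y) * u x)).
Proof.
move=> su sv; pose F (z : T1 * T2) := (u z.1 * (K z * v z.2))%:E.
have mF : measurable_fun setT F.
  apply/measurable_EFinP; apply: measurable_funM.
    by apply: measurableT_comp => //; exact: summable_measurable su.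
  apply: measurable_funM => //.
  by apply: measurableT_comp => //; exact: summable_measurable sv.
have iF : (m1 \x m2)%E.-integrable setT F.
  apply/(integrable12ltyP _ _ mF).
  pose C := c * Rintegral m2 setT (fun y => `|v y|).
  apply: (@le_lt_trans _ _ (\int[m1]_x (C * `|u x|)%:E)%E); last first.
    by rewrite (Rintegral_EFin (summableZ C (summable_norm su))) ltry.
  apply: ge0_le_integral => //=.
  - by move=> x _; apply: integral_ge0.
  - apply: (measurable_fun_fubini_tonelli_F (abse \o F)).
    exact: measurableT_comp.
    by move=> z; exact: abse_ge0.
  - exact: (measurable_int m1 (summableZ C (summable_norm su))).
  move=> x _.
  have sx : summable m2 (fun y => `|u x * (K (x, y) * v y)|).
    exact/summable_norm/summableZ/summable_kernel1.
  rewrite (Rintegral_EFin sx) lee_fin /C mulrC.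
  under eq_RintegralT do rewrite normrM.
  rewrite RintegralZT; last exact/summable_norm/summable_kernel1.
  rewrite ler_wpM2l// -RintegralZT; last exact: summable_norm.
  apply: le_RintegralT; first exact/summable_norm/summable_kernel1.
    exact/summableZ/summable_norm.
  by move=> y; rewrite normrM ler_wpM2r.
have := Fubini iF; rewrite /Rintegral => h.
congr fine; transitivity (\int[m1]_x \int[m2]_y F (x, y))%E.
  apply: eq_integral => x _.
  rewrite -/(Rintegral m2 setT _) -RintegralZT; last exact: summable_kernel1.
  by rewrite -Rintegral_EFin//; exact/summableZ/summable_kernel1.
rewrite h; apply: eq_integral => y _.
rewrite -/(Rintegral m1 setT _) -RintegralZT; last exact: summable_kernel2.
rewrite -Rintegral_EFin; last exact/summableZ/summable_kernel2.
by apply: eq_integral => x _; congr EFin; rewrite /=; ring.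
Qed.

End KernelFubini.

(** * Complex square-integrable functions as a real inner product space *)

Section ComplexL2.
Context d (T : measurableType d) (R : realType)
  (mu : {measure set T -> \bar R}).
Local Notation Re := complex.Re.
Local Notation Im := complex.Im.
Implicit Types F G : T -> R[i].

Definition csqsummable F :=
  sqsummable mu (fun x => Re (F x)) /\ sqsummable mu (fun x => Im (F x)).

(** The real part of the complex inner product. It determines the norm, and it is the sum of two
    real inner products. *)
Definition rip F G := ip mu (fun x => Re (F x)) (fun x => Re (G x)) +
  ip mu (fun x => Im (F x)) (fun x => Im (G x)).

Definition cnorm F := Num.sqrt (rip F F).

Lemma csqsummableD F G : csqsummable F -> csqsummable G ->
  csqsummable (fun x => F x + G x).
Proof.
move=> [F1 F2] [G1 G2]; split; under eq_fun do rewrite raddfD; exact: sqsummableD.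
Qed.

Lemma csqsummableN F : csqsummable F -> csqsummable (fun x => - F x).
Proof.
move=> [F1 F2]; split; under eq_fun do rewrite raddfN -mulN1r; exact: sqsummableZ.
Qed.

Lemma csqsummableB F G : csqsummable F -> csqsummable G ->
  csqsummable (fun x => F x - G x).
Proof. by move=> ? ?; apply: csqsummableD => //; exact: csqsummableN. Qed.

Lemma ripC F G : rip F G = rip G F.
Proof. by rewrite /rip ipC [X in _ + X]ipC. Qed.

Lemma rip_ge0 F : 0 <= rip F F.
Proof. by rewrite addr_ge0// ip_ge0. Qed.

Lemma cnorm_ge0 F : 0 <= cnorm F.
Proof. exact: sqrtr_ge0. Qed.

Lemma sqr_cnorm F : cnorm F ^+ 2 = rip F F.
Proof. by rewrite sqr_sqrtr// rip_ge0. Qed.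

Lemma ripDl F G H : csqsummable F -> csqsummable G -> csqsummable H ->
  rip (fun x => F x + G x) H = rip F H + rip G H.
Proof.
move=> [F1 F2] [G1 G2] [H1 H2]; rewrite /rip.
rewrite (_ : (fun x => Re (F x + G x)) = (fun x => Re (F x) + Re (G x))); last first.
  by apply/funext => x; rewrite raddfD.
rewrite (_ : (fun x => Im (F x + G x)) = (fun x => Im (F x) + Im (G x))); last first.
  by apply/funext => x; rewrite raddfD.
by rewrite !ipDl// addrACA.
Qed.

Lemma csqsummableZ (t : R) F : csqsummable F -> csqsummable (fun x => t%:C%C * F x).
Proof.
move=> [F1 F2]; split.
  rewrite (_ : (fun x => _) = (fun x => t * Re (F x))); last first.
    by apply/funext => x; case: (F x) => a b /=; ring.
  exact: sqsummableZ.
rewrite (_ : (fun x => _) = (fun x => t * Im (F x))); last first.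
  by apply/funext => x; case: (F x) => a b /=; ring.
exact: sqsummableZ.
Qed.

Lemma ripZl (t : R) F G : csqsummable F -> csqsummable G ->
  rip (fun x => t%:C%C * F x) G = t * rip F G.
Proof.
move=> [F1 F2] [G1 G2]; rewrite /rip.
rewrite (_ : (fun x => Re (t%:C%C * F x)) = (fun x => t * Re (F x))); last first.
  by apply/funext => x; case: (F x) => a b /=; ring.
rewrite (_ : (fun x => Im (t%:C%C * F x)) = (fun x => t * Im (F x))); last first.
  by apply/funext => x; case: (F x) => a b /=; ring.
by rewrite !ipZl//; ring.
Qed.

(** Cauchy-Schwarz from the nonnegativity of the quadratic t -> |F + t G|^2, evaluated at one
    well-chosen t in each of three cases. *)
Lemma rip_le F G : csqsummable F -> csqsummable G ->
  rip F G <= cnorm F * cnorm G.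
Proof.
move=> hF hG.
have quad t : 0 <= rip F F + t * rip F G *+ 2 + t ^+ 2 * rip G G.
  pose H x := t%:C%C * G x; have hH : csqsummable H by exact: csqsummableZ.
  have HF : rip H F = t * rip F G by rewrite ripZl// ripC.
  have HH : rip H H = t ^+ 2 * rip G G.
    by rewrite ripZl// ripC ripZl// mulrA expr2.
  have hFH := csqsummableD hF hH.
  have := rip_ge0 (fun x => F x + H x).
  rewrite ripDl// (ripC F) (ripC H) !ripDl// (ripC F H) HF HH.
  by move=> h; apply: le_trans h _; rewrite le_eqVlt; apply/orP; left; apply/eqP; ring.
have := rip_ge0 F; have := rip_ge0 G; rewrite -!sqr_cnorm in quad *.
have := cnorm_ge0 F; have := cnorm_ge0 G.
move: (cnorm F) (cnorm G) (rip F G) quad => a b p quad b0 a0 _ _.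
have [b00|bn0] := eqVneq b 0.
  subst b; rewrite mulr0 leNgt; apply/negP => p0.
  (* For b = 0 the quadratic is affine in t; this t makes it equal to - (a^2 + 2). *)
  have := quad (- (a ^+ 2 + 1) / p).
  have -> : a ^+ 2 + - (a ^+ 2 + 1) / p * p *+ 2 +
    (- (a ^+ 2 + 1) / p) ^+ 2 * 0 ^+ 2 = - (a ^+ 2 + 2).
    by field; rewrite gt_eqF.
  by have := sqr_ge0 a; lra.
have bgt0 : 0 < b by rewrite lt_def bn0.
(* This t gives t G the norm of F; the quadratic then factors through a b - p. *)
have := quad (- a / b).
have -> : a ^+ 2 + - a / b * p *+ 2 + (- a / b) ^+ 2 * b ^+ 2 =
          2 * (a / b) * (a * b - p) by field.
move=> h; have [a00|agt0] := eqVneq a 0; last first.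
  have : 0 < a / b by rewrite divr_gt0// lt_def agt0.
  by nra.
subst a; rewrite mul0r leNgt; apply/negP => p0.
(* For a = 0 the minimum of the quadratic is used instead. *)
have := quad (- p / b ^+ 2).
have -> : 0 ^+ 2 + - p / b ^+ 2 * p *+ 2 + (- p / b ^+ 2) ^+ 2 * b ^+ 2 =
          - (p / b) ^+ 2 by field.
rewrite leNgt oppr_lt0 exprn_gt0// divr_gt0//.
Qed.

Lemma cnormD F G : csqsummable F -> csqsummable G ->
  cnorm (fun x => F x + G x) <= cnorm F + cnorm G.
Proof.
move=> hF hG; have hFG := csqsummableD hF hG.
rewrite -(@ler_pXn2r _ 2)// ?nnegrE ?cnorm_ge0 ?addr_ge0 ?cnorm_ge0//.
rewrite sqrrD !sqr_cnorm ripDl// [X in X + _]ripC [X in _ + X]ripC !ripDl//.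
have := rip_le hF hG; rewrite (ripC G F); lra.
Qed.

Lemma cnormN F : cnorm (fun x => - F x) = cnorm F.
Proof.
congr Num.sqrt; rewrite /rip; congr (_ + _); apply: eq_RintegralT => x;
  by rewrite !raddfN/= mulrNN.
Qed.

Lemma cnormB F G : csqsummable F -> csqsummable G ->
  cnorm (fun x => F x - G x) <= cnorm F + cnorm G.
Proof.
move=> hF hG; rewrite -(cnormN G); apply: cnormD => //; exact: csqsummableN.
Qed.

Lemma cnorm_distC F G : cnorm (fun x => F x - G x) = cnorm (fun x => G x - F x).
Proof. by rewrite -cnormN; congr cnorm; apply/funext => x; rewrite opprB. Qed.

Lemma eq_cnorm F G : F =1 G -> cnorm F = cnorm G.
Proof. by move=> /funext ->. Qed.

Lemma cnorm_le_sub F G : csqsummable F -> csqsummable G ->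
  cnorm F <= cnorm G + cnorm (fun x => F x - G x).
Proof.
move=> hF hG; apply: le_trans (cnormD hG (csqsummableB hF hG)).
by rewrite le_eqVlt; apply/orP; left; apply/eqP/eq_cnorm => x; rewrite addrC subrK.
Qed.

End ComplexL2.

(** * Cosine and sine transforms *)

Section LineIntegral.
Context {R : realType}.
Local Notation mu := (@lebesgue_measure R).
Local Notation L1 := (summable mu).
Local Notation "'I' f" := (Rintegral mu [set: R] f) (at level 10, f at level 8).
Implicit Types (f F : R -> R) (D : set R) (a b l c : R).

Lemma Rintegral_indic D f :
  Rintegral mu D f = I (fun x => \1_D x * f x).
Proof.
rewrite Rintegral_mkcond; apply: eq_Rintegral => x _.
by rewrite patchE indicE; case: ifPn => _; rewrite ?mul1r ?mul0r.
Qed.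

Lemma summable_indic D f : measurable D -> L1 f -> L1 (fun x => \1_D x * f x).
Proof.
move=> mD; apply: (@summableMb _ _ _ _ _ _ 1) => //.
by move=> x; rewrite indicE; case: (_ \in _); rewrite ?normr1 ?normr0.
Qed.

Lemma summable_seg f a b : continuous f -> L1 (fun x => \1_`[a, b] x * f x).
Proof.
move=> cf; have := @continuous_compact_integrable R f `[a, b] (@segment_compact _ a b)
  (continuous_subspaceT cf).
move=> h; have {h} := (@integrable_mkcond _ _ _ mu _ _ (measurable_itv `[a, b])).1 h.
apply: eq_integrable => // x _.
by rewrite patchE/= indicE; case: ifPn => _; rewrite ?mul1r ?mul0r.
Qed.

Lemma Rintegral_seg F f a b : a <= b -> continuous f ->
  (forall x : R, is_derive x (1 : R) F (f x)) ->
  I (fun x => \1_`[a, b] x * f x) = F b - F a.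
Proof.
move=> + cf dF; rewrite -Rintegral_indic le_eqVlt => /predU1P[<-|ab].
  by rewrite set_itv1 Rintegral_set1 subrr.
have cF x : {for x, continuous F}.
  by apply: differentiable_continuous; apply/derivable1_diffP; case: (dF x).
rewrite /Rintegral (@continuous_FTC2 R f F a b ab)//.
- exact: continuous_subspaceT.
- split.
  + by move=> x _; case: (dF x).
  + exact/cvg_at_right_filter/cF.
  + exact/cvg_at_left_filter/cF.
- by move=> x _; rewrite derive1E; case: (dF x).
Qed.

Lemma cvg_seq_unique (u : nat -> R) a b : u n @[n --> \oo] --> a ->
  u n @[n --> \oo] --> b -> a = b.
Proof.
by move=> /(cvg_lim (@Rhausdorff R)) <- /(cvg_lim (@Rhausdorff R)) <-.
Qed.

Lemma cvg_indic_exhaust (D_ : nat -> set R) D x :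
  (\forall n \near \oo, (x \in D_ n) = (x \in D)) ->
  \1_(D_ n) x @[n --> \oo] --> (\1_D x : R).
Proof.
move=> h; apply: cvg_near_cst; apply: filterS h => n.
by rewrite !indicE => ->.
Qed.

Definition half : set R := [set x | 0 <= x].

Lemma measurable_half : measurable half.
Proof. by rewrite /half -set_itvcy; exact: measurable_itv. Qed.

Lemma measurable_indic_half :
  measurable_fun [set: measurableTypeR R] (\1_half : R -> R).
Proof. by apply: measurable_indic; exact: measurable_half. Qed.

Lemma cvg_indic_half x : \1_`[0, n%:R] x @[n --> \oo] --> (\1_half x : R).
Proof.
apply: cvg_indic_exhaust; near=> n.
have xn : x <= n%:R by near: n; exact: nbhs_infty_ger.
by apply/idP/idP; rewrite !inE /half /= in_itv/= xn andbT.
Unshelve. all: by end_near. Qed.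

Lemma cvg_indic_line (x : R) : \1_`[(- n%:R), n%:R] x @[n --> \oo] --> (1 : R).
Proof.
apply: cvg_near_cst; near=> n.
have xn : `|x| <= n%:R by near: n; exact: nbhs_infty_ger.
by rewrite indicE mem_set//= in_itv/= -ler_norml.
Unshelve. all: by end_near. Qed.

Lemma indic_norm_le1 D (x : R) : `|\1_D x| <= 1 :> R.
Proof. by rewrite indicE; case: (_ \in _); rewrite ?normr1 ?normr0. Qed.

Lemma indic_ge0 D (x : R) : 0 <= \1_D x :> R.
Proof. by rewrite indicE. Qed.

Lemma Rintegral_exhaust (D_ : nat -> set R) D f :
  (forall n, measurable (D_ n : set (measurableTypeR R))) ->
  (forall x, \1_(D_ n) x @[n --> \oo] --> (\1_D x : R)) -> L1 f ->
  I (fun x => \1_(D_ n) x * f x) @[n --> \oo] --> I (fun x => \1_D x * f x).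
Proof.
move=> mD cD sf; have mf := summable_measurable sf.
apply: (@Rintegral_dominated_cvg _ _ _ mu (fun n x => \1_(D_ n) x * f x)
  (fun x => \1_D x * f x) (fun x => `|f x|)).
- by move=> n; apply: measurable_funM => //; exact/measurable_indic/mD.
- by move=> x; apply: cvgMr_tmp; exact: cD.
- exact: summable_norm.
- by move=> n x; rewrite normrM ler_piMl// indic_norm_le1.
Qed.

Lemma Rintegral_half F f l : L1 (fun x => \1_half x * f x) -> continuous f ->
  (forall x : R, is_derive x (1 : R) F (f x)) -> F n%:R @[n --> \oo] --> l ->
  I (fun x => \1_half x * f x) = l - F 0.
Proof.
move=> sf cf dF Fl; apply: (@cvg_seq_unique (fun n => I (fun x => \1_`[0, n%:R] x * f x))).
  have := @Rintegral_exhaust (fun n => `[0, n%:R]%classic) half _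
     (fun n => measurable_itv _) cvg_indic_half sf.
  rewrite (_ : I (fun x => _ * (_ * _)) = I (fun x => \1_half x * f x)); last first.
    by apply: eq_RintegralT => x; rewrite mulrA -expr2 indicE; case: (_ \in _); rewrite ?expr1n ?expr0n.
  apply: cvg_trans; apply: near_eq_cvg; apply: nearW => n.
  apply: eq_RintegralT => x; rewrite mulrA; congr (_ * _); rewrite !indicE.
  case: (boolP (x \in `[0, n%:R]%classic)) => [|_]; last by rewrite mul0r.
  by rewrite inE/= in_itv/= => /andP[x0 _]; rewrite mem_set ?mulr1.
rewrite (_ : (fun n => _) = (fun n : nat => F n%:R - F 0)).
  by apply: cvgB => //; exact: cvg_cst.
by apply/funext => n; rewrite (@Rintegral_seg F).
Qed.

Lemma Rintegral_line F f l l' : L1 f -> continuous f ->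
  (forall x : R, is_derive x (1 : R) F (f x)) -> F n%:R @[n --> \oo] --> l ->
  F (- n%:R) @[n --> \oo] --> l' -> I f = l - l'.
Proof.
move=> sf cf dF Fl Fl'; apply: (@cvg_seq_unique (fun n => I (fun x => \1_`[(- n%:R), n%:R] x * f x))).
  rewrite (_ : I f = I (fun x => \1_[set: R] x * f x)); last first.
    by apply: eq_RintegralT => x; rewrite indicT mul1r.
  apply: Rintegral_exhaust => // x; rewrite indicT; exact: cvg_indic_line.
rewrite (_ : (fun n => _) = (fun n : nat => F n%:R - F (- n%:R))).
  exact: cvgB.
by apply/funext => n; rewrite (@Rintegral_seg F)// (@le_trans _ _ 0)// lerNl oppr0.
Qed.

Lemma summable_half F f c : continuous f -> (forall x, 0 <= x -> 0 <= f x) ->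
  (forall x : R, is_derive x (1 : R) F (f x)) -> (forall n : nat, F n%:R - F 0 <= c) ->
  L1 (fun x => \1_half x * f x).
Proof.
move=> cf f0 dF Fc.
have := @Rintegral_fatou _ _ _ mu (fun n x => \1_`[0, n%:R] x * f x)
  (fun x => \1_half x * f x) c.
case=> //.
- by move=> n; exact: summable_seg.
- move=> n x; rewrite indicE; case: (boolP (x \in _)); last by rewrite mul0r.
  by rewrite inE/= in_itv/= mul1r => /andP[/f0].
- by move=> x; apply: cvgMl; exact: cvg_indic_half.
- by move=> n; rewrite (@Rintegral_seg F).
Qed.

Lemma summable_line F f c : continuous f -> (forall x, 0 <= f x) ->
  (forall x : R, is_derive x (1 : R) F (f x)) -> (forall n : nat, F n%:R - F (- n%:R) <= c) ->
  L1 f.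
Proof.
move=> cf f0 dF Fc.
have := @Rintegral_fatou _ _ _ mu (fun n x => \1_`[(- n%:R), n%:R] x * f x) f c.
case=> //.
- by move=> n; exact: summable_seg.
- by move=> n x; rewrite mulr_ge0// indic_ge0.
- by move=> x; rewrite -[X in _ --> X]mul1r; apply: cvgMl; exact: cvg_indic_line.
- by move=> n; rewrite (@Rintegral_seg F)// (@le_trans _ _ 0)// lerNl oppr0.
Qed.

(** Lebesgue measure is its own pushforward under negation. *)
Lemma summable_reflect f : L1 f -> L1 (fun x => f (- x)).
Proof.
move=> sf; have mf := summable_measurable sf.
apply: summableP; first exact: measurableT_comp.
have /integrableP[_ /=] := sf.
rewrite (eq_measure_integral (pushforward mu (-%R : _ -> measurableTypeR R))); last first.
  by move=> A mA _; exact/esym/lebesgue_measureN.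
by rewrite ge0_integral_pushforward//=; exact/measurable_EFinP/measurableT_comp.
Qed.

Lemma Rintegral_reflect f : L1 f -> I (fun x => f (- x)) = I f.
Proof.
move=> sf; have mf := summable_measurable sf.
rewrite [in RHS]/Rintegral.
rewrite (eq_measure_integral (pushforward mu (-%R : _ -> measurableTypeR R))); last first.
  by move=> A mA _; exact/esym/lebesgue_measureN.
rewrite integral_pushforward//=.
- exact/measurable_EFinP.
- exact: summable_reflect.
Qed.

(** Reflection sends x < 0 to x > 0, and adding the null point 0 closes up that half-line. This
    brings full-line spectral integrals to nonnegative frequencies. *)
Lemma Rintegral_fold f : L1 f -> I f = I (fun x => \1_half x * (f x + f (- x))).
Proof.
move=> sf; have sr := summable_reflect sf.
have mh := measurable_half.
have mh' : measurable [set x : R | 0 < x] by rewrite -set_itvoy; exact: measurable_itv.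
under [RHS]eq_RintegralT do rewrite mulrDr.
rewrite RintegralDT; [|exact: summable_indic..].
rewrite -[X in _ + X]Rintegral_indic.
have -> : Rintegral mu half (fun x => f (- x)) =
    Rintegral mu [set x | 0 < x] (fun x => f (- x)).
  rewrite /half -set_itvcy -set_itvoy Rintegral_itv_obnd_cbnd//.
  exact: integrableS sr.
have h : L1 (fun x => \1_[set x | 0 < x] (- x) * f x).
  have /= := summable_reflect (summable_indic mh' sr).
  by under eq_fun do rewrite opprK.
have -> : Rintegral mu [set x | 0 < x] (fun x => f (- x)) =
    I (fun x => \1_[set x | 0 < x] (- x) * f x).
  rewrite Rintegral_indic -[RHS](Rintegral_reflect h).
  by apply: eq_RintegralT => x; rewrite opprK.
rewrite -(RintegralDT (summable_indic mh sf) h).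
apply: eq_RintegralT => x; rewrite -mulrDl !indicE.
have -> : (x \in half) = (0 <= x) by apply/idP/idP; rewrite inE.
have -> : (- x \in [set x | 0 < x]) = (x < 0).
  by apply/idP/idP; rewrite inE/= oppr_gt0.
by case: ltP => _; rewrite /= ?add0r ?addr0 mul1r.
Qed.

End LineIntegral.

(** * Transforms of integrable real functions and spectral multipliers *)

Section FourierSines.
Context {R : realType}.
Local Notation mu := (@lebesgue_measure R).
Local Notation L1 := (summable mu).
Local Notation "'I' f" := (Rintegral mu [set: R] f) (at level 10, f at level 8).
Implicit Types (a b m : R -> R) (w x y c : R).

Definition cos_transform b w := I (fun y => cos (w * y) * b y).
Definition sin_transform b w := I (fun y => sin (w * y) * b y).
Local Notation C := cos_transform.
Local Notation S := sin_transform.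

Lemma measurable_cos_mul : measurable_fun [set: measurableTypeR R * measurableTypeR R] (fun z => cos (z.1 * z.2)).
Proof.
apply: measurableT_comp; last exact: measurable_funM.
by apply: continuous_measurable_fun; exact: continuous_cos.
Qed.

Lemma measurable_sin_mul : measurable_fun [set: measurableTypeR R * measurableTypeR R] (fun z => sin (z.1 * z.2)).
Proof.
apply: measurableT_comp; last exact: measurable_funM.
by apply: continuous_measurable_fun; exact: continuous_sin.
Qed.

Lemma measurable_cos_transform b : L1 b -> measurable_fun [set: R] (C b).
Proof.
exact: (@measurable_kernel_integral _ _ _ _ _ mu _ measurable_cos_mul).
Qed.

Lemma measurable_sin_transform b : L1 b -> measurable_fun [set: R] (S b).
Proof.
exact: (@measurable_kernel_integral _ _ _ _ _ mu _ measurable_sin_mul).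
Qed.

Lemma summable_cosM b w : L1 b -> L1 (fun y => cos (w * y) * b y).
Proof.
move=> sb; exact: (@summable_kernel1 _ _ _ _ _ mu _ 1 measurable_cos_mul
  (fun z => cos_max _) b w sb).
Qed.

Lemma summable_sinM b w : L1 b -> L1 (fun y => sin (w * y) * b y).
Proof.
move=> sb; exact: (@summable_kernel1 _ _ _ _ _ mu _ 1 measurable_sin_mul
  (fun z => sin_max _) b w sb).
Qed.

Lemma normr_cos_transform b w : L1 b -> `|C b w| <= I (fun y => `|b y|).
Proof.
move=> sb; rewrite -[leRHS]mul1r.
exact: (@normr_kernel_integral _ _ _ _ _ mu _ 1 measurable_cos_mul
  (fun z => cos_max _) b w sb).
Qed.

Lemma normr_sin_transform b w : L1 b -> `|S b w| <= I (fun y => `|b y|).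
Proof.
move=> sb; rewrite -[leRHS]mul1r.
exact: (@normr_kernel_integral _ _ _ _ _ mu _ 1 measurable_sin_mul
  (fun z => sin_max _) b w sb).
Qed.

Lemma cos_transformN b w : C b (- w) = C b w.
Proof. by apply: eq_RintegralT => y; rewrite mulNr cosN. Qed.

Lemma sin_transformN b w : L1 b -> S b (- w) = - S b w.
Proof.
move=> sb; rewrite /S -[RHS]mulN1r -RintegralZT; last exact: summable_sinM.
by apply: eq_RintegralT => y; rewrite mulNr sinN mulNr mulN1r.
Qed.

Lemma cos_transformD a b w : L1 a -> L1 b ->
  C (fun x => a x + b x) w = C a w + C b w.
Proof.
move=> sa sb; rewrite /C; under eq_RintegralT do rewrite mulrDr.
by rewrite RintegralDT//; exact: summable_cosM.
Qed.

Lemma sin_transformD a b w : L1 a -> L1 b ->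
  S (fun x => a x + b x) w = S a w + S b w.
Proof.
move=> sa sb; rewrite /S; under eq_RintegralT do rewrite mulrDr.
by rewrite RintegralDT//; exact: summable_sinM.
Qed.

Lemma cos_transformZ c a w : L1 a -> C (fun x => c * a x) w = c * C a w.
Proof.
move=> sa; rewrite /C; under eq_RintegralT do rewrite mulrCA.
by rewrite RintegralZT//; exact: summable_cosM.
Qed.

Lemma sin_transformZ c a w : L1 a -> S (fun x => c * a x) w = c * S a w.
Proof.
move=> sa; rewrite /S; under eq_RintegralT do rewrite mulrCA.
by rewrite RintegralZT//; exact: summable_sinM.
Qed.

(** For real a and b this is 2 pi times the real part of the transform of a against the conjugate
    transform of b. It is even in w, so nonnegative frequencies carry all of it. *)
Definition spectral_product a b w := C a w * C b w + S a w * S b w.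

Lemma spectral_productE a b w : L1 a -> L1 b ->
  spectral_product a b w =
  I (fun x => (cos (w * x) * C b w + sin (w * x) * S b w) * a x).
Proof.
move=> sa sb; rewrite /spectral_product mulrC [X in _ + X]mulrC.
rewrite -RintegralZT; last exact: summable_cosM.
rewrite -RintegralZT; last exact: summable_sinM.
rewrite -RintegralDT; [|exact/summableZ/summable_cosM|exact/summableZ/summable_sinM].
by apply: eq_RintegralT => x; ring.
Qed.

Lemma cos_sub_transform b w x : L1 b ->
  cos (w * x) * C b w + sin (w * x) * S b w = I (fun y => cos (w * (x - y)) * b y).
Proof.
move=> sb; rewrite -RintegralZT; last exact: summable_cosM.
rewrite -RintegralZT; last exact: summable_sinM.
rewrite -RintegralDT; [|exact/summableZ/summable_cosM|exact/summableZ/summable_sinM].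
by apply: eq_RintegralT => y; rewrite mulrBr cosB; ring.
Qed.

Lemma normr_spectral_product a b w : L1 a -> L1 b ->
  `|spectral_product a b w| <= 2 * (I (fun x => `|a x|) * I (fun x => `|b x|)).
Proof.
move=> sa sb; rewrite (le_trans (ler_normD _ _))// !normrM mulr2n mulrDl mul1r.
by rewrite lerD// ler_pM// ?normr_cos_transform// normr_sin_transform.
Qed.

Lemma measurable_spectral_product a b : L1 a -> L1 b ->
  measurable_fun [set: R] (spectral_product a b).
Proof.
move=> sa sb; apply: measurable_funD; apply: measurable_funM.
- exact: measurable_cos_transform.
- exact: measurable_cos_transform.
- exact: measurable_sin_transform.
- exact: measurable_sin_transform.
Qed.

Lemma summable_weightM m a b : L1 m -> L1 a -> L1 b ->
  L1 (fun w => m w * spectral_product a b w).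
Proof.
move=> sm sa sb; under eq_fun do rewrite mulrC.
apply: summableMb sm; first exact: measurable_spectral_product.
by move=> w; exact: normr_spectral_product.
Qed.

(* Integrating the cosine of [w * (x - y)] against the weight first turns a
   Fourier multiplier into a convolution kernel. *)
Lemma multiplier_kernel m a b : L1 m -> L1 a -> L1 b ->
  I (fun w => m w * spectral_product a b w) =
  I (fun x => a x * I (fun y => C m (x - y) * b y)).
Proof.
move=> sm sa sb.
(* The triple integral is reordered by two exchanges, each with a bounded kernel of two variables.
   This one swaps w and x, the integral in y being hidden in the transforms of b. *)
pose K (z : measurableTypeR R * measurableTypeR R) := cos (z.1 * z.2) * C b z.1 + sin (z.1 * z.2) * S b z.1.
have mK : measurable_fun setT K.
  apply: measurable_funD; apply: measurable_funM.
  - exact: measurable_cos_mul.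
  - by apply: measurableT_comp => //; exact: measurable_cos_transform.
  - exact: measurable_sin_mul.
  - by apply: measurableT_comp => //; exact: measurable_sin_transform.
have Kc z : `|K z| <= I (fun y => `|b y|) + I (fun y => `|b y|).
  rewrite (le_trans (ler_normD _ _))// lerD// normrM -[leRHS]mul1r ler_pM//;
    rewrite ?cos_max ?sin_max//; [exact: normr_cos_transform|exact: normr_sin_transform].
under eq_RintegralT do rewrite spectral_productE//.
rewrite (kernel_fubini mK Kc sm sa); apply: eq_RintegralT => x; congr (_ * _).
(* Second exchange, of w and y, for fixed x. *)
pose K' (z : measurableTypeR R * measurableTypeR R) := cos (z.1 * (x - z.2)).
have mK' : measurable_fun setT K'.
  apply: measurableT_comp.
    by apply: continuous_measurable_fun; exact: continuous_cos.
  by apply: measurable_funM => //; apply: measurable_funB.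
transitivity (I (fun w => m w * I (fun y => K' (w, y) * b y))).
  by apply: eq_RintegralT => w; rewrite /K/= cos_sub_transform// mulrC.
rewrite (kernel_fubini mK' (fun z => cos_max _) sm sb).
apply: eq_RintegralT => y; rewrite mulrC; congr (_ * _).
by apply: eq_RintegralT => w; rewrite /K'/= [w * _]mulrC.
Qed.

End FourierSines.

(** * Poisson kernels and Plancherel *)

Section Derivatives.
Context {R : realType}.
Implicit Types (f g : R -> R) (x c : R).

Lemma is_derive_addf f g x df dg : is_derive x (1 : R) f df ->
  is_derive x (1 : R) g dg -> is_derive x (1 : R) (fun y => f y + g y) (df + dg).
Proof. by move=> hf hg; exact: is_deriveD. Qed.

Lemma is_derive_subf f g x df dg : is_derive x (1 : R) f df ->
  is_derive x (1 : R) g dg -> is_derive x (1 : R) (fun y => f y - g y) (df - dg).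
Proof. by move=> hf hg; exact: is_deriveB. Qed.

Lemma is_derive_mulf f g x df dg : is_derive x (1 : R) f df ->
  is_derive x (1 : R) g dg ->
  is_derive x (1 : R) (fun y => f y * g y) (df * g x + f x * dg).
Proof.
move=> hf hg; apply: (is_derive_eq (is_deriveM hf hg)).
by rewrite /GRing.scale/= addrC mulrC.
Qed.

Lemma is_derive_scalef f c x df : is_derive x (1 : R) f df ->
  is_derive x (1 : R) (fun y => c * f y) (c * df).
Proof. by move=> hf; exact: is_deriveZ. Qed.

Lemma is_derive_oppf f x df : is_derive x (1 : R) f df ->
  is_derive x (1 : R) (fun y => - f y) (- df).
Proof. by move=> hf; exact: is_deriveN. Qed.

Lemma is_derive_sqrf f x df : is_derive x (1 : R) f df ->
  is_derive x (1 : R) (fun y => f y ^+ 2) (2 * f x * df).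
Proof.
move=> hf; apply: (is_derive_eq (is_derive_mulf hf hf)); ring.
Qed.

Lemma is_derive_compf f g x df dg : is_derive x (1 : R) f df ->
  is_derive (f x) (1 : R) g dg -> is_derive x (1 : R) (fun y => g (f y)) (dg * df).
Proof. by move=> hf hg; exact: is_derive1_comp. Qed.

Lemma is_derive_continuous f df : (forall x, is_derive x (1 : R) f (df x)) ->
  continuous f.
Proof.
by move=> h x; apply: differentiable_continuous; apply/derivable1_diffP; case: (h x).
Qed.

Lemma is_derive_linear c x : is_derive x (1 : R) (fun y => c * y) c.
Proof. by apply: (is_derive_eq (is_derive_scalef c (is_derive_id x 1))); rewrite mulr1. Qed.

Lemma is_derive_expRf f x df : is_derive x (1 : R) f df ->
  is_derive x (1 : R) (fun y => expR (f y)) (expR (f x) * df).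
Proof. by move=> hf; apply: is_derive_compf. Qed.

Lemma is_derive_cosf f x df : is_derive x (1 : R) f df ->
  is_derive x (1 : R) (fun y => cos (f y)) (- sin (f x) * df).
Proof. by move=> hf; apply: is_derive_compf. Qed.

Lemma is_derive_sinf f x df : is_derive x (1 : R) f df ->
  is_derive x (1 : R) (fun y => sin (f y)) (cos (f x) * df).
Proof. by move=> hf; apply: is_derive_compf. Qed.

Lemma mean_value_le f df x y c : (forall z, is_derive z (1 : R) f (df z)) ->
  (forall z, Num.min x y <= z <= Num.max x y -> `|df z| <= c) ->
  `|f x - f y| <= c * `|x - y|.
Proof.
move=> hf hc.
wlog xy : x y hc / y <= x.
  move=> h; have [yx|/ltW xy] := leP y x; first exact: h.
  by rewrite distrC [`|x - y|]distrC; apply: h => // z; rewrite minC maxC; exact: hc.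
have [z zyx ->] := @MVT_segment _ f df _ _ xy (fun z _ => hf z)
  (continuous_subspaceT (is_derive_continuous hf)).
rewrite normrM ler_wpM2r// hc//.
by move: zyx; rewrite in_itv/= (min_r xy) (max_l xy).
Qed.

End Derivatives.

(** * The Poisson kernel as the cosine transform of an exponential *)

Section PoissonKernel.
Context {R : realType}.
Local Notation mu := (@lebesgue_measure R).
Local Notation L1 := (summable mu).
Local Notation "'I' f" := (Rintegral mu [set: R] f) (at level 10, f at level 8).
Local Notation C := (@cos_transform R).
Implicit Types (w x y s e : R).

Definition exp_weight e w : R := \1_half w * expR (- e * w).

(** The Poisson kernel of the half-plane without its factor 1 / pi: its mass is pi, whence the pi in
    the energy identities below. *)
Definition poisson e s : R := e / (e ^+ 2 + s ^+ 2).

Let poisson_den e s : 0 < e -> 0 < e ^+ 2 + s ^+ 2.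
Proof. by move=> e0; rewrite ltr_wpDr ?sqr_ge0// exprn_gt0. Qed.

Lemma poisson_ge0 e s : 0 < e -> 0 <= poisson e s.
Proof. by move=> e0; rewrite divr_ge0// ltW// poisson_den. Qed.

Lemma poisson_le e s : 0 < e -> poisson e s <= e^-1.
Proof.
move=> e0; rewrite /poisson ler_pdivrMr ?poisson_den//.
have -> : e^-1 * (e ^+ 2 + s ^+ 2) = e + e^-1 * s ^+ 2 by field; rewrite gt_eqF.
by rewrite lerDl mulr_ge0 ?sqr_ge0// invr_ge0 ltW.
Qed.

Let continuous_expR_linear e : continuous (fun w => expR (- e * w)).
Proof.
exact: is_derive_continuous (fun w => is_derive_expRf (is_derive_linear (- e) w)).
Qed.

Lemma summable_exp_weight e : 0 < e -> L1 (exp_weight e).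
Proof.
move=> e0; apply: (@summable_half _ (fun w => - e^-1 * expR (- e * w)) _ e^-1).
- exact: continuous_expR_linear.
- by move=> x _; exact: expR_ge0.
- move=> x; apply: (is_derive_eq
    (is_derive_scalef _ (is_derive_expRf (is_derive_linear (- e) x)))).
  by field; rewrite gt_eqF.
- move=> n; rewrite mulr0 expR0 mulr1 opprK gerDr mulNr oppr_le0.
  by rewrite mulr_ge0// ?invr_ge0 ?ltW// expR_gt0.
Qed.

Lemma cvgry_scale e : 0 < e -> e * n%:R @[n --> \oo] --> +oo.
Proof.
move=> e0; apply/cvgryPge => A; near=> n.
rewrite mulrC -ler_pdivrMr//; near: n; exact: nbhs_infty_ger.
Unshelve. all: by end_near. Qed.

Lemma exp_weight_cvg0 e : 0 < e -> expR (- e * n%:R) @[n --> \oo] --> (0 : R).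
Proof.
move=> e0; under eq_fun do rewrite mulNr.
apply: (cvg_comp (fun n : nat => e * n%:R) (fun x => expR (- x))); last exact: cvgr_expR.
exact: cvgry_scale.
Qed.

Lemma cos_transform_exp_weight e s : 0 < e -> C (exp_weight e) s = poisson e s.
Proof.
move=> e0; pose f w := cos (s * w) * expR (- e * w).
(* The real part of exp ((- e + i s) w) / (- e + i s), a primitive of [f]. *)
pose F w := (e ^+ 2 + s ^+ 2)^-1 * (expR (- e * w) * (s * sin (s * w) - e * cos (s * w))).
have d0 := poisson_den s e0.
have dF x : is_derive x (1 : R) F (f x).
  apply: (is_derive_eq (is_derive_scalef _ (is_derive_mulf
    (is_derive_expRf (is_derive_linear _ _))
    (is_derive_subf (is_derive_scalef _ (is_derive_sinf (is_derive_linear _ _)))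
      (is_derive_scalef _ (is_derive_cosf (is_derive_linear _ _))))))).
  by rewrite /f; field; rewrite gt_eqF.
have cf : continuous f.
  exact: is_derive_continuous (fun x => is_derive_mulf
    (is_derive_cosf (is_derive_linear _ _)) (is_derive_expRf (is_derive_linear _ _))).
transitivity (I (fun w => \1_half w * f w)).
  by apply: eq_RintegralT => w; rewrite /f /exp_weight mulrCA.
rewrite (@Rintegral_half _ F f 0) //.
- rewrite /F !mulr0 sin0 cos0 expR0 /poisson; field; rewrite gt_eqF//.
- have := summable_cosM s (summable_exp_weight e0).
  by under eq_fun do rewrite /exp_weight mulrCA.
- pose k := (e ^+ 2 + s ^+ 2)^-1 * (`|s| + e).
  apply: (@squeeze_cvgr _ _ _ _ (fun n : nat => - (k * expR (- e * n%:R)))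
    (fun n : nat => k * expR (- e * n%:R))).
  + apply: nearW => n; rewrite -ler_norml /F normrM [`|_^-1|]gtr0_norm ?invr_gt0//.
    rewrite /k -mulrA ler_pM2l ?invr_gt0// normrM gtr0_norm ?expR_gt0// mulrC.
    rewrite ler_pM2r ?expR_gt0// (le_trans (ler_normB _ _))// lerD//.
      by rewrite normrM ler_piMr// sin_max.
    by rewrite normrM gtr0_norm// ler_piMr ?cos_max// ltW.
  + rewrite -oppr0 -(mulr0 k); apply: cvgN; apply: cvgMl_tmp; exact: exp_weight_cvg0.
  + rewrite -(mulr0 k); apply: cvgMl_tmp; exact: exp_weight_cvg0.
Qed.

Let is_derive_poisson e x y : 0 < e ->
  is_derive y (1 : R) (fun y => atan (e^-1 * (y - x))) (poisson e (x - y)).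
Proof.
move=> e0; apply: (is_derive_eq (is_derive_compf (is_derive_scalef _
  (is_derive_subf (is_derive_id _ _) (is_derive_cst _ _ _)))
  (is_derive1_atan _))).
by rewrite /= subr0 mulr1 /poisson; field; rewrite !gt_eqF ?poisson_den.
Qed.

Lemma continuous_poisson e x : 0 < e -> continuous (fun y => poisson e (x - y)).
Proof.
move=> e0 y; apply: cvgMl_tmp; apply: cvgV; first by rewrite gt_eqF// poisson_den.
apply: cvgD; first exact: cvg_cst.
apply: cvgM; apply: cvgB; by [exact: cvg_cst|exact: cvg_id].
Qed.

Lemma summable_poisson e x : 0 < e -> L1 (fun y => poisson e (x - y)).
Proof.
move=> e0; apply: (@summable_line _ (fun y => atan (e^-1 * (y - x))) _ pi).
- exact: continuous_poisson.
- by move=> y; exact: poisson_ge0.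
- by move=> y; exact: is_derive_poisson.
- move=> n; rewrite [leRHS]splitr lerD//; first exact/ltW/atan_ltpi2.
  by rewrite lerNl; exact/ltW/atan_gtNpi2.
Qed.

Lemma Rintegral_poisson e x : 0 < e -> I (fun y => poisson e (x - y)) = pi.
Proof.
move=> e0.
have lim c : atan (e^-1 * (n%:R + c)) @[n --> \oo] --> (pi / 2 : R).
  apply: (cvg_comp (fun n : nat => e^-1 * (n%:R + c)) atan); last exact: cvgy_atan.
  apply/cvgryPge => A; near=> n.
  rewrite -ler_pdivrMl ?invr_gt0// invrK -lerBlDr.
  near: n; exact: nbhs_infty_ger.
have lim' : atan (e^-1 * (- n%:R - x)) @[n --> \oo] --> - (pi / 2 : R).
  rewrite (_ : (fun n => _) = (fun n : nat => - atan (e^-1 * (n%:R + x)))).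
    by apply: cvgN; exact: lim.
  by apply/funext => n; rewrite -atanN; congr atan; ring.
have dF y := is_derive_poisson x y e0.
rewrite (Rintegral_line (summable_poisson x e0) (@continuous_poisson e x e0) dF
  (lim _) lim').
by rewrite opprK -splitr.
Unshelve. all: by end_near. Qed.

Lemma measurable_poisson_sub e : 0 < e ->
  measurable_fun [set: measurableTypeR R * measurableTypeR R]
    (fun z => poisson e (z.1 - z.2)).
Proof.
move=> e0; apply: (measurableT_comp (f := poisson e)); last exact: measurable_funB.
apply: continuous_measurable_fun => s; apply: cvgMl_tmp.
apply: cvgV; first by rewrite gt_eqF// poisson_den.
apply: cvgD; first exact: cvg_cst.
apply: cvgM; exact: cvg_id.
Qed.

End PoissonKernel.

(** * The energy inequality through Poisson averages *)

Section Plancherel.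
Context {R : realType}.
Local Notation mu := (@lebesgue_measure R).
Local Notation L1 := (summable mu).
Local Notation L2 := (sqsummable mu).
Local Notation "'I' f" := (Rintegral mu [set: R] f) (at level 10, f at level 8).
Local Notation C := (@cos_transform R).
Local Notation S := (@sin_transform R).
Implicit Types (a b f : R -> R) (w x y s e c : R).

Definition poisson_form e a b :=
  I (fun x => a x * I (fun y => poisson e (x - y) * b y)).

Let K_le e (e0 : 0 < e) (z : measurableTypeR R * measurableTypeR R) :
  `|poisson e (z.1 - z.2)| <= e^-1.
Proof. by rewrite ger0_norm ?poisson_ge0// poisson_le. Qed.

Lemma poissonN e s : poisson e (- s) = poisson e s.
Proof. by rewrite /poisson sqrrN. Qed.

Lemma summable_poissonM e x b : 0 < e -> L1 b ->
  L1 (fun y => poisson e (x - y) * b y).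
Proof.
move=> e0 sb.
exact: (@summable_kernel1 _ _ _ _ _ mu _ _ (measurable_poisson_sub e0) (K_le e0) b x sb).
Qed.

Lemma summable_poisson_form e a b : 0 < e -> L1 a -> L1 b ->
  L1 (fun x => a x * I (fun y => poisson e (x - y) * b y)).
Proof.
move=> e0 sa sb.
exact: (@summable_kernel_integral _ _ _ _ _ mu mu _ _ (measurable_poisson_sub e0) (K_le e0) a b).
Qed.

Lemma poisson_formC e a b : 0 < e -> L1 a -> L1 b ->
  poisson_form e a b = poisson_form e b a.
Proof.
move=> e0 sa sb; rewrite /poisson_form.
rewrite (kernel_fubini (measurable_poisson_sub e0) (K_le e0) sa sb).
apply: eq_RintegralT => y; congr (_ * _); apply: eq_RintegralT => x.
by rewrite -poissonN opprB.
Qed.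

Lemma poisson_formBr e a b b' : 0 < e -> L1 a -> L1 b -> L1 b' ->
  poisson_form e a (fun x => b x - b' x) = poisson_form e a b - poisson_form e a b'.
Proof.
move=> e0 sa sb sb'; rewrite /poisson_form -RintegralBT; [|exact: summable_poisson_form..].
apply: eq_RintegralT => x; rewrite -mulrBr -RintegralBT; [|exact: summable_poissonM..].
by congr (_ * _); apply: eq_RintegralT => y; rewrite mulrBr.
Qed.

Lemma exp_weight_spectral e a b : 0 < e -> L1 a -> L1 b ->
  I (fun w => exp_weight e w * spectral_product a b w) = poisson_form e a b.
Proof.
move=> e0 sa sb; rewrite (multiplier_kernel (summable_exp_weight e0) sa sb).
apply: eq_RintegralT => x; congr (_ * _); apply: eq_RintegralT => y.
by rewrite cos_transform_exp_weight.
Qed.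

Lemma Rintegral_poissonM_le e x f c : 0 < e -> L1 f -> (forall y, 0 <= f y <= c) ->
  I (fun y => poisson e (x - y) * f y) <= c * pi.
Proof.
move=> e0 sf fc; rewrite mulrC -(Rintegral_poisson x e0) mulrC -RintegralZT; last exact: summable_poisson.
apply: le_RintegralT; first exact: summable_poissonM.
  exact/summableZ/summable_poisson.
by move=> y; rewrite mulrC ler_wpM2r ?poisson_ge0//; case/andP: (fc y).
Qed.

(** By symmetry the average may be taken of [a], where it is at most c pi. The bound is uniform in
    [e], which makes the form stable under L^1 approximation of [b]. *)
Lemma normr_poisson_form e a b c : 0 < e -> L1 a -> (forall x, `|a x| <= c) -> L1 b ->
  `|poisson_form e a b| <= c * pi * I (fun x => `|b x|).
Proof.
move=> e0 sa ac sb; rewrite poisson_formC// -RintegralZT; last exact: summable_norm.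
apply: normr_Rintegral_le.
- exact/summable_measurable/summable_poisson_form.
- exact/summableZ/summable_norm.
- move=> x; rewrite normrM mulrC ler_wpM2r//.
  apply: (le_trans (normr_le_RintegralT (summable_poissonM _ _ _))) => //.
  under eq_RintegralT do rewrite normrM ger0_norm ?poisson_ge0//.
  by apply: Rintegral_poissonM_le => //; [exact: summable_norm|move=> y; rewrite normr_ge0/=].
Qed.

Lemma summable_indic_itv (i : R * R) : L1 (\1_`[i.1, i.2]).
Proof. exact: integrable_indic_itv. Qed.

(** Schur's test: a(x) a(y) is at most (a(x)^2 + a(y)^2) / 2, and the kernel has mass pi in each
    variable. *)
Lemma poisson_form_le e a u v : 0 < e -> L1 a -> L2 a ->
  (forall x, a x = \1_`[u, v] x * a x) ->
  poisson_form e a a <= pi * I (fun x => a x ^+ 2).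
Proof.
move=> e0 sa [ma qa] aD; set D := `[u, v]%classic in aD.
have sD : L1 (\1_D : R -> R) by exact: (summable_indic_itv (u, v)).
pose P f x := I (fun y => poisson e (x - y) * f y).
have D01 y : 0 <= (\1_D y : R) <= 1 by rewrite indicE; case: (_ \in _); rewrite /= ?ler01 ?lexx.
have PD_le x : P (\1_D) x <= pi by rewrite -[leRHS]mul1r Rintegral_poissonM_le.
have sPD f g : L1 f -> L1 g -> L1 (fun x => f x * P g x) by move=> *; exact: summable_poisson_form.
(* The indicator of the segment stands for the constant 1, because the kernel lemmas require
   integrable functions; its Poisson average is still at most pi. *)
have le1 : poisson_form e a a <=
    I (fun x => 2^-1 * (a x ^+ 2 * P \1_D x) + 2^-1 * (\1_D x * P (fun y => a y ^+ 2) x)).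
  apply: le_RintegralT; first exact: summable_poisson_form.
    by apply: summableD; apply: summableZ; exact: sPD.
  move=> x; rewrite /P -RintegralZT; last exact: summable_poissonM.
  rewrite -RintegralZT; last exact: summable_poissonM.
  rewrite -RintegralZT; last exact/summableZ/summable_poissonM.
  rewrite -[X in _ <= _ + _ * X]RintegralZT; last exact: summable_poissonM.
  rewrite -[X in _ <= _ + X]RintegralZT; last exact/summableZ/summable_poissonM.
  rewrite -RintegralDT; [|exact/summableZ/summableZ/summable_poissonM..].
  apply: le_RintegralT; first exact/summableZ/summable_poissonM.
    by apply: summableD; exact/summableZ/summableZ/summable_poissonM.
  move=> y; rewrite aD (aD y).
  have := poisson_ge0 (x - y) e0; move: (poisson _ _) => p p0.
  have := mulr_ge0 p0 (sqr_ge0 (a x - a y)); have := mulr_ge0 p0 (sqr_ge0 (a x)).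
  have := mulr_ge0 p0 (sqr_ge0 (a y)); move: (a x) (a y) => s t.
  rewrite /D !indicE; case: (x \in _); case: (y \in _); rewrite /= ?mul0r ?mul1r ?mulr0 ?mulr1; nra.
have le2 : I (fun x => a x ^+ 2 * P \1_D x) <= pi * I (fun x => a x ^+ 2).
  rewrite -RintegralZT//; apply: le_RintegralT => //; first exact: sPD.
    exact: summableZ.
  by move=> x; rewrite mulrC ler_wpM2r ?sqr_ge0.
apply: (le_trans le1); rewrite RintegralDT; [|apply: summableZ; exact: sPD..].
rewrite !RintegralZT; [|exact: sPD..].
have -> : I (fun x => \1_D x * P (fun y => a y ^+ 2) x) = I (fun x => a x ^+ 2 * P \1_D x).
  by have := poisson_formC e0 sD qa.
by move: le2; lra.
Qed.

Definition spectral_energy a := I (fun w => \1_half w * spectral_product a a w).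

Lemma spectral_product_ge0 a w : 0 <= spectral_product a a w.
Proof. by rewrite addr_ge0// -expr2 sqr_ge0. Qed.

Lemma exp_weight_ge0 e w : 0 <= exp_weight e w.
Proof. by rewrite mulr_ge0 ?indic_ge0// expR_ge0. Qed.

Lemma exp_weight_le e w : 0 < e -> exp_weight e w <= \1_half w.
Proof.
move=> e0; rewrite /exp_weight indicE; case: (boolP (w \in half)); rewrite ?mul0r//.
rewrite inE /half/= mul1r => w0; rewrite -expR0 ler_expR mulNr oppr_le0.
by rewrite mulr_ge0// ltW.
Qed.

Lemma cvg_exp_weight w : exp_weight n.+1%:R^-1 w @[n --> \oo] --> (\1_half w : R).
Proof.
rewrite -[X in _ --> X]mulr1; apply: cvgMl_tmp.
rewrite -[X in _ --> X]expR0; apply: continuous_cvg; first exact: continuous_expR.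
rewrite [X in _ --> X](_ : 0 = - 0 * w); last by rewrite oppr0 mul0r.
apply: cvgMr_tmp; apply: cvgN; exact: (@cvg_harmonic R).
Qed.

Lemma cvg_cos_transform (a_ : nat -> R -> R) a f w : (forall n, measurable_fun [set: R] (a_ n)) ->
  (forall x, a_ n x @[n --> \oo] --> a x) -> L1 f -> (forall n x, `|a_ n x| <= f x) ->
  C (a_ n) w @[n --> \oo] --> C a w.
Proof.
move=> ma ca sf af.
apply: (@Rintegral_dominated_cvg _ _ _ mu (fun n y => cos (w * y) * a_ n y)
  (fun y => cos (w * y) * a y) f) => //.
- move=> n; apply: measurable_funM; last exact: ma.
  apply: continuous_measurable_fun.
  exact: is_derive_continuous (fun x => is_derive_cosf (is_derive_linear w x)).
- by move=> x /=; apply: cvgMl_tmp; exact: ca.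
- by move=> n x; rewrite normrM (le_trans _ (af n x))// ler_piMl// cos_max.
Qed.

Lemma cvg_sin_transform (a_ : nat -> R -> R) a f w : (forall n, measurable_fun [set: R] (a_ n)) ->
  (forall x, a_ n x @[n --> \oo] --> a x) -> L1 f -> (forall n x, `|a_ n x| <= f x) ->
  S (a_ n) w @[n --> \oo] --> S a w.
Proof.
move=> ma ca sf af.
apply: (@Rintegral_dominated_cvg _ _ _ mu (fun n y => sin (w * y) * a_ n y)
  (fun y => sin (w * y) * a y) f) => //.
- move=> n; apply: measurable_funM; last exact: ma.
  apply: continuous_measurable_fun.
  exact: is_derive_continuous (fun x => is_derive_sinf (is_derive_linear w x)).
- by move=> x /=; apply: cvgMl_tmp; exact: ca.
- by move=> n x; rewrite normrM (le_trans _ (af n x))// ler_piMl// sin_max.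
Qed.

Lemma sqsummable_indic (D : set R) a : measurable D -> L2 a -> L2 (fun x => \1_D x * a x).
Proof.
move=> mD; apply: (@sqsummableMb _ _ _ _ _ _ 1) => //.
by move=> x; rewrite indic_norm_le1.
Qed.

(** The Schur bound requires a function carried by a segment and a damping e > 0. Truncation to
    [-n, n] and damping 1 / (n + 1) share the index n, and Fatou's lemma removes both at once. *)
Lemma spectral_energy_le a : L1 a -> L2 a ->
  L1 (fun w => \1_half w * spectral_product a a w) /\
  spectral_energy a <= pi * I (fun x => a x ^+ 2).
Proof.
move=> sa [ma qa].
pose a_ n x := \1_`[(- n%:R), n%:R] x * a x.
have sa_ n : L1 (a_ n) by exact: summable_indic.
have qa_ n : L2 (a_ n) by exact: sqsummable_indic.
have ma_ n : measurable_fun [set: R] (a_ n) by case: (qa_ n).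
have ca x : a_ n x @[n --> \oo] --> a x.
  by rewrite -[X in _ --> X]mul1r; apply: cvgMr_tmp; exact: cvg_indic_line.
have la n x : `|a_ n x| <= `|a x| by rewrite normrM ler_piMl// indic_norm_le1.
apply: (@Rintegral_fatou _ _ _ mu
  (fun n w => exp_weight n.+1%:R^-1 w * spectral_product (a_ n) (a_ n) w)).
- by move=> n; apply: summable_weightM => //; exact: summable_exp_weight.
- by move=> n w; rewrite mulr_ge0 ?exp_weight_ge0 ?spectral_product_ge0.
- move=> w /=; apply: cvgM; first exact: cvg_exp_weight.
  have h1 := @cvg_cos_transform a_ a _ w ma_ ca (summable_norm sa) la.
  have h2 := @cvg_sin_transform a_ a _ w ma_ ca (summable_norm sa) la.
  by apply: cvgD; apply: cvgM.
- move=> n; rewrite exp_weight_spectral//.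
  apply: (le_trans (@poisson_form_le _ _ (- n%:R) n%:R _ _ _ _)) => //.
    move=> x; rewrite /a_ mulrA; congr (_ * _).
    by rewrite indicE; case: (_ \in _); rewrite /= ?mulr1 ?mulr0.
  rewrite ler_wpM2l ?pi_ge0//; apply: le_RintegralT => //; first by case: (qa_ n).
  move=> x; rewrite -[leLHS]real_normK ?num_real// -[leRHS]real_normK ?num_real//.
  by rewrite lerXn2r ?nnegrE.
Qed.

(** At each frequency the product is dominated by the sum of the two energies, integrable by
    [spectral_energy_le]. *)
Lemma summable_half_spectral a b : L1 a -> L2 a -> L1 b -> L2 b ->
  L1 (fun w => \1_half w * spectral_product a b w).
Proof.
move=> sa qa sb qb; have [ha _] := spectral_energy_le sa qa.
have [hb _] := spectral_energy_le sb qb.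
have mab : measurable_fun [set: measurableTypeR R] (fun w => \1_half w * spectral_product a b w).
  apply: measurable_funM; last exact: measurable_spectral_product.
  exact: measurable_indic_half.
apply: (summable_le mab (summableD ha hb)) => w.
have i0 := indic_ge0 half w; rewrite -mulrDr normrM (ger0_norm i0) ler_wpM2l//.
rewrite /spectral_product; move: (C a w) (S a w) (C b w) (S b w) => p q r s.
by rewrite ler_norml; apply/andP; split;
  have := sqr_ge0 (p + r); have := sqr_ge0 (p - r); have := sqr_ge0 (q + s);
  have := sqr_ge0 (q - s); have := sqr_ge0 p; have := sqr_ge0 q;
  have := sqr_ge0 r; have := sqr_ge0 s; nra.
Qed.

(** Once the undamped spectral product is known to be integrable it dominates the damped ones. *)
Lemma cvg_poisson_form a b : L1 a -> L2 a -> L1 b -> L2 b ->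
  poisson_form n.+1%:R^-1 a b @[n --> \oo] -->
  I (fun w => \1_half w * spectral_product a b w).
Proof.
move=> sa qa sb qb; under eq_fun do rewrite -exp_weight_spectral//.
apply: (@Rintegral_dominated_cvg _ _ _ mu
  (fun n w => exp_weight n.+1%:R^-1 w * spectral_product a b w) _
  (fun w => `|\1_half w * spectral_product a b w|)).
- move=> n; apply: summable_measurable.
  by apply: summable_weightM => //; exact: summable_exp_weight.
- by move=> w /=; apply: cvgMr_tmp; exact: cvg_exp_weight.
- exact/summable_norm/summable_half_spectral.
- move=> n w; rewrite !normrM ler_wpM2r// !ger0_norm ?indic_ge0 ?exp_weight_ge0//.
  exact: exp_weight_le.
Qed.

End Plancherel.

(** * Plancherel and Parseval identities on a segment *)

Section PlancherelIdentity.
Context {R : realType}.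
Local Notation mu := (@lebesgue_measure R).
Local Notation L1 := (summable mu).
Local Notation L2 := (sqsummable mu).
Local Notation "'I' f" := (Rintegral mu [set: R] f) (at level 10, f at level 8).
Local Notation C := (@cos_transform R).
Local Notation S := (@sin_transform R).
Implicit Types (a b f : R -> R) (w x y s e r M T : R).

(** Away from the diagonal the narrow kernel is a small multiple of a kernel of fixed width r, since
    r^2 + s^2 is at most 2 s^2. The tail of a Poisson average is therefore O(e / r). *)
Lemma poisson_le_scale e r s : 0 < e -> 0 < r -> r <= `|s| ->
  poisson e s <= 2 * e / r * poisson r s.
Proof.
move=> e0 r0 rs.
have rs2 : r ^+ 2 <= s ^+ 2.
  by rewrite -[s ^+ 2]real_normK ?num_real// lerXn2r ?nnegrE// ltW.
have s2 : 0 < s ^+ 2 by apply: lt_le_trans rs2; rewrite exprn_gt0.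
have d1 : 0 < e ^+ 2 + s ^+ 2 by rewrite ltr_wpDl ?sqr_ge0.
have d2 : 0 < r ^+ 2 + s ^+ 2 by rewrite ltr_wpDl ?sqr_ge0.
have -> : 2 * e / r * poisson r s = e * (2 / (r ^+ 2 + s ^+ 2)).
  by rewrite /poisson; field; rewrite !gt_eqF.
rewrite /poisson ler_pM2l// -div1r ler_pdivrMr// mulrAC ler_pdivlMr// mul1r.
by have := sqr_ge0 e; lra.
Qed.

(** The kernels form an approximate identity of mass pi; continuity of [b] is used only at the point
    x. *)
Lemma poisson_average_cvg b M x : L1 b -> (forall y, `|b y| <= M) ->
  {for x, continuous b} ->
  I (fun y => poisson n.+1%:R^-1 (x - y) * b y) @[n --> \oo] --> pi * b x.
Proof.
move=> sb bM cb; have pi0 := pi_gt0 R.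
have M0 : 0 <= M by apply: le_trans (bM 0).
apply/cvgrPdist_le => h h0; pose h' := h / (2 * pi).
have h'0 : 0 < h' by rewrite divr_gt0// mulr_gt0.
have /cvgrPdist_le/(_ h' h'0)/nbhs_ballP[r /= r0 hr] := cb.
near=> n; set e := n.+1%:R^-1.
have e0 : 0 < e by rewrite invr_gt0.
have sp z := summable_poisson x (z : 0 < _).
have -> : pi * b x = I (fun y => b x * poisson e (x - y)).
  by rewrite RintegralZT ?Rintegral_poisson// 1?mulrC//; exact: summable_poisson.
rewrite -RintegralBT; [|exact/summableZ/summable_poisson|exact: summable_poissonM].
(* The first term covers |x - y| < r, where [b] varies by at most [h'], and the second the rest,
   where it varies by at most 2 M. Since h' = h / (2 pi), the first integrates to h / 2. *)
pose g y := h' * poisson e (x - y) + 2 * M * (2 * e / r) * poisson r (x - y).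
have sg : L1 g by apply: summableD; apply: summableZ; exact: summable_poisson.
apply: (@le_trans _ _ (I g)).
  apply: normr_Rintegral_le => //.
    apply: (@summable_measurable _ _ _ mu).
    by apply: summableB; [exact/summableZ/summable_poisson|exact: summable_poissonM].
  move=> y; rewrite mulrC -mulrBr normrM ger0_norm ?poisson_ge0// /g.
  have p0 := poisson_ge0 (x - y) e0; have pr0 := poisson_ge0 (x - y) r0.
  have q0 : 0 <= 2 * M * (2 * e / r) * poisson r (x - y).
    apply: mulr_ge0 => //; apply: mulr_ge0; first exact: mulr_ge0.
    by apply: divr_ge0; [apply: mulr_ge0 => //|]; exact: ltW.
  have [xy|xy] := ltP `|x - y| r.
    rewrite mulrC -[leLHS]addr0 lerD// ler_wpM2r//; exact: hr.
  rewrite -[leLHS]add0r lerD//; first by rewrite mulr_ge0// ltW.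
  have := poisson_le_scale e0 r0 xy => le1.
  have le2 : `|b x - b y| <= 2 * M.
    by rewrite (le_trans (ler_normB _ _))// mulr2n mulrDl mul1r lerD.
  by rewrite mulrC -[leRHS]mulrA ler_pM.
have -> : I g = h' * pi + 2 * M * (2 * e / r) * pi.
  rewrite /g RintegralDT; [|exact/summableZ/summable_poisson..].
  rewrite (RintegralZT h' (summable_poisson x e0)).
  by rewrite (RintegralZT _ (summable_poisson x r0)) !Rintegral_poisson.
have -> : h' * pi = h / 2.
  by rewrite /h' invfM mulrA -[LHS]mulrA mulVf ?gt_eqF// mulr1.
rewrite [leRHS]splitr lerD2l.
(* The size of n at which the far term 4 M pi / (r (n + 1)) drops to h / 2. *)
have : 8 * M * pi / r / h <= n.+1%:R.
  apply: (@le_trans _ _ n%:R); last by rewrite ler_nat.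
  by near: n; exact: nbhs_infty_ger.
rewrite ler_pdivrMr// /e; have : (0 : R) < n.+1%:R by [].
move: (n.+1%:R : R) => N N0 le1; move: le1 pi0; move: (pi : R) => p le1 p0.
have -> : 2 * M * (2 * N^-1 / r) * p = (8 * M * p / r) / 2 / N.
  by field; rewrite !gt_eqF.
rewrite ler_pdivrMr//; move: le1; lra.
Unshelve. all: by end_near. Qed.

Lemma continuous_bounded_on_segment (g : R -> R) u v : continuous g ->
  exists2 M, 0 <= M & forall x, `|\1_`[u, v] x * g x| <= M.
Proof.
move=> cg; have /compact_bounded[M [_ hM]] :=
  continuous_compact (continuous_subspaceT cg) (@segment_compact R u v).
exists (`|M| + 1) => // x.
rewrite indicE; case: (boolP (x \in _)) => [|_]; rewrite ?mul0r ?normr0// inE mul1r => xi.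
apply: hM; first by rewrite (le_lt_trans (ler_norm _))// ltrDl.
by exists x.
Qed.

(** The cut-off of [g] is wider than the segment carrying [a] by 1 on each side, so that [b] is
    continuous at every point where [a] may be nonzero. *)
Lemma poisson_form_cvg a (g : R -> R) T : L1 a -> (forall x, a x = \1_`[(- T), T] x * a x) ->
  continuous g ->
  let b x := \1_`[(- (T + 1)), (T + 1)] x * g x in
  poisson_form n.+1%:R^-1 a b @[n --> \oo] --> pi * ip mu a b.
Proof.
move=> sa aT cg b; have pi0 := pi_gt0 R.
have [M M0 bM] := continuous_bounded_on_segment (- (T + 1)) (T + 1) cg.
have sb : L1 b by exact: summable_seg.
have mb := summable_measurable sb.
have sab : L1 (fun x => a x * b x).
  by under eq_fun do rewrite mulrC; exact: (summableMb mb bM sa).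
have -> : pi * ip mu a b = I (fun x => a x * (pi * b x)).
  by rewrite /ip -(RintegralZT pi sab); apply: eq_RintegralT => x; rewrite mulrCA.
apply: (@Rintegral_dominated_cvg _ _ _ mu
  (fun n x => a x * I (fun y => poisson n.+1%:R^-1 (x - y) * b y))
  (fun x => a x * (pi * b x)) (fun x => M * pi * `|a x|)).
- by move=> n; apply: (@summable_measurable _ _ _ mu); exact: summable_poisson_form.
- move=> x /=; rewrite aT indicE; case: (boolP (x \in _)) => [|_].
    rewrite inE/= in_itv/= => /andP[x1 x2]; rewrite mul1r; apply: cvgMl_tmp.
    apply: (@poisson_average_cvg b M) => //.
    have xi : x \in `](- (T + 1)), (T + 1)[ by rewrite in_itv/=; apply/andP; split; lra.
    have bg y : y \in `](- (T + 1)), (T + 1)[ -> b y = g y.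
      by move=> /subset_itv_oo_cc yi; rewrite /b indicE mem_set// mul1r.
    change (b y @[y --> x] --> b x); rewrite bg//; apply: cvg_trans (cg x).
    by apply: near_eq_cvg; near=> y; rewrite bg//; near: y; exact: near_in_itvoo.
  by rewrite !mul0r; under eq_fun do rewrite mul0r; exact: cvg_cst.
- exact/summableZ/summable_norm.
- move=> n x; rewrite normrM mulrC ler_wpM2r//.
  apply: (le_trans (normr_le_RintegralT (summable_poissonM _ _ _))) => //.
  under eq_RintegralT do rewrite normrM ger0_norm ?poisson_ge0//.
  by apply: Rintegral_poissonM_le => //; [exact: summable_norm|move=> y; rewrite normr_ge0; exact: bM].
Unshelve. all: by end_near. Qed.

(** Density of continuous functions on the wider segment, in the form needed by
    [poisson_form_cvg]. *)
Lemma approx_continuous_L1 a T r : L1 a -> (forall x, a x = \1_`[(- T), T] x * a x) ->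
  0 < r -> exists2 g : R -> R, continuous g &
    I (fun x => `|a x - \1_`[(- (T + 1)), (T + 1)] x * g x|) <= r.
Proof.
move=> sa aT r0; set E := `[(- (T + 1)), (T + 1)]%classic.
have mE : measurable (E : set (measurableTypeR R)) by exact: measurable_itv.
have muE : (mu E < +oo)%E.
  by rewrite /E lebesgue_measure_itv/=; case: ifP => _; rewrite ?ltry// -EFinB ltry.
have [g_ [cg _ lim]] := @approximation_continuous_integrable R E a mE muE
  (integrableS measurableT mE (@subsetT _ _) sa).
have := lim; rewrite fine_cvgP => -[_ /cvgrPdist_le/(_ r r0)].
move=> -[N _ /(_ N (leqnn N))]/=.
rewrite sub0r normrN => le_r; exists (g_ N); first exact: cg.
apply: le_trans le_r; apply: le_trans (ler_norm _).
rewrite le_eqVlt; apply/orP; left; apply/eqP.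
rewrite -[RHS]/(Rintegral mu E (fun x => `|a x - g_ N x|)) Rintegral_indic.
apply: eq_RintegralT => x; rewrite [in LHS]aT.
have sub : `[(- T), T]%classic `<=` E.
  by move=> y; rewrite /E/= !in_itv/= => /andP[y1 y2]; apply/andP; split; lra.
case: (boolP (x \in E)) => xE; rewrite [\1_E x]indicE ?xE ?(negbTE xE) /=; last first.
  rewrite !mul0r subr0 indicE memNset ?mul0r ?normr0//.
  by move=> /sub xE'; move/negP : xE; apply; exact/mem_set.
by rewrite -aT !mul1r.
Qed.

(** The forms for (a, a) converge to the spectral energy. A continuous [b] replaces the second [a];
    boundedness of [a] makes the cost uniform in the damping, so the same forms converge to pi times
    the squared norm. *)
Lemma spectral_energy_bounded a T M : L1 a -> L2 a ->
  (forall x, a x = \1_`[(- T), T] x * a x) -> (forall x, `|a x| <= M) ->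
  spectral_energy a = pi * ip mu a a.
Proof.
move=> sa qa aT aM; have pi0 := pi_gt0 R.
have M0 : 0 <= M by apply: le_trans (aM 0).
apply: (@cvg_seq_unique _ (fun n => poisson_form n.+1%:R^-1 a a)).
  exact: cvg_poisson_form.
(* Three errors of at most h / 3 each. Two cost M pi r; M + 1 keeps the divisor positive when M =
   0. *)
apply/cvgrPdist_le => h h0; pose r := h / (3 * (M + 1) * pi).
have r0 : 0 < r by rewrite divr_gt0// !mulr_gt0// ltr_wpDl.
have [g cg gr] := approx_continuous_L1 sa aT r0.
pose b x := \1_`[(- (T + 1)), (T + 1)] x * g x.
have sb : L1 b by exact: summable_seg.
have mab : L1 (fun x => a x * b x).
  exact: (summableMb (summable_measurable sa) aM sb).
have sab : L1 (fun x => a x - b x) by exact: summableB.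
have h3 : 0 < h / 3 by rewrite divr_gt0.
have /cvgrPdist_le/(_ _ h3) near1 := poisson_form_cvg sa aT cg.
have rE : M * pi * r <= h / 3.
  have -> : h / 3 = (M + 1) * pi * r.
    rewrite /r; move: pi0; move: (pi : R) => p p0; field.
    by rewrite !gt_eqF// ltr_wpDl.
  by rewrite ler_wpM2r ?(ltW r0)// ler_wpM2r ?(ltW pi0)// lerDl.
near=> n.
have le3 : `|pi * ip mu a b - poisson_form n.+1%:R^-1 a b| <= h / 3.
  by near: n; exact: near1.
set e := n.+1%:R^-1 in le3 *; have e0 : 0 < e by rewrite invr_gt0.
have ipE : ip mu a a - ip mu a b = I (fun x => a x * (a x - b x)).
  rewrite /ip -RintegralBT//; last by case: qa => _; under eq_fun do rewrite expr2.
  by apply: eq_RintegralT => x; rewrite mulrBr.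
have le1 : `|pi * ip mu a a - pi * ip mu a b| <= M * pi * r.
  rewrite -mulrBr ipE normrM gtr0_norm// mulrAC [leRHS]mulrC ler_wpM2l ?(ltW pi0)//.
  apply: (@le_trans _ _ (I (fun x => M * `|a x - b x|))).
    apply: normr_Rintegral_le.
    - apply: measurable_funM; first exact: summable_measurable sa.
      exact: summable_measurable sab.
    - exact/summableZ/summable_norm.
    - by move=> x; rewrite normrM ler_wpM2r.
  rewrite RintegralZT; last exact: summable_norm.
  by rewrite ler_wpM2l.
have le2 : `|poisson_form e a a - poisson_form e a b| <= M * pi * r.
  rewrite -poisson_formBr//; apply: (le_trans (normr_poisson_form e0 sa aM sab)).
  by rewrite ler_wpM2l// mulr_ge0// ltW.
have -> : pi * ip mu a a - poisson_form e a a =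
  (pi * ip mu a a - pi * ip mu a b) + (pi * ip mu a b - poisson_form e a b)
  - (poisson_form e a a - poisson_form e a b).
  by move: (pi : R) => p; ring.
apply: (le_trans (ler_normB _ _)); apply: (le_trans (lerD (ler_normD _ _) (lexx _))).
by move: le1 le2 le3 rE; lra.
Unshelve. all: by end_near. Qed.

Lemma summable_L2_segment a T : L2 a -> (forall x, a x = \1_`[(- T), T] x * a x) ->
  L1 a.
Proof.
move=> [ma qa] aT.
apply: (summable_le ma (summableD (summable_indic_itv (- T, T)) qa)) => x /=.
rewrite [in `|a x|]aT indicE; case: (_ \in _); rewrite /= ?mul1r ?mul0r ?normr0 ?addr_ge0 ?sqr_ge0//.
by have := sqr_ge0 (`|a x| - 1); rewrite -[a x ^+ 2]real_normK ?num_real//;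
  have := normr_ge0 (a x); nra.
Qed.

(** Only the lower bound remains. [a] is truncated in height to the bounded [a_ k], for which
    equality holds; the remainder [d_ k] tends to 0 in L^2 and its energy is controlled by the
    inequality already known. *)
Theorem plancherel_segment a T : L2 a -> (forall x, a x = \1_`[(- T), T] x * a x) ->
  spectral_energy a = pi * ip mu a a.
Proof.
move=> qa aT; have sa := summable_L2_segment qa aT; have pi0 := pi_gt0 R.
have ipE f : ip mu f f = I (fun x => f x ^+ 2) by apply: eq_RintegralT => x; rewrite expr2.
have [_ ub] := spectral_energy_le sa qa.
apply/eqP; rewrite eq_le ipE ub/=.
pose D k : set R := [set x | `|a x| <= k%:R].
have mD k : measurable (D k : set (measurableTypeR R)).
  have ma : measurable_fun [set: measurableTypeR R] (fun x => `|a x|).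
    by apply: measurableT_comp => //; case: qa.
  rewrite /D -[X in measurable X]setTI; have := ma measurableT _ (measurable_itv `]-oo, k%:R]).
  by congr measurable; apply/seteqP; split => x /=; rewrite in_itv.
pose a_ k x := \1_(D k) x * a x.
have qa_ k : L2 (a_ k) := sqsummable_indic (mD k) qa.
have sa_ k : L1 (a_ k) := summable_indic (mD k) sa.
have aT_ k x : a_ k x = \1_`[(- T), T] x * a_ k x by rewrite /a_ mulrCA -aT.
have aM_ k x : `|a_ k x| <= k%:R.
  rewrite /a_ indicE; case: (boolP (x \in D k)) => [|_]; rewrite ?mul0r ?normr0//.
  by rewrite inE /D/= mul1r.
have cD x : \1_(D n) x @[n --> \oo] --> (1 : R).
  apply: cvg_near_cst; near=> n; rewrite indicE mem_set//=.
  by near: n; exact: nbhs_infty_ger.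
pose d_ k x := a x - a_ k x.
have qd_ k : L2 (d_ k) by exact: sqsummableB.
have sd_ k : L1 (d_ k) by exact: summableB.
have sqa : L1 (fun x => a x ^+ 2) by case: qa.
have lim1 : I (fun x => a_ k x ^+ 2) @[k --> \oo] --> I (fun x => a x ^+ 2).
  apply: (@Rintegral_dominated_cvg _ _ _ mu (fun k x => a_ k x ^+ 2)
    (fun x => a x ^+ 2) (fun x => a x ^+ 2)) => //.
  - by move=> k; apply: (@summable_measurable _ _ _ mu); case: (qa_ k).
  - move=> x; rewrite -[X in _ --> X]mul1r -[X in X * _](expr1n _ 2).
    under eq_fun do rewrite /a_ exprMn.
    by apply: cvgMr_tmp; apply: cvgM; exact: cD.
  - move=> k x; rewrite /a_ indicE; case: (_ \in _).
      by rewrite mul1r ger0_norm ?sqr_ge0.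
    by rewrite mul0r expr0n normr0 sqr_ge0.
have lim2 : I (fun x => d_ k x ^+ 2) @[k --> \oo] --> (0 : R).
  have dE k : I (fun x => d_ k x ^+ 2) = I (fun x => a x ^+ 2) - I (fun x => a_ k x ^+ 2).
    rewrite -RintegralBT//; last by case: (qa_ k).
    apply: eq_RintegralT => x; rewrite /d_ /a_ indicE; case: (_ \in _) => /=; ring.
  under eq_fun do rewrite dE; rewrite -(subrr (I (fun x => a x ^+ 2))).
  by apply: cvgB => //; exact: cvg_cst.
have Q0 f : 0 <= spectral_energy f.
  by apply: Rintegral_ge0T => w; rewrite mulr_ge0 ?indic_ge0// spectral_product_ge0.
(* Young's inequality (p - u)^2 <= (1 + t) p^2 + (1 + 1 / t) u^2 at each frequency, the difference
   being (t p + u)^2 / t. The index k tends to infinity before t tends to 0. *)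
have ineq t k : 0 < t -> pi * I (fun x => a_ k x ^+ 2) <=
    (1 + t) * spectral_energy a + (1 + t^-1) * (pi * I (fun x => d_ k x ^+ 2)).
  move=> t0; rewrite -ipE -(spectral_energy_bounded (sa_ k) (qa_ k) (aT_ k) (aM_ k)).
  have [sed led] := spectral_energy_le (sd_ k) (qd_ k).
  have [sea _] := spectral_energy_le sa qa.
  have [sek _] := spectral_energy_le (sa_ k) (qa_ k).
  apply: (@le_trans _ _ ((1 + t) * spectral_energy a + (1 + t^-1) * spectral_energy (d_ k))).
    rewrite -RintegralZT// -RintegralZT// -RintegralDT; [|exact: summableZ..].
    apply: le_RintegralT => //; first by apply: summableD; exact: summableZ.
    move=> w; rewrite mulrCA [X in _ <= _ + X]mulrCA -mulrDr ler_wpM2l ?indic_ge0//.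
    have -> : spectral_product (a_ k) (a_ k) w = 
      (C a w - C (d_ k) w) ^+ 2 + (S a w - S (d_ k) w) ^+ 2.
      have -> : a_ k = (fun x => a x + (-1) * d_ k x).
        by apply/funext => x; rewrite /d_; ring.
      have sN : L1 (fun x => (-1) * d_ k x) by exact: summableZ.
      by rewrite /spectral_product cos_transformD// sin_transformD// cos_transformZ// sin_transformZ//; ring.
    rewrite /spectral_product; move: (C a w) (S a w) (C (d_ k) w) (S (d_ k) w) => p q u v.
    have -> : (1 + t) * (p * p + q * q) + (1 + t^-1) * (u * u + v * v) =
      (p - u) ^+ 2 + (q - v) ^+ 2 + t^-1 * ((t * p + u) ^+ 2 + (t * q + v) ^+ 2).
      by field; rewrite gt_eqF.
    by rewrite lerDl mulr_ge0 ?invr_ge0 ?(ltW t0)// addr_ge0 ?sqr_ge0.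
  by rewrite lerD2l ler_wpM2l// addr_ge0// invr_ge0 ltW.
have ineq2 t : 0 < t -> pi * I (fun x => a x ^+ 2) <= (1 + t) * spectral_energy a.
  move=> t0.
  have l1 : pi * I (fun x => a_ k x ^+ 2) @[k --> \oo] --> pi * I (fun x => a x ^+ 2).
    by apply: cvgMl_tmp; exact: lim1.
  have l2 : (1 + t) * spectral_energy a + (1 + t^-1) * (pi * I (fun x => d_ k x ^+ 2))
      @[k --> \oo] --> (1 + t) * spectral_energy a.
    rewrite -[X in _ --> X]addr0; apply: cvgD; first exact: cvg_cst.
    rewrite -(mulr0 (1 + t^-1)); apply: cvgMl_tmp.
    rewrite -(mulr0 pi); apply: cvgMl_tmp; exact: lim2.
  by apply: (ler_cvg_to l1 l2); apply: nearW => k; exact: ineq.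
apply/ler_addgt0Pr => h h0; have := Q0 a; set Q := spectral_energy a => Q_ge0.
(* With this t the excess t Q is at most h, including when Q = 0. *)
have t0 : 0 < h / (Q + 1) by rewrite divr_gt0// ltr_wpDl.
apply: (le_trans (ineq2 _ t0)); rewrite mulrDl mul1r lerD2l mulrAC ler_pdivrMr ?ltr_wpDl//.
by rewrite ler_pM2l// lerDl.
Unshelve. all: by end_near. Qed.

Lemma spectral_productDD a b w : L1 a -> L1 b ->
  spectral_product (fun x => a x + b x) (fun x => a x + b x) w =
  spectral_product a a w + spectral_product b b w + 2 * spectral_product a b w.
Proof.
move=> sa sb; rewrite /spectral_product cos_transformD// sin_transformD//; ring.
Qed.

(** Polarization: the Plancherel identities of a + b, a and b are subtracted. *)
Theorem parseval_segment a b T : L2 a -> L2 b ->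
  (forall x, a x = \1_`[(- T), T] x * a x) ->
  (forall x, b x = \1_`[(- T), T] x * b x) ->
  I (fun w => \1_half w * spectral_product a b w) = pi * ip mu a b.
Proof.
move=> qa qb aT bT.
have sa := summable_L2_segment qa aT; have sb := summable_L2_segment qb bT.
have qab := sqsummableD qa qb.
have abT x : a x + b x = \1_`[(- T), T] x * (a x + b x) by rewrite mulrDr -aT -bT.
have := plancherel_segment qab abT.
rewrite /spectral_energy ipDl// ipC ipDl// [X in _ + X]ipC ipDl// (ipC mu b a).
have -> : I (fun w => \1_half w *
      spectral_product (fun x => a x + b x) (fun x => a x + b x) w) =
    I (fun w => (\1_half w * spectral_product a a w +
      \1_half w * spectral_product b b w) + 2 * (\1_half w * spectral_product a b w)).
  by apply: eq_RintegralT => w; rewrite spectral_productDD//; ring.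
have [ea _] := spectral_energy_le sa qa; have [eb _] := spectral_energy_le sb qb.
have eab := summable_half_spectral sa qa sb qb.
rewrite RintegralDT; [|exact: summableD|exact: summableZ].
rewrite RintegralDT// RintegralZT//.
rewrite -/(spectral_energy a) -/(spectral_energy b).
rewrite (plancherel_segment qa aT) (plancherel_segment qb bT).
by move: (pi : R) => p; lra.
Qed.

End PlancherelIdentity.

(** * Hermite functions *)

Section HermiteFunctions.
Context {R : realType}.
Local Notation mu := (@lebesgue_measure R).
Implicit Types (x y c : R) (p : {poly R}) (k : nat).

(** The polynomial factor of the k-th derivative of exp (- x^2). It is (-1)^k times the usual
    Hermite polynomial, so signs in the relations below differ from the customary ones. *)
Fixpoint hermite_poly k : {poly R} :=
  if k is k'.+1 then (hermite_poly k')^`() - 2%:P * 'X * hermite_poly k' else 1.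
Local Notation P := hermite_poly.

Lemma deriv_hermite_poly k : (P k.+1)^`() = - (2 * k.+1%:R)%:P * P k.
Proof.
elim: k => [|k ih].
  rewrite /= -[1]polyC1 derivB !derivM !derivC derivX; ring.
have -> : P k.+2 = (P k.+1)^`() - 2%:P * 'X * P k.+1 by [].
rewrite derivB derivM [(2%:P * 'X)^`()]derivM derivC derivX ih derivM derivN derivC.
have -> : (P k)^`() = P k.+1 + 2%:P * 'X * P k by rewrite /= subrK.
rewrite -[k.+2%:R]natr1 !polyCM polyCD; ring.
Qed.

Lemma is_derive_expR_sqr c x :
  is_derive x (1 : R) (fun y => expR (c * y ^+ 2)) (2 * c * x * expR (c * x ^+ 2)).
Proof.
apply: (is_derive_eq (is_derive_expRf (is_derive_scalef c
  (is_derive_sqrf (is_derive_id x (1 : R)))))); ring.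
Qed.

Lemma is_derive_poly_expR p c x :
  is_derive x (1 : R) (fun y => p.[y] * expR (c * y ^+ 2))
    ((p^`() + (2 * c)%:P * 'X * p).[x] * expR (c * x ^+ 2)).
Proof.
apply: (is_derive_eq (is_derive_mulf (is_derive_poly p x) (is_derive_expR_sqr c x))).
rewrite !(hornerD, hornerM, hornerC, hornerX); ring.
Qed.

Lemma derive1n_gauss k :
  derive1n k (fun y : R => expR (- y ^+ 2)) = fun x => (P k).[x] * expR (- x ^+ 2).
Proof.
elim: k => [|k ih]; first by apply/funext => x; rewrite derive1n0 /= hornerC mul1r.
rewrite derive1nS ih; apply/funext => x; rewrite derive1E.
have := is_derive_poly_expR (P k) (-1) x.
under eq_fun do rewrite mulN1r; case=> _ ->; rewrite mulN1r; congr (_ * _).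
by rewrite /= !(hornerD, hornerN, hornerM, hornerC, hornerX, hornerXn); ring.
Qed.

Definition hermite_cst k : R := (pi `^ (4^-1) * Num.sqrt (2 ^+ k * k`!%:R))^-1.

Lemma hermite_funE k x :
  hermite_fun k x = hermite_cst k * (P k).[x] * expR (- 2^-1 * x ^+ 2).
Proof.
rewrite /hermite_fun /hermite derive1n_gauss -!mulrA; congr (_ * _).
by rewrite mulrCA -!expRD; congr (_ * expR _); field.
Qed.

(** The coefficient of the ladder relations, which is the ratio of two consecutive normalizing
    constants. *)
Definition rt k : R := Num.sqrt (2 * k%:R).

Lemma rt_gt0 k : 0 < rt k.+1.
Proof. by rewrite sqrtr_gt0. Qed.

Lemma sqr_rt k : rt k ^+ 2 = 2 * k%:R.
Proof. by rewrite sqr_sqrtr. Qed.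

Lemma hermite_cstS k : hermite_cst k = rt k.+1 * hermite_cst k.+1.
Proof.
have sE : Num.sqrt (2 ^+ k.+1 * k.+1`!%:R) = rt k.+1 * Num.sqrt (2 ^+ k * k`!%:R).
  by rewrite -sqrtrM ?mulr_ge0// factS natrM exprS; congr Num.sqrt; ring.
by rewrite /hermite_cst sE !invfM [RHS]mulrCA [rt _ * _]mulrA divff ?mul1r// gt_eqF ?rt_gt0.
Qed.

(** One of the two ladder relations. Together with [hermite_lower] and its case of index 0 it yields
    the recurrence, orthogonality, the Christoffel-Darboux formula and the oscillator equation. *)
Lemma hermite_raise k x : is_derive x (1 : R) (@hermite_fun R k)
  (x * hermite_fun k x + rt k.+1 * hermite_fun k.+1 x).
Proof.
rewrite (_ : @hermite_fun R k = (fun y =>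
  hermite_cst k * ((P k).[y] * expR (- 2^-1 * y ^+ 2)))); last first.
  by apply/funext => y; rewrite hermite_funE -mulrA.
apply: (is_derive_eq (is_derive_scalef _ (is_derive_poly_expR _ _ _))).
rewrite !hermite_funE ![rt _ * _]mulrA -hermite_cstS /= !(hornerD, hornerN, hornerM, hornerC, hornerX, hornerXn).
by move: (expR _) (hermite_cst k) ((P k).[x]) ((P k)^`().[x]) => e c u v; field.
Qed.

Lemma hermite_lower k x : is_derive x (1 : R) (@hermite_fun R k.+1)
  (- x * hermite_fun k.+1 x - rt k.+1 * hermite_fun k x).
Proof.
rewrite (_ : @hermite_fun R k.+1 = (fun y =>
  hermite_cst k.+1 * ((P k.+1).[y] * expR (- 2^-1 * y ^+ 2)))); last first.
  by apply/funext => y; rewrite hermite_funE -mulrA.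
apply: (is_derive_eq (is_derive_scalef _ (is_derive_poly_expR _ _ _))).
rewrite !hermite_funE (hermite_cstS k) deriv_hermite_poly !(hornerD, hornerN, hornerM, hornerC, hornerX, hornerXn).
rewrite -sqr_rt.
by move: (expR _) (hermite_cst k.+1) ((P k).[x]) ((P k.+1).[x]) (rt _) => e c u v r; field.
Qed.

Lemma hermite_lower0 x : is_derive x (1 : R) (@hermite_fun R 0)
  (- x * hermite_fun 0 x).
Proof.
rewrite (_ : @hermite_fun R 0 = (fun y =>
  hermite_cst 0 * ((P 0).[y] * expR (- 2^-1 * y ^+ 2)))); last first.
  by apply/funext => y; rewrite hermite_funE -mulrA.
apply: (is_derive_eq (is_derive_scalef _ (is_derive_poly_expR _ _ _))).
rewrite /= -polyC1 derivC !(hornerD, hornerN, hornerM, hornerC, hornerX, hornerXn).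
by move: (expR _) (hermite_cst 0) => e c; field.
Qed.

Lemma is_derive_inj (f : R -> R) x a b :
  is_derive x (1 : R) f a -> is_derive x (1 : R) f b -> a = b.
Proof. by move=> [_ <-] [_ <-]. Qed.

Lemma hermite_rec1 x : rt 1 * hermite_fun 1 x = - 2 * x * hermite_fun 0 x.
Proof. by have := is_derive_inj (hermite_raise 0 x) (hermite_lower0 x); lra. Qed.

(** Raising and lowering give two expressions for the derivative of the same function. *)
Lemma hermite_rec k x : rt k.+2 * hermite_fun k.+2 x =
  - 2 * x * hermite_fun k.+1 x - rt k.+1 * hermite_fun k x.
Proof. by have := is_derive_inj (hermite_raise k.+1 x) (hermite_lower k x); lra. Qed.

(** Induction on the polynomial, for every rate c at once: half of the Gaussian is left to the
    quotient polynomial and the other half absorbs the extra factor x. *)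
Lemma poly_expR_bounded p c : 0 < c ->
  exists M, forall x, `|p.[x] * expR (- c * x ^+ 2)| <= M.
Proof.
elim/poly_ind: p c => [|p a ih] c c0.
  by exists 0 => x; rewrite horner0 mul0r normr0.
have c20 : 0 < c / 2 by rewrite divr_gt0.
have [M hM] := ih _ c20; exists (M * (1 + (c / 2)^-1) + `|a|) => x.
have M0 : 0 <= M by apply: le_trans (hM 0).
have e1 y : 0 < y -> expR (- y * x ^+ 2) <= 1.
  by move=> y0; rewrite -expR0 ler_expR mulNr oppr_le0 mulr_ge0 ?sqr_ge0// ltW.
rewrite hornerMXaddC mulrDl (le_trans (ler_normD _ _))// lerD//; last first.
  by rewrite normrM ler_piMr// gtr0_norm ?expR_gt0// e1.
have -> : p.[x] * x * expR (- c * x ^+ 2) =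
    (p.[x] * expR (- (c / 2) * x ^+ 2)) * (x * expR (- (c / 2) * x ^+ 2)).
  by rewrite mulrACA -expRD; congr (_ * expR _); field.
rewrite normrM ler_pM// normrM [`|expR _|]gtr0_norm ?expR_gt0//.
set b := c / 2 in c20 *; set E := expR _.
have E0 : 0 < E by exact: expR_gt0.
have xE : b * x ^+ 2 * E <= 1.
  rewrite -[E]invrK ler_pdivrMr ?invr_gt0// mul1r -expRN mulNr opprK.
  by apply: le_trans (expR_ge1Dx _); rewrite lerDr.
have x1 : `|x| <= 1 + x ^+ 2.
  by rewrite -[x ^+ 2]real_normK ?num_real//; have := sqr_ge0 (`|x| - 1); have := normr_ge0 x; nra.
apply: (@le_trans _ _ ((1 + x ^+ 2) * E)); first by rewrite ler_wpM2r// ltW.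
rewrite mulrDl mul1r lerD ?e1//.
by rewrite -[leRHS]mul1r ler_pdivlMr// mulrAC [x ^+ 2 * b]mulrC.
Qed.

(** Boundedness is applied to p (1 + X^2). The majorant 1 / (1 + x^2) is a Poisson kernel, so
    integrability and decay at infinity both follow. *)
Lemma poly_gauss_decay p : exists M, forall x,
  `|p.[x] * expR (- 1 * x ^+ 2)| <= M * poisson 1 x.
Proof.
have [M hM] := @poly_expR_bounded (p * (1 + 'X^2)) 1 ltr01.
exists M => x; have x0 : 0 < 1 + x ^+ 2 by rewrite ltr_wpDr ?sqr_ge0.
rewrite /poisson expr1n mul1r ler_pdivlMr//.
apply: le_trans (hM x); rewrite !(hornerD, hornerN, hornerM, hornerC, hornerX, hornerXn) -[X in _ * X](gtr0_norm x0) -normrM.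
by rewrite le_eqVlt; apply/orP; left; apply/eqP; congr `|_|; ring.
Qed.

End HermiteFunctions.

(** * Orthonormality and Bessel's inequality *)

Section HermiteOrthonormal.
Context {R : realType}.
Local Notation mu := (@lebesgue_measure R).
Local Notation L1 := (summable mu).
Local Notation L2 := (sqsummable mu).
Local Notation "'I' f" := (Rintegral mu [set: R] f) (at level 10, f at level 8).
Local Notation h := (@hermite_fun R).
Local Notation rt := (@rt R).
Local Notation P := (@hermite_poly R).
Implicit Types (x y : R) (p : {poly R}) (j k n : nat) (f : R -> R).

Lemma continuous_poly_gauss p : continuous (fun x => p.[x] * expR (- 1 * x ^+ 2)).
Proof. exact: is_derive_continuous (is_derive_poly_expR p (-1)). Qed.

Lemma summable_poly_gauss p : L1 (fun x => p.[x] * expR (- 1 * x ^+ 2)).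
Proof.
have [M hM] := poly_gauss_decay p.
have sp : L1 (fun x => M * poisson 1 x).
  apply: summableZ; have := summable_poisson 0 (@ltr01 R).
  by under eq_fun do rewrite sub0r poissonN.
apply: (summable_le _ sp hM).
by apply: continuous_measurable_fun; exact: continuous_poly_gauss.
Qed.

Lemma cvg_poly_gauss p (u : nat -> R) : (forall n, `|u n| = n%:R) ->
  p.[u n] * expR (- 1 * u n ^+ 2) @[n --> \oo] --> (0 : R).
Proof.
move=> un; have [M hM] := poly_gauss_decay p.
have le n : `|p.[u n] * expR (- 1 * u n ^+ 2)| <= (2 * `|M|) * n.+1%:R^-1.
  apply: (le_trans (hM (u n))).
  rewrite /poisson expr1n -[u n ^+ 2]real_normK ?num_real// un div1r.
  have d0 : (0 : R) < 1 + n%:R ^+ 2 by rewrite ltr_wpDr ?sqr_ge0.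
  apply: (@le_trans _ _ (`|M| * (1 + n%:R ^+ 2)^-1)).
    by rewrite ler_wpM2r ?ler_norm// invr_ge0 ltW.
  rewrite -mulrA mulrCA ler_wpM2l// -div1r ler_pdivrMr// mulrAC.
  rewrite ler_pdivlMr// mul1r -natr1.
  by have := sqr_ge0 (n%:R - 1 : R); have := sqr_ge0 (n%:R : R); nra.
have lim : (2 * `|M|) * n.+1%:R^-1 @[n --> \oo] --> (0 : R).
  by rewrite -[X in _ --> X](mulr0 (2 * `|M|)); apply: cvgMl_tmp; exact: cvg_harmonic.
apply: (@squeeze_cvgr _ _ _ _ (fun n => - (2 * `|M| * n.+1%:R^-1))
  (fun n => 2 * `|M| * n.+1%:R^-1)) => //.
- by apply: nearW => n; rewrite -ler_norml.
- by rewrite -oppr0; exact: cvgN.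
Qed.

Lemma hermite_mulE j k x : h j x * h k x =
  ((hermite_cst j * hermite_cst k)%:P * (P j * P k)).[x] * expR (- 1 * x ^+ 2).
Proof.
have -> : expR (- 1 * x ^+ 2) = expR (- 2^-1 * x ^+ 2) * expR (- 2^-1 * x ^+ 2).
  by rewrite -expRD; congr expR; field.
by rewrite !hermite_funE !hornerM hornerC; ring.
Qed.

Lemma continuous_hermite k : continuous (h k).
Proof. exact: is_derive_continuous (hermite_raise k). Qed.

Lemma sqsummable_hermite k : L2 (h k).
Proof.
split; first by apply: continuous_measurable_fun; exact: continuous_hermite.
by under eq_fun do rewrite expr2 hermite_mulE; exact: summable_poly_gauss.
Qed.

Lemma cvg_hermite_mul j k (u : nat -> R) : (forall n, `|u n| = n%:R) ->
  h j (u n) * h k (u n) @[n --> \oo] --> (0 : R).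
Proof. by move=> un; under eq_fun do rewrite hermite_mulE; exact: cvg_poly_gauss. Qed.

Lemma Rintegral_derive_hermite j k f : L1 f -> continuous f ->
  (forall x, is_derive x (1 : R) (fun y => h j y * h k y) (f x)) -> I f = 0.
Proof.
move=> sf cf df; rewrite (Rintegral_line (l := 0) (l' := 0) sf cf df) ?subr0//.
- by apply: (@cvg_hermite_mul j k (fun n => n%:R)) => n; rewrite ger0_norm.
- by apply: (@cvg_hermite_mul j k (fun n => - n%:R)) => n; rewrite normrN ger0_norm.
Qed.

(** The derivative of h_j h_(k+1), computed by raising the first factor and lowering the second, is
    the difference of the two integrands: the terms in x cancel. Its integral over the line
    vanishes. *)
Lemma ip_hermiteSS j k : rt j.+1 * ip mu (h j.+1) (h k.+1) = rt k.+1 * ip mu (h j) (h k).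
Proof.
pose f x := rt j.+1 * (h j.+1 x * h k.+1 x) - rt k.+1 * (h j x * h k x).
have s1 := summable_mul (sqsummable_hermite j.+1) (sqsummable_hermite k.+1).
have s2 := summable_mul (sqsummable_hermite j) (sqsummable_hermite k).
have I0 : I f = 0.
  apply: (@Rintegral_derive_hermite j k.+1).
  - by apply: summableB; exact: summableZ.
  - move=> x; apply: cvgB; apply: cvgMl_tmp; apply: cvgM; exact: continuous_hermite.
  - move=> x; apply: (is_derive_eq (is_derive_mulf (hermite_raise j x) (hermite_lower k x))).
    by rewrite /f; ring.
apply/eqP; rewrite -subr_eq0 -I0; apply/eqP.
by rewrite /f RintegralBT ?RintegralZT//; exact: summableZ.
Qed.

Lemma ip_hermiteS0 j : ip mu (h j.+1) (h 0) = 0.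
Proof.
have s1 := summable_mul (sqsummable_hermite j.+1) (sqsummable_hermite 0).
have I0 : I (fun x => rt j.+1 * (h j.+1 x * h 0 x)) = 0.
  apply: (@Rintegral_derive_hermite j 0).
  - exact: summableZ.
  - move=> x; apply: cvgMl_tmp; apply: cvgM; exact: continuous_hermite.
  - move=> x; apply: (is_derive_eq (is_derive_mulf (hermite_raise j x) (hermite_lower0 x))).
    by ring.
move: I0; rewrite RintegralZT// => /eqP; rewrite mulf_eq0 (gt_eqF (rt_gt0 j))/=.
by move/eqP.
Qed.

Lemma sqr_hermite_cst0 : (hermite_cst 0 : R) ^+ 2 = (Num.sqrt pi)^-1.
Proof.
rewrite /hermite_cst expr0 mul1r sqrtr1 mulr1 exprVn; congr (_^-1).
rewrite -powR_mulrn ?powR_ge0// -powRrM.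
have -> : 4^-1 * 2%:R = 2^-1 :> R by field.
by rewrite powR12_sqrt// pi_ge0.
Qed.

Lemma ip_hermite00 : ip mu (h 0) (h 0) = 1.
Proof.
have sqrtpi : Num.sqrt (pi : R) != 0 by rewrite gt_eqF// sqrtr_gt0 pi_gt0.
transitivity (I (fun x => (Num.sqrt pi)^-1 * expR (- x ^+ 2))).
  apply: eq_RintegralT => x; rewrite hermite_mulE /= !mulr1 hornerC.
  by rewrite -expr2 sqr_hermite_cst0 mulN1r.
rewrite RintegralZT; last exact: integrableT_gauss.
by rewrite /Rintegral integralT_gauss/= mulVf.
Qed.

(** [ip_hermiteSS] lowers both indices together until one of them is 0. *)
Lemma ip_hermite j k : ip mu (h j) (h k) = (j == k)%:R.
Proof.
elim: j k => [|j ih] [|k].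
- exact: ip_hermite00.
- by rewrite ipC ip_hermiteS0.
- exact: ip_hermiteS0.
- rewrite eqSS -ih; apply: (mulfI (lt0r_neq0 (rt_gt0 j))).
  rewrite ip_hermiteSS ih; have [->//|_] := eqVneq j k; by rewrite !mulr0.
Qed.

Definition proj n f x := \sum_(k <- iota 0 n.+1) ip mu f (h k) * h k x.

Lemma sqsummable_proj n f : L2 (proj n f).
Proof.
by apply: sqsummable_sum => k; apply: sqsummableZ; exact: sqsummable_hermite.
Qed.

Lemma ip_proj n f g : L2 g ->
  ip mu (proj n f) g = \sum_(k <- iota 0 n.+1) ip mu f (h k) * ip mu g (h k).
Proof.
move=> hg; rewrite ip_suml//; last first.
  by move=> k; apply: sqsummableZ; exact: sqsummable_hermite.
apply: eq_bigr => k _; rewrite ipZl//; last exact: sqsummable_hermite.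
by rewrite [ip mu (h k) g]ipC.
Qed.

Lemma ip_proj_hermite n f k : (k < n.+1)%N -> ip mu (proj n f) (h k) = ip mu f (h k).
Proof.
move=> kn; rewrite ip_proj; last exact: sqsummable_hermite.
rewrite (bigD1_seq k) ?mem_iota ?iota_uniq//= ip_hermite eqxx mulr1 big1 ?addr0//.
by move=> i ik; rewrite ip_hermite eq_sym (negbTE ik) mulr0.
Qed.

(** The projection has the same inner product with itself as with f, so the squared norm of f drops
    by a sum of squares. *)
Lemma bessel n f : L2 f ->
  ip mu (fun x => f x - proj n f x) (fun x => f x - proj n f x) <= ip mu f f.
Proof.
move=> qf; have qp := sqsummable_proj n f; have qd := sqsummableB qf qp.
rewrite ipBl// [X in X - _]ipC [X in _ - X]ipC !ipBl// [ip mu (proj n f) f]ipC.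
have -> : ip mu (proj n f) (proj n f) = ip mu f (proj n f).
  rewrite ip_proj// [RHS]ipC ip_proj//.
  rewrite !big_seq; apply: eq_bigr => k; rewrite mem_iota add0n => kn.
  by rewrite ip_proj_hermite.
rewrite subrr subr0 gerBl ipC ip_proj//; apply: sumr_ge0 => k _.
by rewrite -expr2 sqr_ge0.
Qed.

End HermiteOrthonormal.

(** * Wallis integrals and Hermite functions at the origin *)

Section Wallis.
Context {R : realType}.
Local Notation mu := (@lebesgue_measure R).
Local Notation "'I' f" := (Rintegral mu [set: R] f) (at level 10, f at level 8).
Implicit Types (x : R) (n m : nat).

Definition wallis n : R := I (fun x => \1_`[0, pi / 2] x * sin x ^+ n).
Local Notation W := wallis.

Let is_derive_sinX n x :
  is_derive x (1 : R) (fun y => sin y ^+ n.+1) (n.+1%:R * sin x ^+ n * cos x).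
Proof.
elim: n => [|n ih].
  by apply: (is_derive_eq (is_derive_sin x)); rewrite expr0 !mul1r.
have -> : (fun y : R => sin y ^+ n.+2) = (fun y => sin y * sin y ^+ n.+1).
  by apply/funext => y; rewrite -exprS.
apply: (is_derive_eq (is_derive_mulf (is_derive_sin x) ih)).
by rewrite -[n.+2%:R]natr1 !exprS; ring.
Qed.

Let continuous_sinX n : continuous (fun x : R => sin x ^+ n).
Proof.
case: n => [|n]; first by move=> x; under eq_fun do rewrite expr0; exact: cvg_cst.
exact: is_derive_continuous (is_derive_sinX n).
Qed.

Let pihalf_ge0 : 0 <= pi / 2 :> R.
Proof. by rewrite divr_ge0// pi_ge0. Qed.

Lemma wallis0 : W 0 = pi / 2.
Proof.
rewrite /W (@Rintegral_seg _ idfun (fun x => sin x ^+ 0)) ?subr0//.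
Qed.

Lemma wallis1 : W 1 = 1.
Proof.
have dF x : is_derive x (1 : R) (fun y => - cos y) (sin x ^+ 1).
  by apply: (is_derive_eq (is_derive_oppf (is_derive_cos x))); rewrite opprK expr1.
rewrite /W (Rintegral_seg pihalf_ge0 (@continuous_sinX 1) dF) cos_pihalf cos0; ring.
Qed.

Lemma wallisSS n : n.+2%:R * W n.+2 = n.+1%:R * W n.
Proof.
have s k : summable mu (fun x => \1_`[0, pi / 2] x * sin x ^+ k).
  exact/summable_seg/continuous_sinX.
apply/eqP; rewrite -subr_eq0 -!RintegralZT// -RintegralBT; [|exact: summableZ..].
pose f x := n.+2%:R * sin x ^+ n.+2 - n.+1%:R * sin x ^+ n.
rewrite (_ : I _ = I (fun x => \1_`[0, pi / 2] x * f x)); last first.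
  by apply: eq_RintegralT => x; rewrite /f; ring.
have cf : continuous f.
  by move=> x; apply: cvgB; apply: cvgMl_tmp; exact: continuous_sinX.
have dF x : is_derive x (1 : R) (fun y => - cos y * sin y ^+ n.+1) (f x).
  apply: (is_derive_eq (is_derive_mulf (is_derive_oppf (is_derive_cos x))
    (is_derive_sinX n x))).
  rewrite /f opprK -[n.+2%:R]natr1 !exprS.
  have -> : - cos x * (n.+1%:R * sin x ^+ n * cos x) =
    - (cos x ^+ 2) * (n.+1%:R * sin x ^+ n) by ring.
  by rewrite cos2sin2; ring.
rewrite (Rintegral_seg pihalf_ge0 cf dF).
by rewrite cos_pihalf sin0 expr0n /= mulr0 oppr0 mul0r addr0.
Qed.

Lemma wallis_ge0 n : 0 <= W n.
Proof.
apply: Rintegral_ge0T => x; rewrite indicE; case: (boolP (x \in _)); rewrite ?mul0r//.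
rewrite inE/= in_itv/= mul1r => /andP[x0 x1]; rewrite exprn_ge0// sin_ge0_pi//.
by rewrite x0 (le_trans x1)// ler_pdivrMr// mulr_natr mulr2n lerDl pi_ge0.
Qed.

Lemma wallis_le n : W n.+1 <= W n.
Proof.
apply: le_RintegralT; [exact/summable_seg/continuous_sinX..|].
move=> x; rewrite indicE; case: (boolP (x \in _)); rewrite ?mul0r//.
rewrite inE/= in_itv/= !mul1r => /andP[x0 x1].
have s0 : 0 <= sin x.
  rewrite sin_ge0_pi//.
  by rewrite x0 (le_trans x1)// ler_pdivrMr// mulr_natr mulr2n lerDl pi_ge0.
by rewrite exprS ler_piMl ?exprn_ge0// sin_le1.
Qed.

(** This product does not depend on n. With the monotonicity of [wallis] it encloses the square of
    the n-th integral between pi / (2 (n + 1)) and pi / (2 n). *)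
Lemma wallis_mul n : n.+1%:R * (W n * W n.+1) = pi / 2.
Proof.
elim: n => [|n ih]; first by rewrite wallis0 wallis1 mul1r mulr1.
by rewrite mulrCA wallisSS mulrCA mulrC -ih; ring.
Qed.

Lemma wallis_lower n : pi / 2 <= n.+1%:R * W n ^+ 2.
Proof.
by rewrite -(wallis_mul n) expr2 ler_wpM2l// ler_wpM2l ?wallis_ge0// wallis_le.
Qed.

Lemma wallis_upper n : n%:R * W n ^+ 2 <= pi / 2.
Proof.
case: n => [|n]; first by rewrite mul0r.
by rewrite -(wallis_mul n) expr2 ler_wpM2l// ler_wpM2r ?wallis_ge0// wallis_le.
Qed.

Local Notation h := (@hermite_fun R).
Local Notation rt := (@rt R).

Lemma hermite_at0_rec n : n.+2%:R * h n.+2 0 ^+ 2 = n.+1%:R * h n 0 ^+ 2.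
Proof.
have e : rt n.+2 * h n.+2 0 = - (rt n.+1 * h n 0).
  by rewrite hermite_rec mulr0 mul0r sub0r.
have : (rt n.+2 * h n.+2 0) ^+ 2 = (rt n.+1 * h n 0) ^+ 2 by rewrite e sqrrN.
by rewrite !exprMn !sqr_rt; lra.
Qed.

Lemma hermite_at0_odd m : h m.*2.+1 0 = 0.
Proof.
elim: m => [|m ih].
  have := hermite_rec1 (0 : R); rewrite mulr0 mul0r => /eqP.
  by rewrite mulf_eq0 (gt_eqF (rt_gt0 0))/= => /eqP.
have /eqP := hermite_rec m.*2.+1 (0 : R).
rewrite ih !mulr0 mul0r subrr mulf_eq0 (gt_eqF (rt_gt0 _))/= => /eqP.
by rewrite doubleS.
Qed.

(** Both sides are multiplied by (n + 1) / (n + 2) when the index n increases by 2, and they agree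
    at 0. *)
Lemma hermite_at0_even m :
  pi * Num.sqrt pi * h m.*2 0 ^+ 2 = 2 * W m.*2.
Proof.
have pi0 := pi_gt0 R.
elim: m => [|m ih].
  have sp : Num.sqrt (pi : R) != 0 by rewrite gt_eqF// sqrtr_gt0.
  rewrite wallis0 hermite_funE /= expr0n mulr0 expR0 hornerC !mulr1 sqr_hermite_cst0.
  by rewrite -mulrA divff// mulr1; move: (pi : R) => p; field.
have n0 : m.*2.+2%:R != 0 :> R by rewrite pnatr_eq0.
apply: (mulfI n0); rewrite doubleS mulrCA hermite_at0_rec mulrCA ih.
by rewrite [RHS]mulrCA wallisSS mulrCA.
Qed.

(** The value h_n'(0)^2 + l^2 h_n(0)^2 for l^2 = 2 n + 1: at 0 the raising relation gives h_n' =
    [rt n.+1] h_(n+1). *)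
Definition hermite_energy0 n : R :=
  (rt n.+1 * h n.+1 0) ^+ 2 + (2 * n + 1)%:R * h n 0 ^+ 2.

(** By parity one of the two terms vanishes. The even index among n and n + 1 is [n + odd n], and
    [q] is the Wallis integral at that index. *)
Lemma hermite_energy0E n : exists2 q : R, 0 <= q &
  [/\ hermite_energy0 n = (2 * n + 1 + odd n)%:R * (2 * q) / (pi * Num.sqrt pi),
      pi / 2 <= (n + odd n).+1%:R * q ^+ 2 & (n + odd n)%:R * q ^+ 2 <= pi / 2].
Proof.
have pi0 := pi_gt0 R; have sp : 0 < Num.sqrt (pi : R) by rewrite sqrtr_gt0.
have hE m : h m.*2 0 ^+ 2 = 2 * W m.*2 / (pi * Num.sqrt pi).
  rewrite -hermite_at0_even; set c := pi * Num.sqrt pi.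
  by rewrite [c * _]mulrC mulfK// gt_eqF// mulr_gt0.
exists (W (n + odd n)); first exact: wallis_ge0.
split; [|exact: wallis_lower|exact: wallis_upper].
have odd0 k : odd k -> h k 0 = 0.
  by move=> ok; have := hermite_at0_odd k./2; have -> : k./2.*2.+1 = k by lia.
have evenE k : ~~ odd k -> h k 0 ^+ 2 = 2 * W k / (pi * Num.sqrt pi).
  by move=> ok; have := hE k./2; have -> : k./2.*2 = k by lia.
rewrite /hermite_energy0 exprMn sqr_rt; case: (boolP (odd n)) => on /=.
  rewrite (odd0 n)// expr0n mulr0 addr0 evenE /= ?negbK// [(n + 1)%N]addn1 !mulrA.
  have -> : (2 * n + 1 + 1)%N = (2 * n.+1)%N by lia.
  by rewrite natrM.
by rewrite (odd0 n.+1)// expr0n !mulr0 add0r evenE// !addn0 !mulrA.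
Qed.

(** The Wallis bounds concern squares, so the square of the normalized energy is compared with l^2
    before the difference of squares is factored. *)
Lemma hermite_energy0_approx n (l : R) : (0 < n)%N -> 0 < l -> l ^+ 2 = (2 * n + 1)%:R ->
  `|hermite_energy0 n - 2 * l / pi| * (2 * n)%:R <= 2 * l / pi.
Proof.
move=> n0 l0 lE; have [q q0 [-> lo up]] := hermite_energy0E n.
have pi0 := pi_gt0 R; have sp : 0 < Num.sqrt (pi : R) by rewrite sqrtr_gt0.
have spE : Num.sqrt (pi : R) ^+ 2 = pi by rewrite sqr_sqrtr// ltW.
have n1 : 1 <= n%:R :> R by rewrite (ler_nat _ 1).
have lE' : l ^+ 2 = 2 * n%:R + 1 by rewrite lE natrD natrM.
rewrite -[(n + odd n).+1%:R]natr1 natrD in lo; rewrite natrD in up.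
have -> : (2 * n + 1 + odd n)%:R = 2 * n%:R + 1 + (odd n)%:R :> R.
  by rewrite [LHS]natrD [(2 * n + 1)%:R]natrD natrM.
have -> : (2 * n)%:R = 2 * n%:R :> R by rewrite natrM.
have : (odd n)%:R = 0 :> R \/ (odd n)%:R = 1 :> R by case: (odd n); [right|left].
move: lo up; move: ((odd n)%:R : R) => o lo up o01.
move: sp spE pi0 n1 lE' lo up; move: (Num.sqrt (pi : R)) => s.
move: (pi : R) (n%:R : R) => p v s0 sE p0 v1 lE' lo up {lE n0 n}.
subst p.
(* Normalized so that the energy is 2 X / pi, with pi = s^2; X is to be compared with l. *)
pose X := (2 * v + 1 + o) * q / s.
have -> : (2 * v + 1 + o) * (2 * q) / (s ^+ 2 * s) = 2 / s ^+ 2 * X.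
  by rewrite /X; field; rewrite gt_eqF.
have X0 : 0 <= X.
  by rewrite /X; apply: divr_ge0; [apply: mulr_ge0 => //; case: o01 => ->; lra|exact: ltW].
have XE : X ^+ 2 * s ^+ 2 = (2 * v + 1 + o) ^+ 2 * q ^+ 2.
  by rewrite /X; field; rewrite gt_eqF.
(* As l^2 = 2 v + 1, this says that 2 v X^2 lies between (2 v + 1)(2 v - 1) and (2 v + 1)^2. Each
   parity o uses its own pair of Wallis bounds. *)
have key : `|X ^+ 2 - l ^+ 2| * (2 * v) <= l ^+ 2.
  have p0' : 0 < s ^+ 2 by exact: exprn_gt0.
  have Q0 : 0 <= q ^+ 2 by exact: sqr_ge0.
  have ub : X ^+ 2 * (2 * v) <= (2 * v + 1) ^+ 2.
    rewrite -(ler_pM2r p0') mulrAC XE; case: o01 up => -> up.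
      have : (2 * v + 1) ^+ 2 * (v * q ^+ 2 * 2) <= (2 * v + 1) ^+ 2 * s ^+ 2.
        by rewrite ler_wpM2l ?sqr_ge0//; move: up; lra.
      by lra.
    have : (2 * v + 2) * (2 * v) * ((v + 1) * q ^+ 2 * 2) <= (2 * v + 2) * (2 * v) * s ^+ 2.
      by rewrite ler_wpM2l; [|apply: mulr_ge0|move: up]; lra.
    by have := ltW p0'; lra.
  have lb : (2 * v + 1) * (2 * v - 1) <= X ^+ 2 * (2 * v).
    rewrite -(ler_pM2r p0') [leRHS]mulrAC XE; case: o01 lo => -> lo.
      have : (2 * v + 1) * (2 * v - 1) * s ^+ 2 <=
          (2 * v + 1) * (2 * v - 1) * ((v + 1) * q ^+ 2 * 2).
        by rewrite ler_wpM2l; [|apply: mulr_ge0|move: lo]; lra.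
      have : 0 <= (2 * v + 1) * q ^+ 2 by apply: mulr_ge0 => //; lra.
      by lra.
    have : (2 * v + 1) * (2 * v - 1) * s ^+ 2 <=
        (2 * v + 1) * (2 * v - 1) * ((v + 2) * q ^+ 2 * 2).
      by rewrite ler_wpM2l; [|apply: mulr_ge0|move: lo]; lra.
    have : 0 <= (10 * v + 4) * q ^+ 2 by apply: mulr_ge0 => //; lra.
    by lra.
  have v0 : 0 <= 2 * v by lra.
  rewrite -[X in _ * X <= _](ger0_norm v0) -normrM lE' ler_norml.
  by apply/andP; split; lra.
have -> : 2 / s ^+ 2 * X - 2 * l / s ^+ 2 = 2 / s ^+ 2 * (X - l) by ring.
have c0 : 0 < 2 / s ^+ 2 by rewrite divr_gt0// exprn_gt0.
rewrite normrM gtr0_norm// -[leLHS]mulrA (_ : 2 * l / s ^+ 2 = 2 / s ^+ 2 * l); last by ring.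
(* Since X + l >= l, the bound on squares becomes one on X - l. *)
rewrite ler_pM2l//; have lX : 0 < X + l by rewrite ltr_wpDl.
rewrite -(ler_pM2r lX) mulrAC -[X in _ * X * _](gtr0_norm lX) -normrM -subr_sqr.
by apply: (le_trans key); rewrite expr2 ler_pM2l// lerDr.
Qed.

End Wallis.

(** * The harmonic oscillator and the Christoffel-Darboux kernel *)

Section OscillatorEstimate.
Context {R : realType}.
Variables (h d : R -> R) (l T : R).
Hypothesis dh : forall x : R, is_derive x (1 : R) h (d x).
Hypothesis dd : forall x : R, is_derive x (1 : R) d ((x ^+ 2 - l ^+ 2) * h x).
Hypotheses (T0 : 0 <= T) (Tl : T < l).
Implicit Types (x y z : R).

Let l0 : 0 < l. Proof. exact: le_lt_trans Tl. Qed.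

(** The energy of the oscillator with its actual potential. Only the dependence of the potential on
    z changes it, which leaves the derivative - 2 z h(z)^2. *)
Let E z := d z ^+ 2 + (l ^+ 2 - z ^+ 2) * h z ^+ 2.
Let E0 := d 0 ^+ 2 + l ^+ 2 * h 0 ^+ 2.
Let V := E0 / (l ^+ 2 - T ^+ 2).

Let lT : 0 < l ^+ 2 - T ^+ 2.
Proof. by rewrite subr_gt0 ltrXn2r ?nnegrE// ltW. Qed.

Let dE z : is_derive z (1 : R) E (- 2 * z * h z ^+ 2).
Proof.
apply: (is_derive_eq (is_derive_addf (is_derive_sqrf (dd z))
  (is_derive_mulf (is_derive_subf (is_derive_cst (l ^+ 2) z 1)
    (is_derive_sqrf (is_derive_id z (1 : R)))) (is_derive_sqrf (dh z))))).
rewrite /=; ring.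
Qed.

Let EE0 : E 0 = E0.
Proof. by rewrite /E /E0 expr0n subr0. Qed.

(** The derivative of [E] has the sign opposite to z, so [E] is largest at 0. *)
Lemma oscillator_energy_le x : E x <= E0.
Proof.
rewrite -EE0; have cE := continuous_subspaceT (is_derive_continuous dE).
have [x0|/ltW x0] := leP 0 x.
  have [z zx e] := @MVT_segment _ E _ _ _ x0 (fun z _ => dE z) (cE _).
  rewrite -subr_le0 e subr0 mulr_le0_ge0// mulNr mulNr oppr_le0.
  by rewrite mulr_ge0 ?sqr_ge0// mulr_ge0//; move: zx; rewrite in_itv/= => /andP[].
have [z zx e] := @MVT_segment _ E _ _ _ x0 (fun z _ => dE z) (cE _).
rewrite -subr_ge0 e mulr_ge0 ?subr_ge0// mulr_ge0 ?sqr_ge0//.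
by move: zx; rewrite in_itv/= => /andP[_]; nra.
Qed.

Let sqr_le x : `|x| <= T -> x ^+ 2 <= T ^+ 2.
Proof. by move=> xT; rewrite -[x ^+ 2]real_normK ?num_real// lerXn2r ?nnegrE. Qed.

Lemma oscillator_sqr_le x : `|x| <= T -> h x ^+ 2 <= V.
Proof.
move=> /sqr_le xT; rewrite ler_pdivlMr// mulrC.
apply: le_trans (oscillator_energy_le x).
apply: (@le_trans _ _ ((l ^+ 2 - x ^+ 2) * h x ^+ 2)); last by rewrite lerDr sqr_ge0.
by rewrite ler_wpM2r ?sqr_ge0//; lra.
Qed.

Let V0 : 0 <= V.
Proof. by apply: le_trans (@oscillator_sqr_le 0 _); rewrite ?sqr_ge0 ?normr0. Qed.

Let minmax_norm x z : `|x| <= T -> Num.min x 0 <= z <= Num.max x 0 -> `|z| <= T.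
Proof.
rewrite !ler_norml => /andP[x1 x2]; rewrite ge_min le_max => /andP[/orP[] z1 /orP[] z2];
  by apply/andP; split; lra.
Qed.

(** Of the 3 T^2 V, 2 T^2 V is the drift of [E] over a length at most T, and T^2 V is the term x^2
    h^2 by which the free energy differs from [E]. *)
Lemma oscillator_amplitude x : `|x| <= T ->
  `|(d x ^+ 2 + l ^+ 2 * h x ^+ 2) - E0| <= 3 * T ^+ 2 * V.
Proof.
move=> xT; have hx := oscillator_sqr_le xT; have x2 := sqr_le xT.
have e1 : `|E x - E 0| <= 2 * T * V * `|x - 0|.
  apply: (mean_value_le dE) => z zx; have zT := minmax_norm xT zx.
  rewrite normrM (ger0_norm (sqr_ge0 (h z))) normrM normrN (ger0_norm (ler0n R 2)).
  apply: ler_pM; [exact: mulr_ge0|exact: sqr_ge0|exact: ler_wpM2l|].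
  exact: oscillator_sqr_le.
have e2 : 2 * T * V * `|x - 0| <= 2 * T ^+ 2 * V.
  rewrite subr0 (_ : 2 * T ^+ 2 * V = 2 * T * V * T); last by ring.
  by rewrite ler_wpM2l// mulr_ge0 ?V0// mulr_ge0.
have -> : d x ^+ 2 + l ^+ 2 * h x ^+ 2 - E0 = (E x - E 0) + x ^+ 2 * h x ^+ 2.
  by rewrite EE0 /E; ring.
apply: (le_trans (ler_normD _ _)).
have : `|x ^+ 2 * h x ^+ 2| <= T ^+ 2 * V.
  rewrite ger0_norm; last by apply: mulr_ge0; exact: sqr_ge0.
  by apply: ler_pM => //; exact: sqr_ge0.
by move: e1 e2; lra.
Qed.

(** [A] and [B] are the phase-space vector (l h, h') with the free rotation of frequency l undone.
    For u'' = - l^2 u they would be constant; here their derivatives contain only the perturbation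
    x^2 h. *)
Let A x := l * h x * cos (l * x) - d x * sin (l * x).
Let B x := l * h x * sin (l * x) + d x * cos (l * x).

Let dA x : is_derive x (1 : R) A (- (x ^+ 2 * h x * sin (l * x))).
Proof.
have dc := is_derive_cosf (is_derive_linear l x).
have ds := is_derive_sinf (is_derive_linear l x).
apply: (is_derive_eq (is_derive_subf (is_derive_mulf (is_derive_scalef l (dh x)) dc)
  (is_derive_mulf (dd x) ds))); ring.
Qed.

Let dB x : is_derive x (1 : R) B (x ^+ 2 * h x * cos (l * x)).
Proof.
have dc := is_derive_cosf (is_derive_linear l x).
have ds := is_derive_sinf (is_derive_linear l x).
apply: (is_derive_eq (is_derive_addf (is_derive_mulf (is_derive_scalef l (dh x)) ds)
  (is_derive_mulf (dd x) dc))); ring.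
Qed.

Let minmax_norm2 x y z : `|x| <= T -> `|y| <= T ->
  Num.min x y <= z <= Num.max x y -> `|z| <= T.
Proof.
rewrite !ler_norml => /andP[x1 x2] /andP[y1 y2].
rewrite ge_min le_max => /andP[/orP[] z1 /orP[] z2]; by apply/andP; split; lra.
Qed.

Let AB_lip v x y : (forall z, `|z| <= T -> `|h z| <= v) -> `|x| <= T -> `|y| <= T ->
  `|A x - A y| <= T ^+ 2 * v * `|x - y| /\ `|B x - B y| <= T ^+ 2 * v * `|x - y|.
Proof.
move=> hv xT yT; have v0 : 0 <= v.
  by apply: (le_trans _ (hv 0 _)); rewrite ?normr0.
split; [apply: (mean_value_le dA)|apply: (mean_value_le dB)] => z zxy;
  have zT := minmax_norm2 xT yT zxy; rewrite ?normrN normrM -[leRHS]mulr1;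
  rewrite ler_pM ?cos_max ?sin_max// normrM ler_pM ?hv// ger0_norm ?sqr_ge0//;
  exact: sqr_le.
Qed.

Let AB_amp x : A x ^+ 2 + B x ^+ 2 = d x ^+ 2 + l ^+ 2 * h x ^+ 2.
Proof.
rewrite /A /B; have := cos2Dsin2 (l * x); move: (cos _) (sin _) => c s cs.
transitivity ((d x ^+ 2 + l ^+ 2 * h x ^+ 2) * (c ^+ 2 + s ^+ 2)); first by ring.
by rewrite cs mulr1.
Qed.

(** The sine carries the main term, with the scalar product of the two amplitude vectors as
    coefficient. The cosine carries their cross product, which vanishes when the vectors
    coincide. *)
Let wronskianE x y : l * (h x * d y - d x * h y) =
  (A x * A y + B x * B y) * sin (l * (x - y)) +
  (A x * B y - B x * A y) * cos (l * (x - y)).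
Proof.
rewrite [l * (x - y)]mulrBr sinB cosB /A /B.
have := cos2Dsin2 (l * x); have := cos2Dsin2 (l * y).
move: (cos (l * x)) (sin (l * x)) (cos (l * y)) (sin (l * y)) => c s c' s' e e'.
transitivity (l * (h x * d y - d x * h y) * (c ^+ 2 + s ^+ 2) * (c' ^+ 2 + s' ^+ 2)).
  by rewrite e e' !mulr1.
ring.
Qed.

Lemma normr_sin_le (t : R) : `|sin t| <= `|t|.
Proof.
have := @mean_value_le _ sin cos t 0 1 (fun z => is_derive_sin z) (fun z _ => cos_max z).
by rewrite sin0 !subr0 mul1r.
Qed.

(* [A] and [B] are nearly constant, so up to a small phase drift the Wronskian is
   that of the free oscillator of frequency [l] and amplitude [E0]. *)
Lemma wronskian_estimate t x y : 2 <= T -> 34 * T ^+ 3 <= l -> t <= l ->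
  `|E0 - t| <= 2 / l -> `|x| <= T -> `|y| <= T ->
  `|l * (h x * d y - d x * h y) - t * sin (l * (x - y))| <= 12 * T ^+ 2 * `|x - y|
  /\ `|h x * h y| <= 2 / l.
Proof.
move=> T2 Tl3 tl E0t xT yT.
have T3 : 8 <= T ^+ 3.
  have -> : (8 : R) = 2 ^+ 3 by ring.
  by rewrite lerXn2r ?nnegrE.
have l272 : 272 <= l by lra.
have il0 : 0 < l^-1 by rewrite invr_gt0.
have il : l^-1 <= 1 by rewrite invf_le1//; lra.
have TTl : T ^+ 2 * 68 <= l.
  apply: le_trans Tl3; rewrite (_ : 34 * T ^+ 3 = T ^+ 2 * (34 * T)); last by ring.
  by rewrite ler_wpM2l ?sqr_ge0//; lra.
have T24 : 4 <= T ^+ 2 by nra.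
(* The energy is at most l + 2 / l, and the divisor l^2 - T^2 is close to l^2 because T^2 is at most
   l / 68. *)
have Vl : V <= 2 / l.
  rewrite /V ler_pdivrMr//; move: E0t; rewrite ler_norml => /andP[_ E0t].
  have l2 : 2 / l * l ^+ 2 = 2 * l by field; rewrite gt_eqF.
  have Tl2 : 2 / l * T ^+ 2 <= 1.
    by rewrite mulrAC ler_pdivrMr// mul1r; move: TTl; lra.
  by rewrite mulrBr l2; lra.
have hV z : `|z| <= T -> `|h z| ^+ 2 <= 2 / l.
  by move=> zT; rewrite real_normK ?num_real// (le_trans (oscillator_sqr_le zT)).
have TVl : T ^+ 2 * V <= 2 * T ^+ 2 / l.
  by rewrite (_ : 2 * T ^+ 2 / l = T ^+ 2 * (2 / l)) ?ler_wpM2l ?sqr_ge0//; ring.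
have TV1 : 2 * T ^+ 2 / l <= 1 by rewrite ler_pdivrMr//; lra.
(* [v] bounds h, hence the variation of [A] and [B], and [s] bounds [A] and [B] themselves. As v s =
   2, their product is free of l. *)
pose v := Num.sqrt (2 / l); pose s := Num.sqrt (2 * l).
have v0 : 0 <= v := sqrtr_ge0 _; have s0 : 0 <= s := sqrtr_ge0 _.
have vs : v * s = 2.
  rewrite /v /s -sqrtrM ?divr_ge0 ?(ltW l0)// (_ : _ * _ = 2 ^+ 2); last first.
    by field; rewrite gt_eqF.
  by rewrite sqrtr_sqr ger0_norm.
have v2 : v ^+ 2 = 2 / l by rewrite sqr_sqrtr// divr_ge0// ltW.
have hv z : `|z| <= T -> `|h z| <= v.
  move=> zT; rewrite -(@ler_pXn2r _ 2) ?nnegrE// v2; exact: hV.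
have hh : `|h x * h y| <= 2 / l by rewrite normrM -v2 expr2 ler_pM ?hv.
split=> //.
have [lipA lipB] := AB_lip hv xT yT.
have ampl z : `|z| <= T -> A z ^+ 2 + B z ^+ 2 <= s ^+ 2.
  move=> zT; rewrite AB_amp /s sqr_sqrtr; last by rewrite mulr_ge0// ltW.
  have := oscillator_amplitude zT; rewrite ler_norml => /andP[_].
  by move: E0t; rewrite ler_norml => /andP[_]; lra.
have AB_le z : `|z| <= T -> `|A z| <= s /\ `|B z| <= s.
  move=> /ampl; have := sqr_ge0 (A z); have := sqr_ge0 (B z) => B2 A2 amp.
  by split; rewrite -(@ler_pXn2r _ 2) ?nnegrE// real_normK ?num_real//; lra.
have [Ax Bx] := AB_le _ xT.
set D := `|x - y| in lipA lipB *; have D0 : 0 <= D by exact: normr_ge0.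
have DT : D <= 2 * T by rewrite (le_trans (ler_normB _ _))// mulr2n mulrDl mul1r lerD.
rewrite wronskianE.
(* The cross product is of first order in the drift, which supplies the factor D. *)
have e1 : `|A x * B y - B x * A y| <= 4 * T ^+ 2 * D.
  have -> : A x * B y - B x * A y = B x * (A x - A y) - A x * (B x - B y) by ring.
  apply: (le_trans (ler_normB _ _)); rewrite !normrM.
  have -> : 4 * T ^+ 2 * D = s * (T ^+ 2 * v * D) + s * (T ^+ 2 * v * D).
    rewrite (_ : s * (T ^+ 2 * v * D) = (v * s) * T ^+ 2 * D); last by ring.
    by rewrite vs; ring.
  by rewrite lerD// ler_pM.
(* One of the two factors D is bounded by 2 T, the other is kept for the division by x - y. *)
have sq (a : R) : `|a| <= T ^+ 2 * v * D -> a ^+ 2 <= 4 * T ^+ 5 / l * D.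
  move=> aD; rewrite -[a ^+ 2]real_normK ?num_real//.
  apply: (@le_trans _ _ ((T ^+ 2 * v * D) ^+ 2)).
    by rewrite lerXn2r ?nnegrE// !mulr_ge0 ?sqr_ge0.
  have -> : (T ^+ 2 * v * D) ^+ 2 = v ^+ 2 * (T ^+ 4 * D * D) by ring.
  rewrite v2 (_ : 4 * T ^+ 5 / l * D = 2 / l * (T ^+ 4 * D * (2 * T))); last by ring.
  by rewrite ler_wpM2l ?divr_ge0 ?(ltW l0)// ler_wpM2l// mulr_ge0// exprn_ge0.
have := sq _ lipA; have := sq _ lipB.
set sg := sin _; set cs := cos _ => sB sA.
have sg1 : `|sg| <= 1 by exact: sin_max.
have sgl : `|sg| <= l * D.
  by rewrite (le_trans (normr_sin_le _))// normrM gtr0_norm.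
have T5 : 4 * T ^+ 5 / l <= T ^+ 2.
  by rewrite ler_pdivrMr// (_ : 4 * T ^+ 5 = T ^+ 2 * (4 * T ^+ 3)); [rewrite ler_wpM2l ?sqr_ge0//; lra|ring].
(* Polarization of the scalar product: [m] is the mean squared amplitude minus [t], and [r] half the
   squared drift between x and y. *)
pose m := 2^-1 * ((A x ^+ 2 + B x ^+ 2 - E0) + (A y ^+ 2 + B y ^+ 2 - E0)) + (E0 - t).
pose r := 2^-1 * ((A x - A y) ^+ 2 + (B x - B y) ^+ 2).
have -> : (A x * A y + B x * B y) * sg + (A x * B y - B x * A y) * cs - t * sg =
  m * sg - r * sg + (A x * B y - B x * A y) * cs by rewrite /m /r; field.
have mE : `|m| <= (6 * T ^+ 2 + 2) / l.
  have ax := oscillator_amplitude xT; have ay := oscillator_amplitude yT.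
  rewrite -!AB_amp in ax ay; rewrite /m; apply: (le_trans (ler_normD _ _)).
  rewrite normrM gtr0_norm ?invr_gt0//.
  have := ler_normD (A x ^+ 2 + B x ^+ 2 - E0) (A y ^+ 2 + B y ^+ 2 - E0).
  by move: ax ay E0t TVl; lra.
(* [m] has no factor D of its own; |sin u| <= |u| provides it and absorbs the 1 / l. *)
have e2 : `|m * sg| <= (6 * T ^+ 2 + 2) * D.
  have -> : (6 * T ^+ 2 + 2) * D = (6 * T ^+ 2 + 2) / l * (l * D) by field; rewrite gt_eqF.
  by rewrite normrM ler_pM.
have r0 : 0 <= r by rewrite mulr_ge0 ?addr_ge0 ?sqr_ge0.
have e3 : `|r * sg| <= T ^+ 2 * D.
  rewrite normrM (ger0_norm r0) (@le_trans _ _ r)//; first by rewrite ler_piMr.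
  apply: (@le_trans _ _ (4 * T ^+ 5 / l * D)); last by rewrite ler_wpM2r.
  by rewrite /r; lra.
have e4 : `|(A x * B y - B x * A y) * cs| <= 4 * T ^+ 2 * D.
  by rewrite normrM -[leRHS]mulr1 ler_pM// cos_max.
apply: (le_trans (ler_normD _ _)); apply: (le_trans (lerD (ler_normB _ _) (lexx _))).
(* The three errors add up to (11 T^2 + 2) D, at most 12 T^2 D because T >= 2. *)
have : 0 <= (T ^+ 2 - 4) * D by rewrite mulr_ge0// subr_ge0.
by move: e2 e3 e4; lra.
Qed.

End OscillatorEstimate.

(** * The Hermite kernel compared with the sinc kernel *)

Section HermiteKernel.
Context {R : realType}.
Local Notation mu := (@lebesgue_measure R).
Local Notation "'I' f" := (Rintegral mu [set: R] f) (at level 10, f at level 8).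
Local Notation h := (@hermite_fun R).
Local Notation rt := (@rt R).
Implicit Types (x y s l T : R) (n k : nat).

Definition hermite_kernel n x y := \sum_(k <- iota 0 n.+1) h k x * h k y.

Lemma hermite_kernelS n x y :
  hermite_kernel n.+1 x y = hermite_kernel n x y + h n.+1 x * h n.+1 y.
Proof.
by rewrite /hermite_kernel -[in LHS]addn1 iotaD big_cat /= big_seq1 add0n.
Qed.

(** Telescoping by the three-term recurrence. The factor x - y is kept on the left, so no case
    distinction is needed on the diagonal. *)
Lemma christoffel_darboux n x y :
  2 * (x - y) * hermite_kernel n x y =
  rt n.+1 * (h n x * h n.+1 y - h n.+1 x * h n y).
Proof.
elim: n => [|n ih].
  rewrite /hermite_kernel /= big_seq1.
  have := hermite_rec1 x; have := hermite_rec1 y.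
  move: (rt 1) (h 0 x) (h 0 y) (h 1 x) (h 1 y) => r a b c d e1 e2.
  rewrite (_ : r * (a * d - c * b) = a * (r * d) - (r * c) * b); last by ring.
  by rewrite e1 e2; ring.
rewrite hermite_kernelS mulrDr ih.
have := hermite_rec n x; have := hermite_rec n y.
move: (rt n.+1) (rt n.+2) (h n x) (h n y) (h n.+1 x) (h n.+1 y) (h n.+2 x) (h n.+2 y).
move=> r r' a b c d e f e1 e2.
rewrite (_ : r' * (c * f - e * d) = c * (r' * f) - (r' * e) * d); last by ring.
by rewrite e1 e2; ring.
Qed.

Definition hermite_der n x := x * h n x + rt n.+1 * h n.+1 x.

(** Differentiating the raised form of h_n' by the lowering relation gives the oscillator equation
    with l^2 = 2 n + 1. *)
Lemma is_derive_hermite_der n x : is_derive x (1 : R) (hermite_der n)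
  ((x ^+ 2 - (2 * n + 1)%:R) * h n x).
Proof.
apply: (is_derive_eq (is_derive_addf
  (is_derive_mulf (is_derive_id x (1 : R)) (hermite_raise n x))
  (is_derive_scalef (rt n.+1) (hermite_lower n x)))).
have e : (2 * n + 1)%:R = rt n.+1 ^+ 2 - 1 :> R by rewrite sqr_rt natrD natrM -natr1; ring.
by rewrite e; ring.
Qed.

Lemma christoffel_darboux_der n x y : 2 * (x - y) * hermite_kernel n x y =
  h n x * hermite_der n y - hermite_der n x * h n y + (x - y) * (h n x * h n y).
Proof. by rewrite christoffel_darboux /hermite_der; ring. Qed.

Lemma indic_seg_summable l : summable mu (\1_`[0, l] : R -> R).
Proof. exact: integrable_indic_itv. Qed.

(** The sinc kernel as an integral of cosines: it needs no separate value at s = 0, and it is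
    directly the kernel of the multiplier by the indicator of [0, l]. *)
Definition band_kernel l s := pi^-1 * cos_transform \1_`[0, l] s.

Lemma band_kernelE l s : 0 <= l -> pi * s * band_kernel l s = sin (l * s).
Proof.
move=> l0; rewrite /band_kernel mulrACA divff ?mul1r ?gt_eqF ?pi_gt0//.
have cc : continuous (fun w => cos (s * w)).
  exact: is_derive_continuous (fun w => is_derive_cosf (is_derive_linear s w)).
have scos : summable mu (fun w => cos (s * w) * \1_`[0, l] w).
  by under eq_fun do rewrite mulrC; exact: summable_seg.
rewrite /cos_transform -RintegralZT//.
transitivity (I (fun w => \1_`[0, l] w * (cos (s * w) * s))).
  by apply: eq_RintegralT => w; ring.
have dF w : is_derive w (1 : R) (fun v => sin (s * v)) (cos (s * w) * s).
  exact: is_derive_sinf (is_derive_linear s w).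
have cf : continuous (fun w => cos (s * w) * s).
  by move=> w; apply: cvgMr_tmp; exact: cc.
by rewrite (Rintegral_seg l0 cf dF) mulr0 sin0 subr0 mulrC.
Qed.

(** Provides the continuity by which the kernel estimate reaches the diagonal. *)
Lemma band_kernel_lipschitz l s s' : 0 <= l ->
  `|band_kernel l s - band_kernel l s'| <= pi^-1 * (l * I \1_`[0, l]) * `|s - s'|.
Proof.
move=> l0; have si := indic_seg_summable l.
rewrite /band_kernel -mulrBr normrM gtr0_norm ?invr_gt0 ?pi_gt0// -mulrA ler_wpM2l//.
  by rewrite invr_ge0 pi_ge0.
rewrite /cos_transform -RintegralBT; [|exact: summable_cosM..].
rewrite mulrC mulrA -RintegralZT//.
have mc r := summable_measurable (summable_cosM r si).
apply: normr_Rintegral_le; [exact: measurable_funB|exact: summableZ|].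
move=> w; rewrite -mulrBl normrM (ger0_norm (indic_ge0 _ _)).
rewrite indicE; case: (boolP (w \in _)) => [|_]; rewrite ?mulr0//.
rewrite inE/= in_itv/= !mulr1 => /andP[w0 wl].
have := @mean_value_le _ (fun r => cos (w * r)) (fun r => - sin (w * r) * w) s s' w
  (fun r => is_derive_cosf (is_derive_linear w r)).
rewrite ![w * _]mulrC => /(_ _)/le_trans; apply.
  by move=> z _; rewrite normrM normrN (ger0_norm w0) ler_piMl// sin_max.
by rewrite ler_wpM2l.
Qed.

Lemma continuous_hermite_kernel n x : continuous (hermite_kernel n x).
Proof.
elim: n => [|n ih].
  rewrite (_ : hermite_kernel 0 x = fun y => h 0 x * h 0 y); last first.
    by apply/funext => y; rewrite /hermite_kernel/= big_seq1.
  by move=> y; apply: cvgMl_tmp; exact: continuous_hermite.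
rewrite (_ : hermite_kernel n.+1 x = fun y => hermite_kernel n x y + h n.+1 x * h n.+1 y).
  by move=> y; apply: cvgD; [exact: ih|apply: cvgMl_tmp; exact: continuous_hermite].
by apply/funext => y; exact: hermite_kernelS.
Qed.

Lemma continuous_band_kernel l : 0 <= l -> continuous (band_kernel l).
Proof.
move=> l0 s; set c := pi^-1 * (l * I \1_`[0, l]).
have c0 : 0 <= c.
  rewrite /c mulr_ge0 ?invr_ge0 ?pi_ge0// mulr_ge0//.
  by apply: Rintegral_ge0T => w; exact: indic_ge0.
apply/cvgrPdist_le => e e0; near=> s'.
apply: (le_trans (band_kernel_lipschitz _ _ l0)); rewrite -/c.
have : `|s - s'| <= e / (c + 1).
  near: s'; apply: (@cvgr_dist_le _ _ _ _ _ id s) => //.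
  by rewrite divr_gt0// ltr_wpDl.
rewrite ler_pdivlMr ?ltr_wpDl// => /(le_trans _); apply.
by rewrite mulrC ler_wpM2l// lerDl.
Unshelve. all: by end_near. Qed.

Lemma kernel_estimate_off_diagonal n T x y (l := Num.sqrt (2 * n%:R + 1)) :
  2 <= T -> 34 * T ^+ 3 <= l -> `|x| <= T -> `|y| <= T -> x != y ->
  `|hermite_kernel n x y - band_kernel l (x - y)| <= 17 * T ^+ 2 / l.
Proof.
move=> T2 Tl xT yT xy; have pi0 := pi_gt0 R; have pi2 := @pi_ge2 R.
have T3 : 4 * T <= T ^+ 3 by rewrite exprS expr2 mulrC ler_wpM2l//; nra.
have l272 : 272 <= l by lra.
have l0 : 0 < l by lra.
have lE' : l ^+ 2 = 2 * n%:R + 1.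
  by rewrite /l sqr_sqrtr// addr_ge0// mulr_ge0.
have lE : l ^+ 2 = (2 * n + 1)%:R by rewrite lE' natrD natrM.
have n0 : (0 < n)%N.
  by case: (n) lE' => // lE0; exfalso; move: lE0; rewrite mulr0 add0r; nra.
(* The amplitude for which t sin (l (x - y)) equals 2 l (x - y) times the sinc kernel. *)
pose t := 2 * l / pi.
have tl : t <= l by rewrite /t ler_pdivrMr// mulrC ler_wpM2l// ltW.
(* The Wallis estimate bounds the difference by t / (2 n), at most l / (l^2 - 1) as 2 n = l^2 -
   1. *)
have E0t : `|hermite_energy0 n - t| <= 2 / l.
  have := hermite_energy0_approx n0 l0 lE; rewrite -/t natrM => e1.
  rewrite ler_pdivlMr//; have := normr_ge0 (hermite_energy0 n - t).
  move: e1; move: `|_| => a e1 a0.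
  have : a * (2 * n%:R) <= l by lra.
  rewrite (_ : 2 * n%:R = l ^+ 2 - 1); last by rewrite lE'; ring.
  nra.
have dd z : is_derive z (1 : R) (hermite_der n) ((z ^+ 2 - l ^+ 2) * h n z).
  by rewrite lE; exact: is_derive_hermite_der.
have EE : hermite_der n 0 ^+ 2 + l ^+ 2 * h n 0 ^+ 2 = hermite_energy0 n.
  by rewrite /hermite_der mul0r add0r lE.
have T0 : 0 <= T by lra.
have Tl' : T < l by lra.
rewrite -EE in E0t.
have [w1 w2] := wronskian_estimate (hermite_raise n) dd T0 Tl' T2 Tl tl E0t xT yT.
have D0 : 0 < `|x - y| by rewrite normr_gt0 subr_eq0.
set K := hermite_kernel n x y; set b := band_kernel l (x - y).
have e : 2 * l * (x - y) * (K - b) =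
    (l * (h n x * hermite_der n y - hermite_der n x * h n y) - t * sin (l * (x - y))) +
    l * (x - y) * (h n x * h n y).
  have -> : 2 * l * (x - y) * (K - b) = l * (2 * (x - y) * K) - 2 * l * (x - y) * b.
    by ring.
  rewrite christoffel_darboux_der -(band_kernelE _ (ltW l0)) -/b.
  rewrite (_ : t * (pi * (x - y) * b) = 2 * l * (x - y) * b); first by ring.
  by rewrite /t; move: pi0; move: (pi : R) => p p0; field; rewrite gt_eqF.
have : `|2 * l * (x - y) * (K - b)| <= 12 * T ^+ 2 * `|x - y| + 2 * `|x - y|.
  rewrite e (le_trans (ler_normD _ _))// lerD// normrM [`|l * _|]normrM gtr0_norm//.
  have -> : 2 * `|x - y| = l * `|x - y| * (2 / l) by field; rewrite gt_eqF.
  by rewrite ler_wpM2l// mulr_ge0// ltW.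
rewrite normrM [`|2 * l * _|]normrM (gtr0_norm (_ : 0 < 2 * l)) ?mulr_gt0//.
(* Cancelling |x - y| leaves 2 l times the error at most 12 T^2 + 2, which is the bound (6 T^2 + 1)
   / l. *)
rewrite -mulrDl mulrAC ler_pM2r// => le1.
rewrite ler_pdivlMr// mulrC; move: le1; nra.
Qed.

(** On the diagonal the bound is the limit of the off-diagonal one, both kernels being
    continuous. *)
Lemma kernel_estimate n T x y (l := Num.sqrt (2 * n%:R + 1)) :
  2 <= T -> 34 * T ^+ 3 <= l -> `|x| <= T -> `|y| <= T ->
  `|hermite_kernel n x y - band_kernel l (x - y)| <= 17 * T ^+ 2 / l.
Proof.
move=> T2 Tl xT yT; have [xy|xy] := eqVneq x y; last exact: kernel_estimate_off_diagonal.
subst y; have l0 : 0 <= l := sqrtr_ge0 _.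
pose F y : R := `|hermite_kernel n x y - band_kernel l (x - y)|.
have cF : F y @[y --> x] --> F x.
  apply: cvg_norm; apply: cvgB; first exact: continuous_hermite_kernel.
  apply: continuous_cvg; first exact: continuous_band_kernel.
  by apply: cvgB; [exact: cvg_cst|exact: cvg_id].
(* The approach is from the side of the origin, so that the points [u k] stay in [-T, T] even when x
   is an endpoint. *)
pose sg : R := if 0 <= x then 1 else - 1.
pose u k := x - sg * k.+1%:R^-1.
have cu : u k @[k --> \oo] --> x.
  rewrite -[X in _ --> X]subr0; apply: cvgB; first exact: cvg_cst.
  by rewrite -[X in _ --> X](mulr0 sg); apply: cvgMl_tmp; exact: cvg_harmonic.
have cFu : F (u k) @[k --> \oo] --> F x by exact: (cvg_comp u F cu cF).
pose c : R := 17 * T ^+ 2 / l.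
have cc : (fun _ : nat => c) @ \oo --> c by exact: cvg_cst.
apply: (ler_cvg_to cFu cc); apply: nearW => k.
have k0 : 0 < k.+1%:R^-1 :> R by rewrite invr_gt0.
have k1 : k.+1%:R^-1 <= 1 :> R by rewrite invf_le1// ler1n.
apply: kernel_estimate_off_diagonal => //; rewrite /u /sg;
  move: k0 k1; move: (k.+1%:R^-1 : R) => e e0 e1.
  move: xT; rewrite !ler_norml => /andP[x1 x2]; case: (leP 0 x) => x0;
    by apply/andP; split; lra.
by apply/eqP; case: (leP 0 x) => x0; lra.
Qed.

End HermiteKernel.

(** * Projection error of band-limited functions *)

Section BandLimitedPart.
Context {R : realType}.
Local Notation mu := (@lebesgue_measure R).
Local Notation L1 := (summable mu).
Local Notation L2 := (sqsummable mu).
Local Notation h := (@hermite_fun R).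
Local Notation "'I' f" := (Rintegral mu [set: R] f) (at level 10, f at level 8).
Implicit Types (a b : R -> R) (x y w l s t T : R) (n : nat).

Lemma indic_le1 (D : set R) x : \1_D x <= 1 :> R.
Proof. by rewrite indicE; case: (_ \in _). Qed.

(** For real [a], the energy of its Fourier transform on |w| > l, written over positive frequencies
    only. *)
Definition spectral_tail l a :=
  pi^-1 * I (fun w => \1_half w * (1 - \1_`[0, l] w) * spectral_product a a w).

Lemma summable_kernelM n x a : L2 a -> L1 (fun y => hermite_kernel n x y * a y).
Proof.
move=> qa; rewrite /hermite_kernel; under eq_fun do rewrite mulr_suml.
apply: summable_sum => k; under eq_fun do rewrite -mulrA.
exact/summableZ/summable_mul/qa/sqsummable_hermite.
Qed.

Lemma projE n a x : L2 a -> proj n a x = I (fun y => hermite_kernel n x y * a y).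
Proof.
move=> qa; have sk k := summable_mul (sqsummable_hermite k) qa.
transitivity (I (fun y => \sum_(k <- iota 0 n.+1) h k x * (h k y * a y))).
  rewrite Rintegral_sumT; last by move=> k; exact: summableZ.
  by apply: eq_bigr => k _; rewrite RintegralZT// mulrC ipC.
apply: eq_RintegralT => y; rewrite /hermite_kernel mulr_suml.
by apply: eq_bigr => k _; rewrite mulrA.
Qed.

Let measurable_band l : measurable_fun [set: measurableTypeR R * measurableTypeR R]
  (fun z => cos_transform \1_`[0, l] (z.1 - z.2)).
Proof.
apply: (measurableT_comp (measurable_cos_transform (indic_seg_summable l))).
exact: measurable_funB.
Qed.

Let band_bound l (z : measurableTypeR R * measurableTypeR R) :=
  normr_cos_transform (z.1 - z.2) (@indic_seg_summable R l).

Lemma summable_band_kernelM l x b : L1 b -> L1 (fun y => band_kernel l (x - y) * b y).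
Proof.
move=> sb; under eq_fun do rewrite /band_kernel -mulrA; apply: summableZ.
exact: (summable_kernel1 (@measurable_band l) (band_bound l) x sb).
Qed.

Let Rintegral_band l x b : L1 b -> I (fun y => band_kernel l (x - y) * b y) =
  pi^-1 * I (fun y => cos_transform \1_`[0, l] (x - y) * b y).
Proof.
move=> sb; rewrite -RintegralZT.
  by apply: eq_RintegralT => y; rewrite mulrA.
exact: (summable_kernel1 (@measurable_band l) (band_bound l) x sb).
Qed.

Lemma summable_band_form l a b : L1 a -> L1 b ->
  L1 (fun x => a x * I (fun y => band_kernel l (x - y) * b y)).
Proof.
move=> sa sb; under eq_fun do rewrite Rintegral_band// mulrCA; apply: summableZ.
exact: (summable_kernel_integral (@measurable_band l) (band_bound l) sa sb).
Qed.

Lemma band_part l a b : L1 a -> L1 b ->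
  pi^-1 * I (fun w => \1_`[0, l] w * spectral_product a b w) =
  I (fun x => a x * I (fun y => band_kernel l (x - y) * b y)).
Proof.
move=> sa sb; rewrite (multiplier_kernel (indic_seg_summable l) sa sb).
rewrite -RintegralZT.
  by apply: eq_RintegralT => x; rewrite Rintegral_band// mulrCA.
exact: (summable_kernel_integral (@measurable_band l) (band_bound l) sa sb).
Qed.

(** Cauchy-Schwarz against the indicator of the segment, whose integral is 2 T. *)
Lemma sqr_L1_segment_le a T : 0 < T -> L2 a ->
  (forall x, a x = \1_`[(- T), T] x * a x) ->
  I (fun x => `|a x|) ^+ 2 <= 2 * T * ip mu a a.
Proof.
move=> T0 qa aT; have sa := summable_L2_segment qa aT.
have sD : L1 (\1_`[(- T), T] : R -> R) by exact: (summable_indic_itv (- T, T)).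
have ID : I \1_`[(- T), T] = 2 * T.
  have TT : - T <= T by lra.
  have := @Rintegral_seg R id (fun=> 1) (- T) T TT (fun x => cvg_cst _) (fun x => is_derive_id x _).
  under eq_RintegralT do rewrite mulr1.
  by move=> ->; ring.
(* [c] is the mean of |a|; the integral of (|a| - c)^2 over the segment is nonnegative. *)
set A := I (fun x => `|a x|); pose c := A / (2 * T).
have sqa : L1 (fun x => a x * a x) by exact: summable_mul.
have : 0 <= I (fun x => a x * a x - (2 * c) * `|a x| + c ^+ 2 * \1_`[(- T), T] x).
  apply: Rintegral_ge0T => x; rewrite aT indicE; case: (_ \in _) => /=.
    rewrite !mul1r mulr1 -expr2 -[a x ^+ 2]real_normK ?num_real//.
    by have := sqr_ge0 (`|a x| - c); lra.
  by rewrite !mul0r normr0 !mulr0 subr0 addr0.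
rewrite RintegralDT; [|apply: summableB => //; apply: summableZ; exact: summable_norm|exact: summableZ].
rewrite RintegralBT//; last by apply: summableZ; exact: summable_norm.
rewrite RintegralZT; last exact: summable_norm.
rewrite RintegralZT// ID -/A -/(ip mu a a).
have cE : A = 2 * T * c by rewrite /c; field; rewrite gt_eqF.
rewrite cE => h; have : 0 <= 2 * T * (ip mu a a - 2 * c * (2 * T * c) + c ^+ 2 * (2 * T)).
  by rewrite mulr_ge0// mulr_ge0// ltW.
by lra.
Qed.

(** The free weights t and s stand for two uses of Cauchy-Schwarz. The bound stays linear in the
    squared norms, so the real and imaginary parts can be added before the weights are fixed. *)
Lemma band_limited_estimate n T a b t s (l := Num.sqrt (2 * n%:R + 1)) :
  2 <= T -> 34 * T ^+ 3 <= l -> L2 a -> L2 b ->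
  (forall x, a x = \1_`[(- T), T] x * a x) ->
  (forall x, b x = \1_`[(- T), T] x * b x) -> 0 < t -> 0 < s ->
  ip mu a b - ip mu (proj n a) b <=
    2^-1 * (t * spectral_tail l a + t^-1 * ip mu b b) +
    2^-1 * (34 * T ^+ 3 / l) * (s * ip mu a a + s^-1 * ip mu b b).
Proof.
move=> T2 Tl qa qb aT bT t0 s0.
have sa := summable_L2_segment qa aT; have sb := summable_L2_segment qb bT.
have T0 : 0 < T by lra.
have pi0 := pi_gt0 R; have ipi0 : 0 < pi^-1 :> R by rewrite invr_gt0.
have l0 : 0 <= l := sqrtr_ge0 _.
pose tail w := \1_half w * (1 - \1_`[0, l] w) : R.
have halfI w : \1_half w * \1_`[0, l] w = \1_`[0, l] w :> R.
  rewrite !indicE; case: (boolP (w \in `[0, l]%classic)) => [|_]; last by rewrite mulr0.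
  by rewrite inE/= in_itv/= => /andP[w0 _]; rewrite mem_set// mulr1.
have tail0 w : 0 <= tail w.
  by apply: mulr_ge0; rewrite ?subr_ge0 ?indic_le1 ?indic_ge0.
have tailh w : tail w <= \1_half w.
  by rewrite /tail ler_piMr ?indic_ge0// gerBl indic_ge0.
have tail1 w : `|tail w| <= 1.
  by rewrite ger0_norm// (le_trans (tailh w))// indic_le1.
have mi : measurable_fun [set: measurableTypeR R] (\1_`[0, l] : R -> R).
  exact: summable_measurable (indic_seg_summable l).
have mtail : measurable_fun [set: measurableTypeR R] tail.
  apply: measurable_funM; first exact: measurable_indic_half.
  exact: measurable_funB.
have stail f g : L1 f -> L2 f -> L1 g -> L2 g -> L1 (fun w => tail w * spectral_product f g w).
  move=> sf qf sg qg.
  have := summableMb mtail tail1 (summable_half_spectral sf qf sg qg).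
  rewrite (_ : (fun x => _) = (fun w => tail w * spectral_product f g w))//.
  apply/funext => w; rewrite mulrA; congr (_ * _); rewrite /tail.
  by rewrite mulrAC -[RHS]mulrC mulrC; congr (_ * _); rewrite !indicE; case: (_ \in _); rewrite ?mulr1 ?mulr0.
have sband : L1 (fun w => \1_`[0, l] w * spectral_product b a w).
  by apply: summable_weightM => //; exact: indic_seg_summable.
(* Parseval split at frequency l. The band part is written with [b] first, so that [band_part] lets
   the sinc kernel act on [a], as the Hermite kernel does in the projection. *)
have ipE : ip mu a b = pi^-1 * I (fun w => tail w * spectral_product a b w) +
    pi^-1 * I (fun w => \1_`[0, l] w * spectral_product b a w).
  rewrite -mulrDr -RintegralDT//; last exact: stail.
  rewrite (_ : I _ = pi * ip mu a b); first by rewrite mulrA mulVf ?mul1r// gt_eqF.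
  rewrite -(parseval_segment qa qb aT bT); apply: eq_RintegralT => w.
  rewrite [spectral_product b a w](_ : _ = spectral_product a b w); last first.
    by rewrite /spectral_product; ring.
  by rewrite -mulrDl /tail mulrBr mulr1 halfI subrK.
have tail_le : pi^-1 * I (fun w => tail w * spectral_product a b w) <=
    2^-1 * (t * spectral_tail l a + t^-1 * ip mu b b).
  have -> : ip mu b b = pi^-1 * spectral_energy b.
    by rewrite (plancherel_segment qb bT) mulrA mulVf ?mul1r// gt_eqF.
  rewrite /spectral_tail -/tail.
  have -> : forall A B : R, 2^-1 * (t * (pi^-1 * A) + t^-1 * (pi^-1 * B)) =
      pi^-1 * (2^-1 * t * A + 2^-1 * t^-1 * B).
    by move=> A B; move: (pi^-1 : R) (t^-1) => p q; ring.
  have [sha _] := spectral_energy_le sa qa; have [shb _] := spectral_energy_le sb qb.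
  rewrite ler_pM2l// -RintegralZT; last exact: stail.
  rewrite -RintegralZT// -RintegralDT; [|exact/summableZ/stail|exact: summableZ].
  apply: le_RintegralT; first exact: stail.
    by apply: summableD; apply: summableZ => //; exact: stail.
  move=> w.
  (* For [b] the whole energy is allowed; it becomes the squared norm by Plancherel. *)
  have b_le : tail w * spectral_product b b w <= \1_half w * spectral_product b b w.
    by rewrite ler_wpM2r ?spectral_product_ge0.
  apply: (@le_trans _ _ (2^-1 * t * (tail w * spectral_product a a w) +
    2^-1 * t^-1 * (tail w * spectral_product b b w))); last first.
    by rewrite lerD2l ler_wpM2l// mulr_ge0 ?invr_ge0// ltW.
  have -> : forall A B : R, 2^-1 * t * (tail w * A) + 2^-1 * t^-1 * (tail w * B) =
      tail w * (2^-1 * t * A + 2^-1 * t^-1 * B) by move=> A B; ring.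
  rewrite ler_wpM2l// -subr_ge0 /spectral_product.
  move: (cos_transform a w) (sin_transform a w) (cos_transform b w) (sin_transform b w).
  move=> p q u v.
  rewrite (_ : _ - _ = 2^-1 * t^-1 * ((t * p - u) ^+ 2 + (t * q - v) ^+ 2)).
    by rewrite mulr_ge0 ?mulr_ge0 ?invr_ge0 ?(ltW t0)// addr_ge0 ?sqr_ge0.
  by field; rewrite gt_eqF.
pose c := 17 * T ^+ 2 / l.
have c0 : 0 <= c by rewrite divr_ge0// mulr_ge0// sqr_ge0.
pose A := I (fun x => `|a x|); pose B := I (fun x => `|b x|).
have rest_le : pi^-1 * I (fun w => \1_`[0, l] w * spectral_product b a w) -
    ip mu (proj n a) b <= c * (A * B).
  rewrite band_part//.
  have projM : ip mu (proj n a) b = I (fun x => b x * proj n a x).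
    by apply: eq_RintegralT => x; rewrite mulrC.
  have s1 : L1 (fun x => b x * proj n a x) by exact: summable_mul qb (sqsummable_proj n a).
  have s2 : L1 (fun x => b x * I (fun y => band_kernel l (x - y) * a y)).
    exact: summable_band_form.
  rewrite projM -RintegralBT//.
  apply: (le_trans (ler_norm _)); rewrite mulrA /B -RintegralZT; last exact: summable_norm.
  apply: normr_Rintegral_le.
  - exact: summable_measurable (summableB s2 s1).
  - exact/summableZ/summable_norm.
  move=> x; rewrite -mulrBr bT -mulrA.
  rewrite indicE; case: (boolP (x \in _)) => [|_]; last by rewrite !mul0r normr0 mulr0.
  rewrite inE/= in_itv/= -ler_norml !mul1r => xT.
  rewrite normrM mulrC ler_wpM2r// projE// -RintegralBT; first last.
  - exact: summable_kernelM.
  - exact: summable_band_kernelM.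
  rewrite /A -RintegralZT; last exact: summable_norm.
  apply: normr_Rintegral_le.
  - apply: summable_measurable (summableB _ _).
      exact: (summable_band_kernelM l x sa).
    exact: summable_kernelM.
  - exact/summableZ/summable_norm.
  move=> y; rewrite -mulrBl aT indicE.
  case: (boolP (y \in _)) => [|_]; last by rewrite mul0r mulr0 normr0 mulr0.
  rewrite inE/= in_itv/= -ler_norml !mul1r => yT.
  by rewrite normrM ler_wpM2r// distrC; exact: kernel_estimate.
(* Each squared L^1 norm costs 2 T and the weighted mean costs 1 / 2. Multiplied by the 17 T^2 / l
   of the kernel, this is half of 34 T^3 / l. *)
have AB : A * B <= T * (s * ip mu a a + s^-1 * ip mu b b).
  have hA := sqr_L1_segment_le T0 qa aT; have hB := sqr_L1_segment_le T0 qb bT.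
  rewrite -/A -/B in hA hB.
  have h1 : s * A ^+ 2 <= s * (2 * T * ip mu a a) by rewrite ler_wpM2l// ltW.
  have h2 : s^-1 * B ^+ 2 <= s^-1 * (2 * T * ip mu b b) by rewrite ler_wpM2l// invr_ge0 ltW.
  have h3 : 0 <= s^-1 * (s * A - B) ^+ 2 by rewrite mulr_ge0 ?sqr_ge0// invr_ge0 ltW.
  have e3 : s^-1 * (s * A - B) ^+ 2 = s * A ^+ 2 + s^-1 * B ^+ 2 - 2 * (A * B).
    by field; rewrite gt_eqF.
  rewrite e3 in h3; clear -h1 h2 h3.
  by clearbody A B; move: (ip mu a a) (ip mu b b) (s^-1) h1 h2 h3 => *; lra.
have cAB : c * (A * B) <= c * (T * (s * ip mu a a + s^-1 * ip mu b b)) by rewrite ler_wpM2l.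
have cE : forall X : R, 2^-1 * (34 * T ^+ 3 / l) * X = c * (T * X).
  by move=> X; rewrite /c; move: (l^-1) => il; field.
rewrite ipE cE -addrA; apply: lerD tail_le _; exact: le_trans rest_le cAB.
Qed.

End BandLimitedPart.

(** * Complex-valued functions *)

Section FourierL2.
Context {R : realType}.
Local Notation mu := (@lebesgue_measure R).
Local Notation L1 := (summable mu).
Local Notation cL2 := (csqsummable mu).
Local Notation "'I' f" := (Rintegral mu [set: R] f) (at level 10, f at level 8).
Local Notation Re := complex.Re.
Local Notation Im := complex.Im.
Local Notation C := (@cos_transform R).
Local Notation S := (@sin_transform R).
Implicit Types (F G : R -> R[i]) (w x : R) (D : set R).

Lemma sqr_cabs (z : R[i]) : cabs z ^+ 2 = Re z ^+ 2 + Im z ^+ 2.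
Proof. by case: z => a b; rewrite /cabs /= sqr_sqrtr// addr_ge0 ?sqr_ge0. Qed.

Lemma measurable_sqr_cabs F : cmeasurable F ->
  measurable_fun [set: measurableTypeR R] (fun x => cabs (F x) ^+ 2).
Proof.
move=> [mr mi]; under eq_fun do rewrite sqr_cabs.
by apply: measurable_funD; exact: measurable_funX.
Qed.

Lemma Rintegral_sqr_cabs F : cL2 F -> I (fun x => cabs (F x) ^+ 2) = rip mu F F.
Proof.
move=> [[_ sr] [_ si]]; under eq_RintegralT do rewrite sqr_cabs.
by rewrite RintegralDT//; congr (_ + _); apply: eq_RintegralT => x; rewrite expr2.
Qed.

Lemma summable_sqr_cabs F : cL2 F -> L1 (fun x => cabs (F x) ^+ 2).
Proof.
by move=> [[_ sr] [_ si]]; under eq_fun do rewrite sqr_cabs; exact: summableD.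
Qed.

Lemma csqsummableP F : cmeasurable F -> L1 (fun x => cabs (F x) ^+ 2) -> cL2 F.
Proof.
move=> [mr mi] s; split; split => //.
  apply: (summable_le _ s); first exact: measurable_funX.
  by move=> x; rewrite sqr_cabs ger0_norm ?sqr_ge0// lerDl sqr_ge0.
apply: (summable_le _ s); first exact: measurable_funX.
by move=> x; rewrite sqr_cabs ger0_norm ?sqr_ge0// lerDr sqr_ge0.
Qed.

Lemma isL2_csqsummable F : isL2 F -> cL2 F.
Proof.
move=> [mF lty]; apply: csqsummableP => //.
apply: summableP; first exact: measurable_sqr_cabs.
under eq_integral do rewrite ger0_norm ?sqr_ge0//.
by apply: lty_poweRy lty; rewrite invr_eq0.
Qed.

Lemma L2normE F : cL2 F -> L2norm [set: R] F = (cnorm mu F)%:E.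
Proof.
move=> hF; rewrite /L2norm Rintegral_EFin; last exact: summable_sqr_cabs.
by rewrite poweR_EFin Rintegral_sqr_cabs// powR12_sqrt// rip_ge0.
Qed.

(** Multiplying by an indicator, rather than restricting integrals, keeps all norms on the whole
    line, where the triangle inequality is available. *)
Definition cut D F x : R[i] := (\1_D x)%:C%C * F x.

Lemma Re_cut D F x : Re (cut D F x) = \1_D x * Re (F x).
Proof. by rewrite /cut; case: (F x) => a b /=; ring. Qed.

Lemma Im_cut D F x : Im (cut D F x) = \1_D x * Im (F x).
Proof. by rewrite /cut; case: (F x) => a b /=; ring. Qed.

Lemma csqsummable_cut D F : measurable (D : set (measurableTypeR R)) -> cL2 F -> cL2 (cut D F).
Proof.
move=> mD [hr hi]; split.
  by under eq_fun do rewrite Re_cut; exact: sqsummable_indic.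
by under eq_fun do rewrite Im_cut; exact: sqsummable_indic.
Qed.

Lemma integral_sqr_cabs_cut D F : measurable (D : set (measurableTypeR R)) -> cL2 F ->
  (\int[mu]_(x in D) (cabs (F x) ^+ 2)%:E = (cnorm mu (cut D F) ^+ 2)%:E)%E.
Proof.
move=> mD hF; have hc := csqsummable_cut mD hF.
rewrite sqr_cnorm -Rintegral_sqr_cabs// -Rintegral_EFin; last exact: summable_sqr_cabs.
rewrite [LHS]integral_mkcond; apply: eq_integral => x _.
rewrite patchE; case: (boolP (x \in D)) => xD; rewrite [cabs (cut _ _ _) ^+ 2]sqr_cabs Re_cut Im_cut indicE.
  by rewrite xD !mul1r sqr_cabs.
by rewrite (negbTE xD) !mul0r expr0n addr0.
Qed.

Lemma L2norm_cut D F : measurable (D : set (measurableTypeR R)) -> cL2 F ->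
  L2norm D F = (cnorm mu (cut D F))%:E.
Proof.
move=> mD hF; rewrite /L2norm integral_sqr_cabs_cut// poweR_EFin.
by rewrite powR12_sqrt ?sqr_ge0// sqrtr_sqr ger0_norm// cnorm_ge0.
Qed.

Lemma cnorm_cut_le D F : measurable (D : set (measurableTypeR R)) -> cL2 F ->
  cnorm mu (cut D F) <= cnorm mu F.
Proof.
move=> mD hF; have hc := csqsummable_cut mD hF.
rewrite -(@ler_pXn2r _ 2) ?nnegrE ?cnorm_ge0// !sqr_cnorm.
rewrite -!Rintegral_sqr_cabs//; apply: le_RintegralT; [exact: summable_sqr_cabs..|].
move=> x; rewrite !sqr_cabs Re_cut Im_cut indicE.
by case: (_ \in _); rewrite ?mul1r// !mul0r expr0n addr0 addr_ge0 ?sqr_ge0.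
Qed.

Lemma cut_sub D D' F : D `<=` D' -> measurable (D : set (measurableTypeR R)) ->
  measurable (D' : set (measurableTypeR R)) -> cL2 F ->
  cnorm mu (cut D F) <= cnorm mu (cut D' F).
Proof.
move=> DD' mD mD' hF; have hc := csqsummable_cut mD' hF.
rewrite (_ : cut D F = cut D (cut D' F)); first exact: cnorm_cut_le.
apply/funext => x; rewrite /cut mulrA; congr (_ * _).
rewrite !indicE; case: (boolP (x \in D)) => [|_]; last by rewrite mul0r.
by rewrite inE => /DD' xD'; rewrite mem_set// mul1r.
Qed.

Definition cL1 F := L1 (fun x => Re (F x)) /\ L1 (fun x => Im (F x)).

Lemma isL1_cL1 F : isL1 F -> cL1 F.
Proof.
move=> [[mr mi] lty].
have mc : measurable_fun [set: measurableTypeR R] (fun x => cabs (F x)).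
  rewrite (_ : (fun x => _) = (fun x => Num.sqrt (Re (F x) ^+ 2 + Im (F x) ^+ 2))).
    apply: (measurableT_comp (f := @Num.sqrt R)).
      by apply: continuous_measurable_fun; exact: sqrt_continuous.
    by apply: measurable_funD; exact: measurable_funX.
  by apply/funext => x; rewrite /cabs; case: (F x).
have c0 x : 0 <= cabs (F x) by rewrite /cabs; case: (F x) => a b; exact: sqrtr_ge0.
have sc : L1 (fun x => cabs (F x)).
  by apply: summableP => //; under eq_integral do rewrite ger0_norm//.
have rle (a b : R) : `|a| <= Num.sqrt (a ^+ 2 + b ^+ 2).
  by rewrite -sqrtr_sqr ler_sqrt ?lerDl ?sqr_ge0// addr_ge0 ?sqr_ge0.
have mr' : measurable_fun [set: measurableTypeR R] (fun x => Re (F x)) := mr.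
have mi' : measurable_fun [set: measurableTypeR R] (fun x => Im (F x)) := mi.
split.
  by apply: (summable_le mr' sc) => x; rewrite /cabs; case: (F x) => a b /=; exact: rle.
by apply: (summable_le mi' sc) => x; rewrite /cabs; case: (F x) => a b /=; rewrite addrC; exact: rle.
Qed.

Lemma cL1B F G : cL1 F -> cL1 G -> cL1 (fun x => F x - G x).
Proof.
by move=> [? ?] [? ?]; split; under eq_fun do rewrite raddfB; exact: summableB.
Qed.

Local Notation fcst := ((Num.sqrt (2 * pi))^-1 : R).

Lemma Re_fourier F w : cL1 F -> Re (fourier F w) =
  fcst * (C (fun x => Re (F x)) w + S (fun x => Im (F x)) w).
Proof.
move=> [sr si]; rewrite /fourier /cintegral /=.
rewrite !mul0r subr0; congr (_ * _).
rewrite -RintegralDT; [|exact: summable_cosM|exact: summable_sinM].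
apply: eq_RintegralT => x; case: (F x) => a b /=.
by rewrite cosN sinN mulrC [w * x]mulrC; ring.
Qed.

Lemma Im_fourier F w : cL1 F -> Im (fourier F w) =
  fcst * (C (fun x => Im (F x)) w - S (fun x => Re (F x)) w).
Proof.
move=> [sr si]; rewrite /fourier /cintegral /=.
rewrite !mul0r addr0; congr (_ * _).
rewrite -RintegralBT; [|exact: summable_cosM|exact: summable_sinM].
apply: eq_RintegralT => x; case: (F x) => a b /=.
by rewrite cosN sinN mulrC [w * x]mulrC; ring.
Qed.

End FourierL2.

(** * Energy of the Fourier transform *)

Section FourierEnergy.
Context {R : realType}.
Local Notation mu := (@lebesgue_measure R).
Local Notation L1 := (summable mu).
Local Notation L2 := (sqsummable mu).
Local Notation cL2 := (csqsummable mu).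
Local Notation "'I' f" := (Rintegral mu [set: R] f) (at level 10, f at level 8).
Local Notation Re := complex.Re.
Local Notation Im := complex.Im.
Local Notation C := (@cos_transform R).
Local Notation S := (@sin_transform R).
Implicit Types (F G f : R -> R[i]) (w x l : R) (D : set R).

Let ReB (x y : R[i]) : Re (x - y) = Re x - Re y.
Proof. by case: x y => [? ?] [? ?]. Qed.

Let ImB (x y : R[i]) : Im (x - y) = Im x - Im y.
Proof. by case: x y => [? ?] [? ?]. Qed.

Lemma fourierB F G w : cL1 F -> cL1 G ->
  fourier (fun x => F x - G x) w = fourier F w - fourier G w.
Proof.
move=> hF hG; have hFG := cL1B hF hG; have [F1 F2] := hF; have [G1 G2] := hG.
have eRe : (fun x => Re (F x - G x)) = (fun x => Re (F x) + (-1) * Re (G x)).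
  by apply/funext => x; rewrite ReB mulN1r.
have eIm : (fun x => Im (F x - G x)) = (fun x => Im (F x) + (-1) * Im (G x)).
  by apply/funext => x; rewrite ImB mulN1r.
have sG1 : L1 (fun x => (-1) * Re (G x)) by exact: summableZ.
have sG2 : L1 (fun x => (-1) * Im (G x)) by exact: summableZ.
apply/eqP; rewrite eq_complex; apply/andP; split; apply/eqP.
  rewrite ReB !Re_fourier// eRe eIm (cos_transformD w F1 sG1) (sin_transformD w F2 sG2).
  by rewrite (cos_transformZ _ w G1) (sin_transformZ _ w G2); ring.
rewrite ImB !Im_fourier// eRe eIm (cos_transformD w F2 sG2) (sin_transformD w F1 sG1).
by rewrite (cos_transformZ _ w G2) (sin_transformZ _ w G1); ring.
Qed.

Lemma summable_even (f : R -> R) : measurable_fun [set: measurableTypeR R] f ->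
  (forall x, f (- x) = f x) -> L1 (fun x => \1_half x * f x) -> L1 f.
Proof.
move=> mf ef sf.
have sr := summable_reflect sf.
apply: (summable_le mf (summableD (summable_norm sf) (summable_norm sr))) => x.
rewrite /= ef !normrM -mulrDl ler_peMl// !indicE.
have [x0|x0] := leP 0 x.
  by rewrite (mem_set (_ : half x))// normr1 lerDl.
by rewrite (mem_set (_ : half (- x))) ?normr1 ?lerDr// /half/= oppr_ge0 ltW.
Qed.

(** The spectral energy controls only nonnegative frequencies; the squares of both transforms are
    even, which extends the bound to the line. *)
Lemma sqsummable_transform (a : R -> R) : L1 a -> L2 a -> L2 (C a) /\ L2 (S a).
Proof.
move=> sa qa; have [ha _] := spectral_energy_le sa qa.
have mC := measurable_cos_transform sa; have mS := measurable_sin_transform sa.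
have part (u : R -> R) : measurable_fun [set: measurableTypeR R] u ->
    (forall w, u (- w) ^+ 2 = u w ^+ 2) ->
    (forall w, u w ^+ 2 <= spectral_product a a w) -> L2 u.
  move=> mu_ eu ule; split => //; apply: summable_even => //.
    exact: measurable_funX.
  apply: (summable_le _ ha).
    by apply: measurable_funM; [exact: measurable_indic_half|exact: measurable_funX].
  move=> w; rewrite normrM (ger0_norm (indic_ge0 _ _)) ler_wpM2l ?indic_ge0//.
  by rewrite ger0_norm ?sqr_ge0.
split; apply: part => // w.
- by rewrite cos_transformN.
- by rewrite /spectral_product expr2 lerDl -expr2 sqr_ge0.
- by rewrite sin_transformN// sqrrN.
- by rewrite /spectral_product expr2 lerDr -expr2 sqr_ge0.
Qed.

Lemma csqsummable_fourier F : cL1 F -> cL2 F -> cL2 (fourier F).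
Proof.
move=> hF [q1 q2]; have [s1 s2] := hF.
have [c1 t1] := sqsummable_transform s1 q1; have [c2 t2] := sqsummable_transform s2 q2.
split.
  under eq_fun do rewrite Re_fourier//.
  by apply: sqsummableZ; exact: sqsummableD.
under eq_fun do rewrite Im_fourier//.
by apply: sqsummableZ; exact: sqsummableB.
Qed.

(* The cross terms between real and imaginary parts are odd in the frequency, so they
   cancel when [w] and [- w] are added. *)
Lemma fourier_energy_fold F D : cL1 F -> cL2 F -> measurable (D : set (measurableTypeR R)) ->
  (forall w, \1_D (- w) = \1_D w :> R) ->
  cnorm mu (cut D (fourier F)) ^+ 2 = pi^-1 * I (fun w => \1_half w * (\1_D w *
    (spectral_product (fun x => Re (F x)) (fun x => Re (F x)) w +
     spectral_product (fun x => Im (F x)) (fun x => Im (F x)) w))).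
Proof.
move=> hF qF mD eD; have hf := csqsummable_fourier hF qF; have [s1 s2] := hF.
have pi0 := pi_gt0 R.
have hc := csqsummable_cut mD hf.
have sq := summable_sqr_cabs hc.
rewrite sqr_cnorm -Rintegral_sqr_cabs// (Rintegral_fold sq).
set f := (fun w => _ * (_ * (spectral_product _ _ w + _))).
have -> : I (fun w => \1_half w * (cabs (cut D (fourier F) w) ^+ 2 +
    cabs (cut D (fourier F) (- w)) ^+ 2)) = I (fun w => pi^-1 * f w).
  apply: eq_RintegralT => w.
  rewrite !sqr_cabs !Re_cut !Im_cut eD !Re_fourier// !Im_fourier//.
  rewrite !cos_transformN !sin_transformN// /f /spectral_product.
  have c2 : ((Num.sqrt (2 * pi))^-1 : R) ^+ 2 = 2^-1 * pi^-1.
    by rewrite exprVn sqr_sqrtr ?invfM// mulr_ge0// ltW.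
  move: c2; move: ((Num.sqrt (2 * pi))^-1 : R) (pi^-1 : R) => c p c2.
  have -> : p = 2 * c ^+ 2 by rewrite c2; field.
  have i2 : (\1_D w : R) ^+ 2 = \1_D w.
    by rewrite indicE; case: (_ \in _); rewrite ?expr1n ?expr0n.
  rewrite -[in RHS]i2; ring.
have sf : L1 f; last by rewrite RintegralZT.
have [q1 q2] := qF.
have [e1 _] := spectral_energy_le s1 q1; have [e2 _] := spectral_energy_le s2 q2.
rewrite (_ : f = fun w => \1_D w *
  (\1_half w * spectral_product (fun x => Re (F x)) (fun x => Re (F x)) w +
   \1_half w * spectral_product (fun x => Im (F x)) (fun x => Im (F x)) w)).
  by apply: summable_indic => //; exact: summableD.
by apply/funext => w; rewrite /f; ring.
Qed.

Lemma cutT F : cut [set: R] F = F.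
Proof. by apply/funext => x; rewrite /cut indicT mul1r. Qed.

(** Rests on the inequality half of Plancherel, so the function need not be carried by a segment. It
    applies to the approximating sequences that define the L^2 transform. *)
Lemma cnorm_fourier_le F : cL1 F -> cL2 F -> cnorm mu (fourier F) <= cnorm mu F.
Proof.
move=> hF qF; have pi0 := pi_gt0 R.
rewrite -(@ler_pXn2r _ 2) ?nnegrE ?cnorm_ge0// -[fourier F]cutT.
rewrite fourier_energy_fold//.
have [s1 s2] := hF; have [q1 q2] := qF.
have [e1 l1] := spectral_energy_le s1 q1; have [e2 l2] := spectral_energy_le s2 q2.
under eq_RintegralT do rewrite indicT mul1r mulrDr.
rewrite RintegralDT// -/(spectral_energy _) -/(spectral_energy _).
rewrite mulrC ler_pdivrMr// sqr_cnorm /rip mulrDl.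
have ipE (f : R -> R) : ip mu f f * pi = pi * I (fun x => f x ^+ 2).
  by rewrite mulrC; congr (_ * _); apply: eq_RintegralT => x; rewrite expr2.
by rewrite !ipE lerD.
Qed.

Lemma measurable_gt_norm l : measurable ([set x | l < `|x|] : set (measurableTypeR R)).
Proof.
have mn : measurable_fun [set: measurableTypeR R] (fun x : R => `|x|).
  exact: measurableT_comp.
rewrite -[X in measurable X]setTI; have := mn measurableT _ (measurable_itv `]l, +oo[).
by congr measurable; apply/seteqP; split => x /=; rewrite in_itv/= andbT.
Qed.

Lemma fourier_tail F l : 0 <= l -> cL1 F -> cL2 F ->
  cnorm mu (cut [set w | l < `|w|] (fourier F)) ^+ 2 =
  spectral_tail l (fun x => Re (F x)) + spectral_tail l (fun x => Im (F x)).
Proof.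
move=> l0 hF qF; set D := [set w | l < `|w|].
have mD : measurable (D : set (measurableTypeR R)) := measurable_gt_norm l.
rewrite fourier_energy_fold//; last first.
  move=> w; rewrite !indicE; have -> // : (- w \in D) = (w \in D).
  by apply/idP/idP; rewrite !inE /D/= normrN.
have [s1 s2] := hF; have [q1 q2] := qF.
have hD w : \1_half w * \1_D w = \1_half w * (1 - \1_`[0, l] w) :> R.
  rewrite !indicE; case: (boolP (w \in half)) => [|_]; last by rewrite !mul0r.
  rewrite inE /half/= => w0; rewrite !mul1r.
  have -> : (w \in D) = (l < w) by apply/idP/idP; rewrite inE /D/= ger0_norm.
  have -> : (w \in `[0, l]%classic) = (w <= l).
    by apply/idP/idP; rewrite inE/= in_itv/= w0.
  by case: ltP => _; rewrite /= ?subr0 ?subrr.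
have st (a : R -> R) : L1 a -> L2 a ->
    L1 (fun w => \1_half w * (1 - \1_`[0, l] w) * spectral_product a a w).
  move=> sa qa; have [e _] := spectral_energy_le sa qa.
  have := summable_indic mD e.
  rewrite (_ : (fun x => _) = (fun w => \1_half w * (1 - \1_`[0, l] w) * spectral_product a a w))//.
  by apply/funext => w; rewrite -hD; ring.
rewrite /spectral_tail -mulrDr -RintegralDT; [|exact: st..].
congr (_ * _); apply: eq_RintegralT => w.
by rewrite -mulrDr -hD mulrA.
Qed.

End FourierEnergy.

(** * The Hermite residual on a segment *)

Section HermiteResidual.
Context {R : realType}.
Local Notation mu := (@lebesgue_measure R).
Local Notation L2 := (sqsummable mu).
Local Notation cL2 := (csqsummable mu).
Local Notation Re := complex.Re.
Local Notation Im := complex.Im.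
Implicit Types (F G : R -> R[i]) (a b : R -> R) (T : R) (n : nat).

Lemma projB n a b x : L2 a -> L2 b ->
  proj n (fun x => a x - b x) x = proj n a x - proj n b x.
Proof.
move=> qa qb; rewrite /proj -sumrB; apply: eq_bigr => k _.
by rewrite ipBl// ?mulrBl//; exact: sqsummable_hermite.
Qed.

(** Hermite functions are real, so the projection acts separately on real and imaginary parts. *)
Lemma Re_hermite_proj n F x :
  Re (hermite_proj n F x) = proj n (fun x => Re (F x)) x.
Proof.
rewrite /hermite_proj /proj raddf_sum -[iota 0 n.+1]/(index_iota 0 n.+1) big_mkord.
apply: eq_bigr => k _; rewrite /inner /cintegral /chermite_fun /= mulr0 subr0.
congr (_ * _); apply: eq_RintegralT => y; case: (F y) => u v /=.
by rewrite oppr0 mulr0 subr0.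
Qed.

Lemma Im_hermite_proj n F x :
  Im (hermite_proj n F x) = proj n (fun x => Im (F x)) x.
Proof.
rewrite /hermite_proj /proj raddf_sum -[iota 0 n.+1]/(index_iota 0 n.+1) big_mkord.
apply: eq_bigr => k _; rewrite /inner /cintegral /chermite_fun /= mulr0 add0r.
congr (_ * _); apply: eq_RintegralT => y; case: (F y) => u v /=.
by rewrite oppr0 mulr0 add0r.
Qed.

Lemma csqsummable_hermite_proj n F : cL2 (hermite_proj n F).
Proof.
split; first by under eq_fun do rewrite Re_hermite_proj; exact: sqsummable_proj.
by under eq_fun do rewrite Im_hermite_proj; exact: sqsummable_proj.
Qed.

Definition hermite_residual n F x := F x - hermite_proj n F x.

Lemma Re_hermite_residual n F x : Re (hermite_residual n F x) =
  Re (F x) - proj n (fun x => Re (F x)) x.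
Proof.
rewrite -Re_hermite_proj /hermite_residual.
by case: (F x) (hermite_proj _ _ _) => [? ?] [? ?].
Qed.

Lemma Im_hermite_residual n F x : Im (hermite_residual n F x) =
  Im (F x) - proj n (fun x => Im (F x)) x.
Proof.
rewrite -Im_hermite_proj /hermite_residual.
by case: (F x) (hermite_proj _ _ _) => [? ?] [? ?].
Qed.

Lemma csqsummable_residual n F : cL2 F -> cL2 (hermite_residual n F).
Proof. by move=> qF; apply: csqsummableB => //; exact: csqsummable_hermite_proj. Qed.

Lemma hermite_residualB n F G x : cL2 F -> cL2 G ->
  hermite_residual n (fun x => F x - G x) x =
  hermite_residual n F x - hermite_residual n G x.
Proof.
move=> [F1 F2] [G1 G2]; apply/eqP; rewrite eq_complex; apply/andP; split; apply/eqP.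
  have ReB (y z : R[i]) : Re (y - z) = Re y - Re z by case: y z => [? ?] [? ?].
  rewrite [in RHS]ReB !Re_hermite_residual ReB.
  by under eq_fun do rewrite ReB; rewrite projB//; ring.
have ImB (y z : R[i]) : Im (y - z) = Im y - Im z by case: y z => [? ?] [? ?].
rewrite [in RHS]ImB !Im_hermite_residual ImB.
by under eq_fun do rewrite ImB; rewrite projB//; ring.
Qed.

Lemma cnorm_residual_le n F : cL2 F -> cnorm mu (hermite_residual n F) <= cnorm mu F.
Proof.
move=> [F1 F2]; rewrite -(@ler_pXn2r _ 2) ?nnegrE ?cnorm_ge0// !sqr_cnorm /rip.
under [X in ip _ X X + _]eq_fun do rewrite Re_hermite_residual.
under [X in _ + ip _ X X <= _]eq_fun do rewrite Im_hermite_residual.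
by apply: lerD; exact: bessel.
Qed.

(** The truncated residual [phi] is tested against itself. This bounds p^2 by p (e + k N), with k =
    34 T^3 / l, and p cancels. *)
Lemma residual_segment_le n T G e N (l := Num.sqrt (2 * n%:R + 1)) :
  2 <= T -> 34 * T ^+ 3 <= l -> cL2 G -> cut `[(- T), T] G = G ->
  0 < e -> 0 < N -> cnorm mu G <= N ->
  cnorm mu (cut [set w | l < `|w|] (fourier G)) <= e ->
  cnorm mu (cut `[(- T), T] (hermite_residual n G)) <= e + 34 * T ^+ 3 / l * N.
Proof.
move=> T2 Tl qG cG e0 N0 GN Ge; have l0 : 0 <= l := sqrtr_ge0 _.
have T0 : 0 < T by lra.
have [q1 q2] := qG.
have c1 x : Re (G x) = \1_`[(- T), T] x * Re (G x) by rewrite -Re_cut cG.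
have c2 x : Im (G x) = \1_`[(- T), T] x * Im (G x) by rewrite -Im_cut cG.
have sG : cL1 G by split; apply: (summable_L2_segment (T := T)).
have mT : measurable (`[(- T), T]%classic : set (measurableTypeR R)) by exact: measurable_itv.
set phi := cut _ _; set p := cnorm mu phi.
have qphi : cL2 phi by exact/csqsummable_cut/csqsummable_residual.
have [f1 f2] := qphi.
have idem (x r : R) : \1_`[(- T), T] x * (\1_`[(- T), T] x * r) = \1_`[(- T), T] x * r.
  by rewrite indicE; case: (_ \in _); rewrite ?mul1r ?mul0r.
(* A zero residual is set apart, since p occurs in the weights and is cancelled at the end. *)
have [p0|pn0] := eqVneq p 0.
  by rewrite p0; apply: addr_ge0; rewrite ?mulr_ge0 ?invr_ge0 ?exprn_ge0// ltW.
have pp : 0 < p by rewrite lt_def pn0 cnorm_ge0.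
have e1 x : Re (phi x) = \1_`[(- T), T] x * Re (phi x) by rewrite /phi Re_cut idem.
have e2 x : Im (phi x) = \1_`[(- T), T] x * Im (phi x) by rewrite /phi Im_cut idem.
(* Being the cut residual, [b] has the same inner product with the full residual as with itself. *)
have diag (a b : R -> R) : L2 a -> L2 b ->
    (forall x, b x = \1_`[(- T), T] x * (a x - proj n a x)) ->
    ip mu b b = ip mu a b - ip mu (proj n a) b.
  move=> qa qb bE; have qp := sqsummable_proj n a.
  rewrite -ipBl//; apply: eq_RintegralT => x; rewrite [b x]bE indicE.
  by case: (_ \in _); rewrite ?mul1r// !mul0r mulr0.
have b1x x : Re (phi x) = \1_`[(- T), T] x * (Re (G x) - proj n (fun x => Re (G x)) x).
  by rewrite /phi Re_cut Re_hermite_residual.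
have b2x x : Im (phi x) = \1_`[(- T), T] x * (Im (G x) - proj n (fun x => Im (G x)) x).
  by rewrite /phi Im_cut Im_hermite_residual.
have d1 := diag _ _ q1 f1 b1x; have d2 := diag _ _ q2 f2 b2x.
(* The weights p / e and p / N balance the two means: e^2 against p^2 gives p e, and N^2 against p^2
   gives p N. *)
have t0 : 0 < p / e by exact: divr_gt0.
have s0 : 0 < p / N by exact: divr_gt0.
have b1 := band_limited_estimate T2 Tl q1 f1 c1 e1 t0 s0.
have b2 := band_limited_estimate T2 Tl q2 f2 c2 e2 t0 s0.
have tailE := fourier_tail l0 sG qG.
have tail_le : spectral_tail l (fun x => Re (G x)) + spectral_tail l (fun x => Im (G x)) <= e ^+ 2.
  by rewrite -tailE ler_pXn2r ?nnegrE ?cnorm_ge0// ltW.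
have N_le : ip mu (fun x => Re (G x)) (fun x => Re (G x)) +
    ip mu (fun x => Im (G x)) (fun x => Im (G x)) <= N ^+ 2.
  by rewrite -/(rip mu G G) -sqr_cnorm ler_pXn2r ?nnegrE ?cnorm_ge0// ltW.
have pE : ip mu (fun x => Re (phi x)) (fun x => Re (phi x)) +
    ip mu (fun x => Im (phi x)) (fun x => Im (phi x)) = p ^+ 2.
  by rewrite sqr_cnorm.
set k := 34 * T ^+ 3 / l in b1 b2 *.
have k0 : 0 <= k by rewrite /k divr_ge0// mulr_ge0// exprn_ge0// ltW.
rewrite -d1 in b1; rewrite -d2 in b2.
move: b1 b2 tail_le N_le pE.
move: (ip mu (fun x => Re (phi x)) _) (ip mu (fun x => Im (phi x)) _).
move: (ip mu (fun x => Re (G x)) _) (ip mu (fun x => Im (G x)) _).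
move: (spectral_tail l (fun x => Re _)) (spectral_tail l (fun x => Im _)).
move=> S1 S2 N1 N2 P1 P2 b1 b2 tail_le N_le pE.
have h1 : p / e * (S1 + S2) <= p / e * e ^+ 2 by rewrite ler_wpM2l// ltW.
have h2 : 2^-1 * k * (p / N * (N1 + N2)) <= 2^-1 * k * (p / N * N ^+ 2).
  by apply: ler_wpM2l; [rewrite mulr_ge0|apply: ler_wpM2l => //; exact: ltW].
have h3 : p / e * e ^+ 2 = p * e by field; rewrite gt_eqF.
have h4 : p / N * N ^+ 2 = p * N by field; rewrite gt_eqF.
have h5 : (p / e)^-1 * (P1 + P2) = p * e by rewrite pE; field; rewrite !gt_eqF.
have h6 : (p / N)^-1 * (P1 + P2) = p * N by rewrite pE; field; rewrite !gt_eqF.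
have : p * p <= p * (e + k * N).
  rewrite -expr2 -pE.
  have h7 : 2^-1 * k * ((p / N)^-1 * (P1 + P2)) = 2^-1 * k * (p * N) by rewrite h6.
  rewrite h4 in h2; move: (p / e) (p / N) ((p / e)^-1) ((p / N)^-1) h1 h2 h3 h5 h7 b1 b2.
  by clear; clearbody k p; move=> *; lra.
by rewrite ler_pM2l.
Qed.

End HermiteResidual.

(** * Stability under truncation and passage to the L^2 transform *)

Section FourierLimit.
Context {R : realType}.
Local Notation mu := (@lebesgue_measure R).
Implicit Types (F G : R -> R[i]) (D : set R).

Lemma cnorm_cutB_le D F G : measurable (D : set (measurableTypeR R)) ->
  csqsummable mu F -> csqsummable mu G ->
  cnorm mu (cut D F) <= cnorm mu (cut D G) + cnorm mu (fun x => F x - G x).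
Proof.
move=> mD qF qG.
have qcF := csqsummable_cut mD qF; have qcG := csqsummable_cut mD qG.
apply: le_trans (cnorm_le_sub qcF qcG) _; rewrite lerD2l.
apply: le_trans (cnorm_cut_le mD (csqsummableB qF qG)).
by rewrite le_eqVlt; apply/orP; left; apply/eqP/eq_cnorm => x; rewrite /cut mulrBr.
Qed.

Lemma cnorm_residualB_le n F G : csqsummable mu F -> csqsummable mu G ->
  cnorm mu (fun x => hermite_residual n F x - hermite_residual n G x) <=
  cnorm mu (fun x => F x - G x).
Proof.
move=> qF qG; apply: le_trans (cnorm_residual_le n (csqsummableB qF qG)).
by rewrite le_eqVlt; apply/orP; left; apply/eqP/eq_cnorm => x; rewrite hermite_residualB.
Qed.

(** The contraction property applies to G - u_k, which is integrable, and k tends to infinity. The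
    approximating sequence behind [Fhat] is eliminated here. *)
Lemma cnorm_fourierL2_le F Fhat G : is_fourierL2 F Fhat -> cL1 G -> csqsummable mu G ->
  cnorm mu (fun w => fourier G w - Fhat w) <= cnorm mu (fun x => F x - G x).
Proof.
rewrite [leRHS]cnorm_distC; move=> [/isL2_csqsummable qF /isL2_csqsummable qFh [u [hu uF uFh]]] sG qG.
have qu k : csqsummable mu (u k) by apply: isL2_csqsummable; case: (hu k).
have su k : cL1 (u k) by apply: isL1_cL1; case: (hu k).
have qfu k := csqsummable_fourier (su k) (qu k).
have qfG := csqsummable_fourier sG qG.
have dn k := csqsummableB (qu k) qF.
have dh k := csqsummableB (qfu k) qFh.
have toR (D : nat -> R -> R[i]) : (forall k, csqsummable mu (D k)) ->
    L2norm [set: R] (D k) @[k --> \oo] --> 0%E -> cnorm mu (D k) @[k --> \oo] --> (0 : R).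
  move=> qD; rewrite (_ : (fun k => _) = (fun k => (cnorm mu (D k))%:E)).
    by move/fine_cvg.
  by apply/funext => k; rewrite L2normE.
have lim : cnorm mu (fun x => G x - F x) + (cnorm mu (fun x => u k x - F x) +
    cnorm mu (fun w => fourier (u k) w - Fhat w)) @[k --> \oo] -->
    cnorm mu (fun x => G x - F x) + (0 + 0).
  apply: cvgD; first exact: cvg_cst.
  by apply: cvgD; [exact: (toR _ dn uF)|exact: (toR _ dh uFh)].
move: lim; rewrite !addr0 => lim; move/cvg_lim : (lim) => <- //.
apply: limr_ge; first by apply/cvg_ex; eexists; exact: lim.
apply: nearW => k.
have h1 : cnorm mu (fun w => fourier G w - Fhat w) <=
    cnorm mu (fun w => fourier G w - fourier (u k) w) +
    cnorm mu (fun w => fourier (u k) w - Fhat w).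
  apply: le_trans (cnormD (csqsummableB qfG (qfu k)) (dh k)).
  by rewrite le_eqVlt; apply/orP; left; apply/eqP/eq_cnorm => w; rewrite addrA subrK.
have h2 : cnorm mu (fun w => fourier G w - fourier (u k) w) <= cnorm mu (fun x => G x - u k x).
  rewrite (_ : (fun w => _) = fourier (fun x => G x - u k x)).
    by apply: cnorm_fourier_le; [exact: cL1B|exact: csqsummableB].
  by apply/funext => w; rewrite fourierB.
have h3 : cnorm mu (fun x => G x - u k x) <=
    cnorm mu (fun x => G x - F x) + cnorm mu (fun x => u k x - F x).
  apply: le_trans (cnormB (csqsummableB qG qF) (dn k)).
  by rewrite le_eqVlt; apply/orP; left; apply/eqP/eq_cnorm => x; rewrite opprB addrA subrK.
apply: le_trans h1 _; rewrite addrA lerD2r; exact: le_trans h2 h3.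
Qed.

End FourierLimit.

(** * The projection estimate for almost time- and band-limited functions *)

Theorem theorem2p5 (R : realType) (Omega0 T0 epsT epsOmega : R)
    (f fhat : R -> R[i])
    (hOmega0 : 2 <= Omega0) (hT0 : 2 <= T0)
    (hepsT : 0 < epsT) (hepsOmega : 0 < epsOmega)
    (hf : isL2 f) (hfhat : is_fourierL2 f fhat)
    (hT : (\int[lebesgue_measure]_(t in [set t : R | (T0 < `|t|)%R])
             (cabs (f t) ^+ 2)%:E
           <= (epsT ^+ 2)%:E * L2norm [set: R] f ^+ 2)%E)
    (hOmega : (\int[lebesgue_measure]_(w in [set w : R | (Omega0 < `|w|)%R])
             (cabs (fhat w) ^+ 2)%:E
           <= (epsOmega ^+ 2)%:E * L2norm [set: R] f ^+ 2)%E)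
    (T : R) (hTT0 : T0 <= T)
    (n : nat) (hn : Num.max (2 * T ^+ 2) (2 * Omega0 ^+ 2) <= n%:R) :
  (L2norm `[(- T)%R, T] (fun x => f x - hermite_proj n f x)%R
   <= (2 * epsT + epsOmega
       + 34 * T ^+ 3 / Num.sqrt (2 * n%:R + 1))%:E * L2norm [set: R] f)%E.
Proof.
have qf := isL2_csqsummable hf; have [_ /isL2_csqsummable qfh _] := hfhat.
have mS : measurable (`[(- T), T]%classic : set (measurableTypeR R)) by exact: measurable_itv.
have mD c : measurable ([set x | c < `|x|] : set (measurableTypeR R)).
  exact: measurable_gt_norm.
have qr := csqsummable_residual n qf.
rewrite (L2normE qf) -/(hermite_residual n f) (L2norm_cut mS qr) -EFinM lee_fin.
move: hT hOmega; rewrite (L2normE qf) (integral_sqr_cabs_cut (mD T0) qf).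
rewrite (integral_sqr_cabs_cut (mD Omega0) qfh) -EFin_expe -!EFinM !lee_fin.
set l := Num.sqrt _ => {}hT {}hOmega.
set N := cnorm (@lebesgue_measure R) f in hT hOmega *.
have N0 : 0 <= N := cnorm_ge0 _ _.
have sqr_le (x y : R) : 0 <= x -> 0 <= y -> x ^+ 2 <= y ^+ 2 * N ^+ 2 -> x <= y * N.
  by move=> x0 y0; rewrite -exprMn ler_pXn2r// nnegrE mulr_ge0.
move: hT => /(sqr_le _ _ (cnorm_ge0 _ _) (ltW hepsT)) hT.
move: hOmega => /(sqr_le _ _ (cnorm_ge0 _ _) (ltW hepsOmega)) hOmega.
have T2 : 2 <= T by lra.
have nn : 0 <= n%:R :> R by exact: ler0n.
have l0 : 0 < l by rewrite sqrtr_gt0; lra.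
have whole : cnorm (@lebesgue_measure R) (cut `[(- T), T] (hermite_residual n f)) <= N.
  exact: le_trans (cnorm_cut_le mS qr) (cnorm_residual_le n qf).
have [Tl|lT] := leP (34 * T ^+ 3) l; last first.
  apply: le_trans whole _; rewrite ler_peMl//.
  have : 1 <= 34 * T ^+ 3 / l by rewrite ler_pdivlMr// mul1r ltW.
  by lra.
(* [residual_segment_le] divides by the bound [N], which must be positive. *)
have [N00|Nn0] := eqVneq N 0.
  by move: whole; rewrite N00 mulr0.
have Np : 0 < N by rewrite lt_def Nn0.
pose g := cut `[(- T), T] f.
have qg : csqsummable (@lebesgue_measure R) g by exact: csqsummable_cut.
have qfg := csqsummableB qf qg.
have gg : cut `[(- T), T] g = g.
  by apply/funext => x; rewrite /g /cut mulrA !indicE; case: (_ \in _); rewrite ?mul1r ?mul0r.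
have gN : cnorm (@lebesgue_measure R) g <= N by exact: cnorm_cut_le.
have fg : cnorm (@lebesgue_measure R) (fun x => f x - g x) <= epsT * N.
  (* The difference f - g is f cut to |x| > T, a set contained in |x| > T0. *)
  apply: le_trans hT; apply: le_trans (cut_sub (D := [set x | T < `|x|]) _ (mD T) (mD T0) qf).
    rewrite le_eqVlt; apply/orP; left; apply/eqP/eq_cnorm => x; rewrite /g /cut !indicE.
    have -> : (x \in [set x | T < `|x|]) = (T < `|x|) by apply/idP/idP; rewrite inE.
    have -> : (x \in `[(- T), T]%classic) = (`|x| <= T).
      by rewrite ler_norml; apply/idP/idP; rewrite inE/= in_itv.
    by case: leP => _; rewrite ?mul1r ?mul0r ?subrr ?subr0.
  by move=> x /=; exact: le_lt_trans.
have sg : cL1 g.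
  have [g1 g2] := qg; have T0p : 0 < T by lra.
  by split; apply: (summable_L2_segment (T := T)) => // x; rewrite -?Re_cut -?Im_cut gg.
have qfg' := csqsummable_fourier sg qg.
have tail : cnorm (@lebesgue_measure R) (cut [set w | l < `|w|] (fourier g)) <= (epsOmega + epsT) * N.
  (* From l^2 = 2 n + 1 and n >= 2 Omega0^2; the tail of [fhat] beyond l is then part of its tail
     beyond Omega0. *)
  have Ol : Omega0 <= l.
    move: hn; rewrite ge_max => /andP[_ hn].
    rewrite -(@ler_pXn2r _ 2) ?nnegrE ?(ltW l0)//; last by lra.
    by rewrite sqr_sqrtr ?addr_ge0 ?mulr_ge0//; have := sqr_ge0 Omega0; lra.
  have h1 := cnorm_cutB_le (mD l) qfg' qfh.
  have h2 : cnorm (@lebesgue_measure R) (cut [set w | l < `|w|] fhat) <= epsOmega * N.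
    apply: le_trans hOmega; apply: (cut_sub _ (mD l) (mD Omega0) qfh).
    by move=> x /=; exact: le_lt_trans.
  have h3 : cnorm (@lebesgue_measure R) (fun w => fourier g w - fhat w) <= epsT * N.
    exact: le_trans (cnorm_fourierL2_le hfhat sg qg) fg.
  by rewrite mulrDl; exact: le_trans h1 (lerD h2 h3).
(* This is the tail of [g] as used by [residual_segment_le]; the second epsT comes from the residual
   of f - g. *)
have e0 : 0 < (epsOmega + epsT) * N by rewrite mulr_gt0 ?addr_gt0.
have main := residual_segment_le T2 Tl qg gg e0 Np gN tail.
have h1 := cnorm_cutB_le mS qr (csqsummable_residual n qg).
have h2 := le_trans (cnorm_residualB_le n qf qg) fg.
apply: le_trans h1 _; apply: le_trans (lerD main h2) _; rewrite -/l.
by rewrite le_eqVlt; apply/orP; left; apply/eqP; move: (_ / l) => k; ring.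
Qed.
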